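(* Let $M=(M^d,g)$ be a compact Riemannian manifold without boundary of dimension $d\ge2$, let $\kappa>0$ and $\lambda\in\{1,-1\}$. Let $(u,v)$ be a sufficiently smooth solution of the Schrödinger-Debye system $$i\partial_tu+\Delta u=uv,\qquad \kappa\,\partial_tv+v=\lambda|u|^2,\qquad u(0,x)=u_0(x),\quad v(0,x)=v_0(x),$$ with $u$ complex-valued and $v$ real-valued. Then $$\frac{d}{dt}\left(\int_M|\nabla u(t)|_g^2\,dg+\int_M|u(t)|^2v(t)\,dg\right)=\frac1\kappa\left(-\int_M|u(t)|^2v(t)\,dg+\lambda\int_M|u(t)|^4\,dg\right).$$
   Context: $\Delta$ is the Laplace-Beltrami operator, $\nabla$ the gradient, $|\cdot|_g$ the norm associated with the metric $g$, and $dg$ the Riemannian volume measure. ''Sufficiently smooth'' means regular enough for the integrals $\int_M|\nabla u(t)|_g^2\,dg$, $\int_M|u(t)|^2v(t)\,dg$ and $\int_M|u(t)|^4\,dg$ and their time derivatives to make sense; in dimension $d=2$ the paper takes the $H^2$-solution with data $u_0,v_0\in H^2(M)$, for which $u\in C([0,T];H^2(M))\cap C^1([0,T];L^2(M))$, and in dimension $d\ge3$ the data are taken regular enough to give a sufficiently smooth solution. *)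

(* Defs.v *)
(* Schrödinger–Debye flows on closed Riemannian manifolds, over MathComp-Analysis. *)
From HB Require Import structures.
From mathcomp Require Export all_boot all_order all_algebra.
From mathcomp Require Export all_classical all_reals all_analysis.
From mathcomp Require Export complex.
Export Order.TTheory GRing.Theory Num.Theory.
Export numFieldNormedType.Exports.

Set Implicit Arguments.
Unset Strict Implicit.
Unset Printing Implicit Defensive.

Local Open Scope classical_set_scope.
Local Open Scope ring_scope.

Definition borel (T : ptopologicalType) := g_sigma_algebraType (@open T).

Section Euclidean.
Variables (R : realType) (d : nat).

Definition partial (k : 'I_d) (f : 'rV[R]_d -> R) (y : 'rV[R]_d) : R :=
  'D_(delta_mx 0 k) f y.

(* Only used on open sets U. *)
Fixpoint diff_upto (n : nat) (U : set 'rV[R]_d) (f : 'rV[R]_d -> R) : Prop :=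
  if n is m.+1 then
    (forall y, U y -> differentiable f y) /\
    (forall k, diff_upto m U (partial k f))
  else forall y, U y -> {for y, continuous f}.

Definition smooth_on (U : set 'rV[R]_d) (f : 'rV[R]_d -> R) : Prop :=
  forall n, diff_upto n U f.

(* These values on boxes determine a Borel measure on R^d. *)
Definition is_lebesgue
    (lam : {measure set (borel 'rV[R]_d) -> \bar R}) : Prop :=
  forall a b : 'rV[R]_d, (forall k, a 0 k <= b 0 k) ->
    lam [set y | forall k, a 0 k <= y 0 k <= b 0 k]
      = (\prod_k (b 0 k - a 0 k))%:E.

End Euclidean.

(* A compact manifold has a finite smooth atlas, and nothing below depends on
   the one that is chosen.  The coordinate maps are total functions, meaningful
   on [dom i] and [img i] only; [metric i] is the Gram matrix of g in the
   coordinates of chart i.  Tangent vectors are rows, and 'J acts on rows from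
   the right.  No connectedness is required. *)
Record closed_riemannian_manifold (R : realType) (d : nat) := ClosedRM {
  carrier :> ptopologicalType;
  carrier_compact : compact [set: carrier];
  carrier_hausdorff : hausdorff_space carrier;
  chart : finType;
  dom : chart -> set carrier;
  img : chart -> set 'rV[R]_d;
  phi : chart -> carrier -> 'rV[R]_d;
  psi : chart -> 'rV[R]_d -> carrier;
  dom_open : forall i, open (dom i);
  img_open : forall i, open (img i);
  dom_cover : forall x, exists i, x \in dom i;
  phi_img : forall i x, dom i x -> img i (phi i x);
  psi_dom : forall i y, img i y -> dom i (psi i y);
  phiK : forall i x, dom i x -> psi i (phi i x) = x;
  psiK : forall i y, img i y -> phi i (psi i y) = y;
  phi_continuous : forall i x, dom i x -> {for x, continuous (phi i)};
  psi_continuous : forall i y, img i y -> {for y, continuous (psi i)};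
  transition_smooth : forall i j k,
    smooth_on (img i `&` psi i @^-1` dom j) (fun y => phi j (psi i y) 0 k);
  metric : chart -> 'rV[R]_d -> 'M[R]_d;
  metric_smooth : forall i k l, smooth_on (img i) (fun y => metric i y k l);
  metric_sym : forall i y, img i y -> (metric i y)^T = metric i y;
  metric_pos : forall i y (X : 'rV[R]_d),
    img i y -> X != 0 -> 0 < (X *m metric i y *m X^T) 0 0;
  metric_compat : forall i j y, img i y -> dom j (psi i y) ->
    let J := 'J (phi j \o psi i) y in
    metric i y = J *m metric j (phi j (psi i y)) *m J^T
}.

Section Geometry.
Variables (R : realType) (d : nat) (M : closed_riemannian_manifold R d).

Definition volume_density (i : chart M) (y : 'rV[R]_d) : R :=
  Num.sqrt (\det (metric i y)).

Definition is_volume (mu : {measure set (borel M) -> \bar R}) : Prop :=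
  exists2 lam : {measure set (borel 'rV[R]_d) -> \bar R}, is_lebesgue lam &
    forall (i : chart M) (A : set (borel M)), measurable A -> A `<=` dom i ->
      mu A = (\int[lam]_(y in phi i @` A) (volume_density i y)%:E)%E.

(* [xchoose] depends only on which chart domains contain x, so [chart_at] is
   Borel. A tangent vector at x is given by its coordinates in [chart_at x]. *)
Definition chart_at (x : M) : chart M := xchoose (dom_cover x).

Definition metric_at (x : M) : 'M[R]_d :=
  metric (chart_at x) (phi (chart_at x) x).

Definition inner_at (x : M) (X Y : 'rV[R]_d) : R :=
  (X *m metric_at x *m Y^T) 0 0.

Definition cnorm2_at (x : M) (X : 'rV[R[i]]_d) : R :=
  let a := map_mx (@complex.Re R) X in
  let b := map_mx (@complex.Im R) X in
  inner_at x a a + inner_at x b b.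

Definition smooth (f : M -> R) : Prop :=
  forall i, smooth_on (@img _ _ M i) (f \o psi i).

Definition csmooth (f : M -> R[i]) : Prop :=
  smooth (fun x => complex.Re (f x)) /\ smooth (fun x => complex.Im (f x)).

Definition chart_grad (i : chart M) (f : M -> R) (y : 'rV[R]_d) : 'rV[R]_d :=
  (\row_k partial k (f \o psi i) y) *m invmx (metric i y).

Definition chart_laplacian (i : chart M) (f : M -> R) (y : 'rV[R]_d) : R :=
  (volume_density i y)^-1 *
  \sum_k partial k (fun z => volume_density i z * chart_grad i f z 0 k) y.

Definition smooth_grad (f : M -> R) (x : M) : 'rV[R]_d :=
  chart_grad (chart_at x) f (phi (chart_at x) x).

Definition smooth_laplacian (f : M -> R) (x : M) : R :=
  chart_laplacian (chart_at x) f (phi (chart_at x) x).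

Definition smooth_cgrad (f : M -> R[i]) (x : M) : 'rV[R[i]]_d :=
  \row_k Complex (smooth_grad (fun z => complex.Re (f z)) x 0 k)
                 (smooth_grad (fun z => complex.Im (f z)) x 0 k).

Definition smooth_claplacian (f : M -> R[i]) (x : M) : R[i] :=
  Complex (smooth_laplacian (fun z => complex.Re (f z)) x)
          (smooth_laplacian (fun z => complex.Im (f z)) x).

End Geometry.

Section FunctionSpaces.
Variables (R : realType) (d : nat) (M : closed_riemannian_manifold R d).
Variable mu : {measure set (borel M) -> \bar R}.

Definition cmeasurable (f : M -> R[i]) : Prop :=
  measurable_fun [set: borel M] (fun x => complex.Re (f x) : R) /\
  measurable_fun [set: borel M] (fun x => complex.Im (f x) : R).

Definition field_measurable (X : M -> 'rV[R[i]]_d) : Prop :=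
  forall k, cmeasurable (fun x => X x 0 k).

Definition Lp_norm (p : R) (f : M -> R[i]) : \bar R :=
  Lnorm mu p%:E (fun x : borel M => (Normc.normc (f x))%:E).

Definition field_L2_norm (X : M -> 'rV[R[i]]_d) : \bar R :=
  Lnorm mu 2%:E (fun x : borel M => (Num.sqrt (cnorm2_at x (X x)))%:E).

Definition in_Lp (p : R) (f : M -> R[i]) : Prop :=
  cmeasurable f /\ (Lp_norm p f < +oo)%E.

(* H^2(M) is the completion of the smooth functions for the norm
   ||(1 - Δ)f|| = (||f||^2 + 2 ||∇f||^2 + ||Δf||^2)^(1/2), all norms in L^2;
   G and w are the gradient and the Laplacian of f. *)
Definition H2_with (f : M -> R[i]) (G : M -> 'rV[R[i]]_d) (w : M -> R[i]) :
    Prop :=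
  [/\ cmeasurable f, field_measurable G, cmeasurable w &
    exists h : nat -> M -> R[i],
    [/\ forall n, csmooth (h n),
        Lp_norm 2 (fun x => h n x - f x) @[n --> \oo] --> 0%E,
        field_L2_norm (fun x => smooth_cgrad (h n) x - G x) @[n --> \oo] --> 0%E
      & Lp_norm 2 (fun x => smooth_claplacian (h n) x - w x) @[n --> \oo]
          --> 0%E]].

Definition H2 (f : M -> R[i]) : Prop := exists G w, H2_with f G w.

(* Representatives of the gradient and the Laplacian of an H^2 function, which
   are unique almost everywhere since both operators are closable; the value 0
   off H^2 is junk. *)
Definition H2_jet (f : M -> R[i]) : (M -> 'rV[R[i]]_d) * (M -> R[i]) :=
  xget (fun=> 0, fun=> 0) [set Gw | H2_with f Gw.1 Gw.2].
Definition grad (f : M -> R[i]) : M -> 'rV[R[i]]_d := (H2_jet f).1.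
Definition laplacian (f : M -> R[i]) : M -> R[i] := (H2_jet f).2.

Variable T : R.

(* s -> t inside [0, T]: one-sided at the end points. *)
Definition near_in (t : R) : set_system R := within `[0, T] (nbhs t).
Definition near_in' (t : R) : set_system R := within `[0, T] t^'.

Definition Lp_continuous (p : R) (f : R -> M -> R[i]) : Prop :=
  forall t, t \in `[0, T] -> in_Lp p (f t) /\
    Lp_norm p (fun x => f s x - f t x) @[s --> near_in t] --> 0%E.

Definition H2_continuous (f : R -> M -> R[i]) : Prop :=
  forall t, t \in `[0, T] ->
  [/\ H2 (f t),
      Lp_norm 2 (fun x => f s x - f t x) @[s --> near_in t] --> 0%E,
      field_L2_norm (fun x => grad (f s) x - grad (f t) x)
        @[s --> near_in t] --> 0%E
    & Lp_norm 2 (fun x => laplacian (f s) x - laplacian (f t) x)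
        @[s --> near_in t] --> 0%E].

(* f is in C^1([0, T]; L^2(M)), with time derivative f'. *)
Definition L2_C1 (f f' : R -> M -> R[i]) : Prop :=
  [/\ Lp_continuous 2 f, Lp_continuous 2 f' &
    forall t, t \in `[0, T] ->
      Lp_norm 2 (fun x => ((s - t)^-1)%:C%C * (f s x - f t x) - f' t x)
        @[s --> near_in' t] --> 0%E].

Definition has_time_derivative (E : R -> R) (t l : R) : Prop :=
  (s - t)^-1 * (E s - E t) @[s --> near_in' t] --> l.

(* In dimension 2 the L^4 conditions, and those on v, follow from
   u in C([0, T]; H^2) and v(0) in H^2, because H^2 embeds in L^oo. *)
Definition sufficiently_smooth (u u' : R -> M -> R[i]) (v v' : R -> M -> R) :
    Prop :=
  [/\ H2_continuous u, L2_C1 u u', Lp_continuous 4 u,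
      L2_C1 (fun t x => (v t x)%:C%C) (fun t x => (v' t x)%:C%C)
    & Lp_continuous 4 (fun t x => (v t x)%:C%C)].

Definition schrodinger_debye (kappa lambda : R) (u0 : M -> R[i]) (v0 : M -> R)
    (u u' : R -> M -> R[i]) (v v' : R -> M -> R) : Prop :=
  [/\ forall t, t \in `[0, T] -> {ae mu, forall x : borel M,
        'i%C * u' t x + laplacian (u t) x = u t x * (v t x)%:C%C},
      forall t, t \in `[0, T] -> {ae mu, forall x : borel M,
        kappa * v' t x + v t x = lambda * Normc.normc (u t x) ^+ 2},
      {ae mu, forall x : borel M, u 0 x = u0 x}
    & {ae mu, forall x : borel M, v 0 x = v0 x}].

End FunctionSpaces.

(* Main.v *)
(** Write B(f, g) for the integral of Re f Re g + Im f Im g.  By Green's formula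
    in H^2, the Dirichlet energies at times s and t differ by
    - B(u_s - u_t, Lap u_s + Lap u_t), and the potential terms differ by
    B(u_s - u_t, (u_s + u_t) v_s) + B(v_s - v_t, |u_t|^2).  After division by
    s - t each factor converges in L^2 (the products because u and v are
    continuous in L^4), so the derivative is
    - 2 B(u', Lap u) + 2 B(u', u v) + B(v', |u|^2).  The first equation gives
    u v - Lap u = i u', which is pointwise orthogonal to u', and the second one
    turns B(v', |u|^2) into the right-hand side.

    Green's formula passes from smooth functions to H^2 by density.  For smooth
    functions it reduces, by bump functions, to one chart, where it says that
    the partial derivatives of a compactly supported C^1 function have integral
    zero; this only needs the translation invariance of Lebesgue measure.  The
    chart formula for the volume measure plays the role of the change of
    variables theorem, and the chart independence of the Laplacian follows from
    its weak characterization rather than from the transformation of second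
    derivatives. *)
Require Import Defs.
From HB Require Import structures.
From mathcomp Require Import measurable_realfun ring lra.

Set Implicit Arguments.
Unset Strict Implicit.
Unset Printing Implicit Defensive.

Local Open Scope classical_set_scope.
Local Open Scope ring_scope.

(** * Continuously differentiable functions on open subsets of R^d *)

(** The hypotheses differentiate u in time only in L^2, so the gradient of u need not be
    differentiable in time and the Dirichlet energy cannot be differentiated under the integral
    sign. Green's formula moves the spatial derivatives onto the Laplacian, a factor that only has
    to be continuous in time, and its symmetry cancels the mixed terms between the two times. In the
    potential term, continuity in L^4 is what makes the products u v converge in L^2, where they can
    be paired with the difference quotient of u. The test functions are C^1 rather than smooth: a
    bump is the square of the positive part of a quadratic polynomial in a chart, and division by a
    positive sum of bumps stays in this class. Hence Green's formula before the density argument has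
    a C^1 first factor and a smooth second one. Limits are controlled by integrals of squares or
    fourth powers and by Young's inequality with an integer weight, where the weight is fixed before
    the vanishing factor is made small. *)

Lemma near_eq_differentiable (R : numFieldType) (V W : normedModType R)
    (f g : V -> W) (y : V) :
  {near y, f =1 g} -> differentiable g y -> differentiable f y.
Proof.
move=> fg dg; have [cdg /eqaddoP eg] := (diff_locallyP _ _).1 dg.
have fgy : f y = g y by exact: nbhs_singleton fg.
(* The expansion of [g] at [y] is also one of [f]; uniqueness of the differential then identifies
   the two differentials. *)
have key : f \o shift y = cst (f y) + 'd g y +o_ 0 id.
  apply/eqaddoP => e e0.
  have fg0 : \forall h \near (0 : V), f (h + y) = g (h + y).
    move: fg; rewrite [X in X -> _](near_shift 0).
    by apply: filterS => h /=; rewrite subr0.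
  apply: filterS2 fg0 (eg e e0) => h fgh.
  by rewrite !fctE /= fgh fgy.
apply/diff_locallyP; rewrite (diff_unique cdg key); split => //.
Qed.

Lemma continuous_near_eq (S T : topologicalType) (f g : S -> T) (y : S) :
  {near y, f =1 g} -> {for y, continuous g} -> {for y, continuous f}.
Proof.
move=> fg; have fgy : f y = g y by exact: nbhs_singleton fg.
rewrite /prop_for /continuous_at fgy => cg; apply: cvg_trans cg.
by apply: near_eq_cvg; apply: filterS fg => x ->.
Qed.

Lemma sum_continuous_at (R : realType) (S : topologicalType) (I : Type)
    (r : seq I) (F : I -> S -> R) (y : S) :
  (forall i, {for y, continuous (F i)}) ->
  {for y, continuous (fun z => \sum_(i <- r) F i z)}.
Proof.
move=> h; elim: r => [|i r IH].
  apply: (@continuous_near_eq _ _ _ (fun=> 0)); last exact: cst_continuous.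
  by apply: nearW => z; rewrite big_nil.
apply: (@continuous_near_eq _ _ _ (fun z => F i z + \sum_(j <- r) F j z)).
  by apply: nearW => z; rewrite big_cons.
exact: continuousD (h i) IH.
Qed.

Section C1.
Variables (R : realType) (d : nat).
Implicit Types (U V : set 'rV[R]_d) (f g : 'rV[R]_d -> R) (y : 'rV[R]_d).

(** Differentiability is included beside continuity of the partial derivatives, so that the product
    and chain rules apply directly. *)
Definition C1_on U f := forall y, U y ->
  differentiable f y /\ forall k, {for y, continuous (partial k f)}.

Lemma C1_on_differentiable U f y : C1_on U f -> U y -> differentiable f y.
Proof. by move=> h /h []. Qed.

Lemma C1_on_partial U f y k : C1_on U f -> U y -> {for y, continuous (partial k f)}.
Proof. by move=> h /h []. Qed.

Lemma C1_on_continuous U f y : C1_on U f -> U y -> {for y, continuous f}.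
Proof. by move=> h Uy; apply/differentiable_continuous/(C1_on_differentiable h). Qed.

Lemma C1_on_derivable U f y v : C1_on U f -> U y -> derivable f y v.
Proof. by move=> h Uy; apply/diff_derivable/(C1_on_differentiable h). Qed.

Lemma near_open U y (P : 'rV[R]_d -> Prop) : open U -> U y ->
  (forall z, U z -> P z) -> \forall z \near y, P z.
Proof.
by move=> oU Uy h; apply: filterS h _; apply: open_nbhs_nbhs.
Qed.

(** Reduces closure properties of C^1 functions to a pointwise formula for the partial derivatives:
    since [U] is open, the formula holds near each point and continuity of [df] passes to
    [partial k f]. *)
Lemma C1_on_intro U f (df : 'I_d -> 'rV[R]_d -> R) : open U ->
  (forall y, U y -> differentiable f y) ->
  (forall k y, U y -> partial k f y = df k y) ->
  (forall k y, U y -> {for y, continuous (df k)}) -> C1_on U f.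
Proof.
move=> oU h1 h2 h3 y Uy; split; first exact: h1.
move=> k; apply: continuous_near_eq (h3 k y Uy).
by apply: near_open (h2 k).
Qed.

Lemma C1_on_sub U V f : U `<=` V -> C1_on V f -> C1_on U f.
Proof. by move=> UV h y /UV /h. Qed.

Lemma C1_on_setU U V f : C1_on U f -> C1_on V f -> C1_on (U `|` V) f.
Proof. by move=> hU hV y [/hU|/hV]. Qed.

Lemma near_eq_partial f g y k : {near y, f =1 g} -> partial k f y = partial k g y.
Proof. by move=> fg; rewrite /partial; apply: near_eq_derive. Qed.

Lemma C1_on_eq U f g : open U -> (forall y, U y -> f y = g y) ->
  C1_on U g -> C1_on U f.
Proof.
move=> oU fg h; have nfg y : U y -> {near y, f =1 g}.
  by move=> Uy; apply: near_open fg.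
apply: (@C1_on_intro U f (fun k => partial k g)) => //.
- move=> y Uy; apply: near_eq_differentiable (nfg y Uy) _.
  exact: C1_on_differentiable h _.
- by move=> k y Uy; apply: near_eq_partial (nfg y Uy).
- by move=> k y Uy; exact: C1_on_partial h Uy.
Qed.

Lemma partial_cst (c : R) k y : partial k (fun=> c) y = 0.
Proof. by exact: derive_cst. Qed.

Lemma C1_on_cst U (c : R) : open U -> C1_on U (fun=> c).
Proof.
move=> oU; apply: (@C1_on_intro U _ (fun _ _ => 0)) => //.
- by move=> k y _; rewrite partial_cst.
by move=> k y _; exact: cst_continuous.
Qed.

Lemma partialD f g k y : differentiable f y -> differentiable g y ->
  partial k (fun z => f z + g z) y = partial k f y + partial k g y.
Proof. by move=> /diff_derivable hf /diff_derivable hg; exact: deriveD. Qed.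

Lemma partialM f g k y : differentiable f y -> differentiable g y ->
  partial k (fun z => f z * g z) y = f y * partial k g y + g y * partial k f y.
Proof. by move=> /diff_derivable hf /diff_derivable hg; exact: deriveM. Qed.

Lemma C1_on_add U f g : open U -> C1_on U f -> C1_on U g ->
  C1_on U (fun z => f z + g z).
Proof.
move=> oU hf hg.
apply: (@C1_on_intro U _ (fun k y => partial k f y + partial k g y)) => //.
- by move=> y Uy; apply: differentiableD; [case: (hf y Uy)|case: (hg y Uy)].
- by move=> k y Uy; apply: partialD; [case: (hf y Uy)|case: (hg y Uy)].
- by move=> k y Uy; apply: continuousD; [case: (hf y Uy)|case: (hg y Uy)].
Qed.

Lemma C1_on_mul U f g : open U -> C1_on U f -> C1_on U g ->
  C1_on U (fun z => f z * g z).
Proof.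
move=> oU hf hg.
apply: (@C1_on_intro U _
  (fun k y => f y * partial k g y + g y * partial k f y)) => //.
- by move=> y Uy; apply: differentiableM; [case: (hf y Uy)|case: (hg y Uy)].
- by move=> k y Uy; apply: partialM; [case: (hf y Uy)|case: (hg y Uy)].
- move=> k y Uy; apply: continuousD; apply: continuousM.
  + exact: C1_on_continuous hf Uy.
  + exact: C1_on_partial hg Uy.
  + exact: C1_on_continuous hg Uy.
  + exact: C1_on_partial hf Uy.
Qed.

Lemma C1_on_sum (I : Type) (r : seq I) (P : pred I) (F : I -> 'rV[R]_d -> R) U :
  open U -> (forall i, P i -> C1_on U (F i)) ->
  C1_on U (fun z => \sum_(i <- r | P i) F i z).
Proof.
move=> oU h; elim: r => [|i r IH].
  apply: (C1_on_eq oU (g := fun=> 0)); last exact: C1_on_cst.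
  by move=> y _; rewrite big_nil.
have [Pi|nPi] := boolP (P i).
  apply: (C1_on_eq oU _ (C1_on_add oU (h i Pi) IH)).
  by move=> y _; rewrite big_cons Pi.
by apply: (C1_on_eq oU _ IH) => y _; rewrite big_cons (negbTE nPi).
Qed.

Lemma C1_on_prod (I : Type) (r : seq I) (P : pred I) (F : I -> 'rV[R]_d -> R) U :
  open U -> (forall i, P i -> C1_on U (F i)) ->
  C1_on U (fun z => \prod_(i <- r | P i) F i z).
Proof.
move=> oU h; elim: r => [|i r IH].
  apply: (C1_on_eq oU (g := fun=> 1)); last exact: C1_on_cst.
  by move=> y _; rewrite big_nil.
have [Pi|nPi] := boolP (P i).
  apply: (C1_on_eq oU _ (C1_on_mul oU (h i Pi) IH)).
  by move=> y _; rewrite big_cons Pi.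
by apply: (C1_on_eq oU _ IH) => y _; rewrite big_cons (negbTE nPi).
Qed.

Lemma C1_on_det (n : nat) (A : 'rV[R]_d -> 'M[R]_n) U : open U ->
  (forall i j, C1_on U (fun z => A z i j)) -> C1_on U (fun z => \det (A z)).
Proof.
move=> oU h; rewrite /determinant; apply: C1_on_sum => // s _.
by apply: C1_on_mul => //; [exact: C1_on_cst|apply: C1_on_prod].
Qed.

Lemma partial_comp1 (m : R -> R) f k y : differentiable f y ->
  derivable m (f y) 1 -> partial k (m \o f) y = derive1 m (f y) * partial k f y.
Proof.
move=> df dm; have dm' : differentiable m (f y) by apply/derivable1_diffP.
rewrite /partial !deriveE //; last exact: differentiable_comp.
by rewrite diff_comp //= deriv1E // mulrC.
Qed.

Lemma C1_on_comp1 (m : R -> R) f U : open U -> C1_on U f ->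
  (forall y, U y -> derivable m (f y) 1 /\ {for f y, continuous (derive1 m)}) ->
  C1_on U (m \o f).
Proof.
move=> oU hf hm.
apply: (@C1_on_intro U _ (fun k y => derive1 m (f y) * partial k f y)) => //.
- move=> y Uy; apply: differentiable_comp; first by case: (hf y Uy).
  by apply/(@derivable1_diffP R R); exact: (hm y Uy).1.
- move=> k y Uy; apply: partial_comp1; first by case: (hf y Uy).
  by case: (hm y Uy).
- move=> k y Uy; apply: continuousM; last exact: C1_on_partial hf Uy.
  have cf := C1_on_continuous hf Uy; have [_ cm] := hm y Uy.
  exact: continuous_comp cf cm.
Qed.

Lemma differentiable_partial f y (v : 'rV[R]_d) : differentiable f y ->
  'd f y v = \sum_k v 0 k * partial k f y.
Proof.
move=> df; rewrite {1}(row_sum_delta v) linear_sum; apply: eq_bigr => k _.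
by rewrite linearZ /= /partial deriveE.
Qed.

Lemma differentiable_rV (n : nat) (h : 'rV[R]_d -> 'rV[R]_n) y :
  (forall k, differentiable (fun z => h z 0 k) y) -> differentiable h y.
Proof.
move=> dh; have -> : h = \sum_(k < n) (fun z => h z 0 k *: delta_mx 0 k).
  by apply/funext => z; rewrite fct_sumE; exact: row_sum_delta.
by apply: differentiable_sum => k; apply: differentiableZl.
Qed.

End C1.

Section C1_comp.
Variables (R : realType) (d n : nat).
Implicit Types (U : set 'rV[R]_d) (V : set 'rV[R]_n).

Lemma partial_comp (f : 'rV[R]_n -> R) (h : 'rV[R]_d -> 'rV[R]_n) k y :
  (forall l, differentiable (fun z => h z 0 l) y) -> differentiable f (h y) ->
  partial k (f \o h) y = \sum_l partial k (fun z => h z 0 l) y * partial l f (h y).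
Proof.
move=> dh df; have dh' := differentiable_rV dh.
rewrite /partial deriveE; last exact: differentiable_comp.
rewrite diff_comp //= differentiable_partial //; apply: eq_bigr => l _.
by congr (_ * _); rewrite -deriveE // derive_mx ?mxE //; exact: diff_derivable.
Qed.

Lemma C1_on_comp (f : 'rV[R]_n -> R) (h : 'rV[R]_d -> 'rV[R]_n) U V : open U ->
  (forall l, C1_on U (fun z => h z 0 l)) -> (forall y, U y -> V (h y)) ->
  C1_on V f -> C1_on U (f \o h).
Proof.
move=> oU hh UV hf.
have dh y : U y -> differentiable h y.
  by move=> Uy; apply: differentiable_rV => l; case: (hh l y Uy).
apply: (@C1_on_intro _ _ U _ (fun k y =>
  \sum_l partial k (fun z => h z 0 l) y * partial l f (h y))) => //.
- move=> y Uy; apply: differentiable_comp; first exact: dh.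
  by case: (hf _ (UV y Uy)).
- move=> k y Uy; apply: partial_comp.
    by move=> l; case: (hh l y Uy).
  by case: (hf _ (UV y Uy)).
- move=> k y Uy; apply: sum_continuous_at => l; apply: continuousM.
    exact: C1_on_partial (hh l) Uy.
  apply: (@continuous_comp _ _ _ h (partial l f)).
    exact: differentiable_continuous (dh y Uy).
  exact: C1_on_partial hf (UV y Uy).
Qed.

End C1_comp.

(** * Inverses, square roots and squared positive parts of C^1 functions *)

Lemma nbhs_gt_at (R : realType) (a r : R) : a < r -> \forall s \near r, a < s.
Proof.
move=> ar; have := @near_in_itvoy R a r; rewrite in_itv /= ar => /(_ isT).
by apply: filterS => s; rewrite in_itv /= andbT.
Qed.

Lemma nbhs_lt_at (R : realType) (a r : R) : r < a -> \forall s \near r, s < a.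
Proof.
move=> ar; have := @near_in_itvNyo R a r; rewrite in_itv /= ar => /(_ isT).
by apply: filterS => s; rewrite in_itv.
Qed.

Section C1_elementary.
Variables (R : realType) (d : nat).
Implicit Types (U : set 'rV[R]_d) (f : 'rV[R]_d -> R).

Lemma C1_on_inv U f : open U -> C1_on U f -> (forall y, U y -> f y != 0) ->
  C1_on U (fun z => (f z)^-1).
Proof.
move=> oU hf f0.
apply: (@C1_on_intro _ _ U _ (fun k y => - (f y) ^- 2 * partial k f y)) => //.
- move=> y Uy; apply: differentiableV; [by case: (hf y Uy)|exact: f0].
- move=> k y Uy; have df := C1_on_differentiable hf Uy.
  by rewrite /partial deriveV ?f0 //; exact: diff_derivable.
- move=> k y Uy; apply: continuousM; last exact: C1_on_partial hf Uy.
  apply: continuousN; have cf := C1_on_continuous hf Uy.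
  apply: (@continuousV _ _ (fun z => f z ^+ 2)); first by rewrite expf_neq0 ?f0.
  by apply: (continuousM cf cf).
Qed.

Lemma C1_on_sqrt U f : open U -> C1_on U f -> (forall y, U y -> 0 < f y) ->
  C1_on U (fun z => Num.sqrt (f z)).
Proof.
move=> oU hf f0; apply: (C1_on_comp1 (m := Num.sqrt)) => // y Uy.
split; first by apply: ex_derive; exact: is_derive1_sqrt (f0 y Uy).
apply: (@continuous_near_eq _ _ _ (fun r => (2 * Num.sqrt r)^-1)).
  near=> r; rewrite derive1E derive_sqrt //.
  by near: r; apply: nbhs_gt_at; exact: f0.
apply: (@continuousV _ _ (fun r : R => 2 * Num.sqrt r)).
  by rewrite mulf_neq0 // gt_eqF // sqrtr_gt0 f0.
apply: continuousM; first exact: cst_continuous.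
exact: sqrt_continuous.
Unshelve. all: by end_near. Qed.

(** The simplest C^1 function that vanishes exactly on the nonpositive reals; composed with a
    quadratic polynomial it gives the bumps. *)
Definition sqpos (r : R) : R := Num.max r 0 ^+ 2.

Lemma is_derive_sqpos (r : R) : is_derive r 1 sqpos (2 * Num.max r 0).
Proof.
have [r0|r0|->] := ltgtP r 0.
- rewrite mulr0; apply: (@near_eq_is_derive _ _ _ (fun=> 0)).
  near=> s; rewrite /sqpos max_r ?expr0n //.
  by apply: ltW; near: s; exact: nbhs_lt_at.
- apply: (@near_eq_is_derive R R R (fun s : R => s ^+ 2)).
    near=> s; rewrite /sqpos max_l //.
    by apply: ltW; near: s; exact: nbhs_gt_at.
  split; first exact: exprn_derivable.
  by rewrite exp_derive expr1 scaler1.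
- rewrite mulr0.
  (* For h <= 0 the quotient is 0 and for h > 0 it equals h. *)
  have h : h^-1 *: (sqpos (h *: 1 + 0) - sqpos 0) @[h --> (0:R)^'] --> (0 : R).
    apply/cvgrPdist_le => e e0; near=> h.
    have h0 : h != 0 by near: h; exact: nbhs_dnbhs_neq.
    rewrite /sqpos maxxx expr0n subr0 addr0 sub0r normrN [h *: 1]mulr1.
    have [hle|hgt] := leP h 0; first by rewrite expr0n /= scaler0 normr0 ltW.
    rewrite /GRing.scale /= expr2 mulrA mulVf // mul1r.
    by near: h; exact: dnbhs0_le.
  split; first by apply/cvg_ex; exists 0.
  exact: cvg_lim.
Unshelve. all: by end_near. Qed.

Lemma C1_on_sqpos U f : open U -> C1_on U f -> C1_on U (fun z => sqpos (f z)).
Proof.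
move=> oU hf; apply: (C1_on_comp1 (m := sqpos)) => // y Uy.
split; first by apply: ex_derive; exact: is_derive_sqpos.
apply: (@continuous_near_eq R R _ (fun r : R => 2 * Num.max r 0 : R)).
  by near=> r; rewrite derive1E; apply: derive_val; exact: is_derive_sqpos.
apply: continuousM; first exact: cst_continuous.
by apply: continuous_max; [exact: cvg_id|exact: cst_continuous].
Unshelve. all: by end_near. Qed.

Lemma C1_on_coord U (k : 'I_d) : open U -> C1_on U (fun z => z 0 k).
Proof.
move=> oU; apply: (@C1_on_intro _ _ U _ (fun l _ => (delta_mx 0 l : 'rV[R]_d) 0 k)) => //.
- by move=> y _; exact: differentiable_coord.
- move=> l y _; rewrite /partial.
  have /(@derive_mx R 'rV[R]_d 1 d id) : derivable (@id 'rV[R]_d) y (delta_mx 0 l).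
    exact: derivable_id.
  by rewrite derive_id => /matrixP /(_ 0 k) ->; rewrite mxE.
- by move=> l y _; exact: cst_continuous.
Qed.

Lemma smooth_on_C1 U f : smooth_on U f -> C1_on U f.
Proof. by move=> /(_ 1%N) /= [h1 h2] y Uy; split; [exact: h1|move=> k; exact: h2]. Qed.

Lemma smooth_on_partial U f k : smooth_on U f -> smooth_on U (partial k f).
Proof. by move=> h n; have /= [_] := h n.+1; exact. Qed.

End C1_elementary.

(** * Borel sets of R^d and translation invariance of Lebesgue measure *)

Section borel.
Variable R : realType.

Lemma open_borel (X : ptopologicalType) (U : set X) :
  open U -> measurable (U : set (borel X)).
Proof. by move=> oU; apply: sub_sigma_algebra. Qed.

Lemma closed_borel (X : ptopologicalType) (U : set X) :
  closed U -> measurable (U : set (borel X)).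
Proof.
by move=> cU; rewrite -[U]setCK; apply: measurableC; apply: open_borel; apply: closed_openC.
Qed.

Lemma open_preimage_in (X Y : topologicalType) (D : set X) (f : X -> Y) (B : set Y) :
  open D -> (forall x, D x -> {for x, continuous f}) -> open B ->
  open (D `&` f @^-1` B).
Proof.
move=> oD cf oB; rewrite openE => x [Dx Bfx]; apply: filterI.
  exact: open_nbhs_nbhs.
by apply: (cf x Dx); apply: open_nbhs_nbhs.
Qed.

Lemma borel_measurable_continuous (X Y : ptopologicalType) (D : set X) (f : X -> Y) :
  open D -> (forall x, D x -> {for x, continuous f}) ->
  measurable_fun (D : set (borel X)) (f : borel X -> borel Y).
Proof.
move=> oD cf; apply: (@measurability _ _ (borel X) (borel Y) _ _ (@open Y)) => //.
by move=> _ [B oB <-]; apply: open_borel; exact: open_preimage_in.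
Qed.

Lemma measurable_continuous_in (X : ptopologicalType) (D : set X) (f : X -> R) :
  open D -> (forall x, D x -> {for x, continuous f}) ->
  measurable_fun (D : set (borel X)) (f : borel X -> R).
Proof.
move=> oD cf; apply: (measurability _ (RGenOpens.measurableE R)).
move=> _ [_ [a [b ->]] <-]; apply: open_borel; apply: open_preimage_in => //.
Qed.

End borel.

(** * The sup norm, boxes and the Borel sets they generate *)

Section rV_norm.
Variables (R : realType) (d : nat).
Implicit Types (y : 'rV[R]_d).

Lemma rV_norm_le y (e : R) : 0 <= e -> (`|y| <= e) <-> (forall k, `|y 0 k| <= e).
Proof.
move=> e0; rewrite {1}/Num.norm /= mx_normrE; split.
  by move=> /bigmax_leP [_ h] k; exact: (h (0, k)).
by move=> h; apply/bigmax_leP; split => // -[i k] _ /=; rewrite ord1.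
Qed.

Lemma rV_norm_lt y (e : R) : 0 < e -> (`|y| < e) <-> (forall k, `|y 0 k| < e).
Proof.
move=> e0; rewrite {1}/Num.norm /= mx_normrE; split.
  by move=> /bigmax_ltP [_ h] k; exact: (h (0, k)).
by move=> h; apply/bigmax_ltP; split => // -[i k] _ /=; rewrite ord1.
Qed.

End rV_norm.

Section boxes.
Variables (R : realType) (d : nat).
Implicit Types (a b y : 'rV[R]_d).

Definition box a b : set 'rV[R]_d := [set y | forall k, a 0 k <= y 0 k <= b 0 k].

Definition cube (r : R) : set 'rV[R]_d := box (const_mx (- r)) (const_mx r).

(** The empty set is added to close the family under intersection. Ordered corners are required
    because the product formula of [is_lebesgue] is only given for them. *)
Definition boxes : set (set (borel 'rV[R]_d)) :=
  [set A | A = set0 \/ exists a b, (forall k, a 0 k <= b 0 k) /\ A = box a b].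

Lemma cubeP (r : R) y : 0 <= r -> cube r y <-> `|y| <= r.
Proof.
move=> r0; rewrite rV_norm_le //; split => h k; have := h k; rewrite ?mxE ler_norml //.
Qed.

Lemma box_closed a b : closed (box a b).
Proof.
have -> : box a b = \bigcap_k ((fun y : 'rV[R]_d => y 0 k) @^-1` `[a 0 k, b 0 k]).
  apply/seteqP; split => y h; first by move=> k _ /=; rewrite in_itv; exact: h.
  by move=> k; have := h k I; rewrite /= in_itv.
apply: closed_bigI => k _; apply: closed_comp; last exact: interval_closed.
by move=> y _; exact: coord_continuous.
Qed.

Lemma box_compact a b : compact (box a b).
Proof.
have := @rV_compact R d (fun k => `[a 0 k, b 0 k]%classic)
  (fun k => @segment_compact R (a 0 k) (b 0 k)).
congr compact; apply/seteqP; split => y h k; have := h k; rewrite /= in_itv //.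
Qed.

Lemma cube_compact r : compact (cube r).
Proof. exact: box_compact. Qed.

Lemma boxes_setI : setI_closed boxes.
Proof.
move=> A B [->|[a [b [ab ->]]]]; first by move=> _; left; rewrite set0I.
move=> [->|[a' [b' [ab' ->]]]]; first by left; rewrite setI0.
have [->|/set0P [y [yab yab']]] := eqVneq (box a b `&` box a' b') set0.
  by left.
right; exists (\row_k Num.max (a 0 k) (a' 0 k)), (\row_k Num.min (b 0 k) (b' 0 k)).
split.
  move=> k; rewrite !mxE; apply: (@le_trans _ _ (y 0 k)).
    by rewrite ge_max; have /andP[-> _] := yab k; have /andP[-> _] := yab' k.
  by rewrite le_min; have /andP[_ ->] := yab k; have /andP[_ ->] := yab' k.
apply/seteqP; split => z.
  move=> [h h'] k; rewrite !mxE ge_max le_min.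
  by have /andP[-> ->] := h k; have /andP[-> ->] := h' k.
by move=> h; split=> k; have := h k; rewrite !mxE ge_max le_min;
  move=> /andP[/andP[? ?] /andP[? ?]]; apply/andP.
Qed.

Definition rat_vec (p : 'rV[rat]_d) : 'rV[R]_d := map_mx ratr p.

(** Around each point of [U], rational corners can be chosen close enough for the box to stay in
    [U]. The union runs over all pairs of rational vectors, unsuitable ones contributing [set0], so
    that the index is a countable type. *)
Lemma open_bigcup_boxes (U : set 'rV[R]_d) : open U ->
  U = \bigcup_(pq : 'rV[rat]_d * 'rV[rat]_d)
        (if `[< (forall k, (rat_vec pq.1) 0 k <= (rat_vec pq.2) 0 k) /\
                box (rat_vec pq.1) (rat_vec pq.2) `<=` U >]
         then box (rat_vec pq.1) (rat_vec pq.2) else set0).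
Proof.
move=> oU; apply/seteqP; split => [y Uy|y [pq _]]; last first.
  by case: asboolP => // -[_ h] /h.
have /nbhs_ballP [e /= e0 eU] : nbhs y U by exact: open_nbhs_nbhs.
have e20 : 0 < e / 2 by rewrite divr_gt0.
have hp k : {p : rat | y 0 k - e / 2 < ratr p < y 0 k}.
  have /rat_in_itvoo : y 0 k - e / 2 < y 0 k by rewrite ltrBlDr ltrDl.
  by move=> /cid [p]; rewrite in_itv /= => h; exists p.
have hq k : {q : rat | y 0 k < ratr q < y 0 k + e / 2}.
  have /rat_in_itvoo : y 0 k < y 0 k + e / 2 by rewrite ltrDl.
  by move=> /cid [p]; rewrite in_itv /= => h; exists p.
exists (\row_k sval (hp k), \row_k sval (hq k)) => //=.
have E1 k : rat_vec (\row_k sval (hp k)) 0 k = ratr (sval (hp k)) by rewrite !mxE.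
have E2 k : rat_vec (\row_k sval (hq k)) 0 k = ratr (sval (hq k)) by rewrite !mxE.
case: asboolP => [_|[]].
  move=> k; rewrite E1 E2; case: (hp k) (hq k) => /= p /andP[_ h1] [q /= /andP[h2 _]].
  by rewrite !ltW.
split.
  move=> k; rewrite E1 E2; case: (hp k) (hq k) => /= p /andP[_ h1] [q /= /andP[h2 _]].
  exact: ltW (lt_trans h1 h2).
move=> z hz; apply: eU; rewrite -ball_normE /=.
apply/(rV_norm_lt _ e0) => k; have := hz k; rewrite E1 E2 !mxE.
case: (hp k) (hq k) => /= p /andP[h1 h1'] [q /= /andP[h2 h2']] /andP[h3 h4].
rewrite ltr_norml; apply/andP; split; lra.
Qed.

Lemma borel_rVE : @measurable _ (borel 'rV[R]_d) = <<s boxes >>.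
Proof.
apply/seteqP; split.
  apply: smallest_sub; first exact: smallest_sigma_algebra.
  move=> U oU; rewrite (open_bigcup_boxes oU).
  apply: (@countable_bigcupT_measurable _ (g_sigma_algebraType boxes)) => // pq.
  case: asboolP => [[h _]|_]; apply: sub_sigma_algebra; last by left.
  by right; exists (rat_vec pq.1), (rat_vec pq.2).
apply: smallest_sub; first exact: smallest_sigma_algebra.
move=> A [->|[a [b [_ ->]]]]; first exact: measurable0.
apply: (@closed_borel 'rV[R]_d); exact: box_closed.
Qed.

End boxes.

Section lebesgue_rV.
Variables (R : realType) (d : nat).
Variable lam : {measure set (borel 'rV[R]_d) -> \bar R}.
Hypothesis hlam : is_lebesgue lam.
Implicit Types (a b v y : 'rV[R]_d).

Lemma lebesgue_box_fin a b : (lam (box a b) < +oo)%E.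
Proof.
have [ab|nab] := pselect (forall k, a 0 k <= b 0 k); first by rewrite hlam // ltry.
suff -> : box a b = set0 by rewrite measure0.
apply/seteqP; split => // y h; case: nab => k.
by have /andP[] := h k; exact: le_trans.
Qed.

Definition translation v : borel 'rV[R]_d -> borel 'rV[R]_d := fun y => y + v.

Lemma measurable_translation v : measurable_fun setT (translation v).
Proof.
apply: borel_measurable_continuous => [|y _]; first exact: openT.
by apply: continuousD; [exact: cvg_id|exact: cst_continuous].
Qed.

HB.instance Definition _ v :=
  isMeasurableFun.Build _ _ _ _ (translation v) (measurable_translation v).

(** The translate of a box is a box with the same side lengths, so both measures agree on the
    pi-system of boxes. They are finite on the cubes of integer radius, which exhaust the space, and
    uniqueness of measures concludes. *)
Lemma lebesgue_translation v (A : set (borel 'rV[R]_d)) : measurable A ->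
  pushforward lam (translation v) A = lam A.
Proof.
move=> mA; apply/esym; move: mA.
have h := @measure_unique _ R (borel 'rV[R]_d) (@boxes R d) (fun n => @cube R d n%:R).
apply: h.
- exact: borel_rVE.
- exact: boxes_setI.
- move=> i; right; exists (const_mx (- i%:R)), (const_mx i%:R); split => // k.
  by rewrite !mxE; apply: (@le_trans _ _ 0); rewrite ?oppr_le0 ler0n.
- apply/seteqP; split => // y _; exists (Num.truncn `|y|).+1 => //.
  apply/cubeP; first by rewrite ler0n.
  by apply: ltW; apply: truncnS_gt.
- move=> _ [->|[a [b [ab ->]]]]; first by rewrite !measure0.
  transitivity (lam (box (a - v) (b - v))); last first.
    congr (lam _); apply/esym; apply/seteqP; split => y h k; have := h k; rewrite !mxE.
      by rewrite lerBlDr lerBrDr.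
    by rewrite lerBlDr lerBrDr.
  rewrite !hlam //; last by move=> k; rewrite !mxE lerD2r.
  congr EFin; apply: eq_bigr => k _; rewrite !mxE; lra.
- by move=> k; exact: lebesgue_box_fin.
Qed.

End lebesgue_rV.

(** * Integrals of partial derivatives *)

Lemma compact_continuous_bounded (R : realType) (X : topologicalType)
    (K : set X) (f : X -> R) : compact K ->
  (forall x, K x -> {for x, continuous f}) ->
  exists2 C, 0 <= C & forall x, K x -> `|f x| <= C.
Proof.
move=> cK cf.
have : compact (f @` K).
  apply: continuous_compact => //; apply: continuous_in_subspaceT => x.
  by rewrite inE; exact: cf.
move=> /compact_bounded [C0 [C0r h]].
exists (`|C0| + 1); first by rewrite addr_ge0.
move=> x Kx; apply: (h (`|C0| + 1)); last by exists x.
by rewrite (le_lt_trans (ler_norm _)) // ltrDl.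
Qed.

Lemma bounded_support_integrable d (T : measurableType d) (R : realType)
    (mu : {measure set T -> \bar R}) (f : T -> R) (A : set T) (C : R) :
  measurable A -> (mu A < +oo)%E -> measurable_fun setT f ->
  (forall x, ~ A x -> f x = 0) -> (forall x, A x -> `|f x| <= C) ->
  mu.-integrable setT (EFin \o f).
Proof.
move=> mA fA mf f0 fC.
have -> : EFin \o f = (EFin \o f) \_ A.
  apply/funext => x; rewrite /patch; case: ifPn => // /negP nA /=.
  by rewrite f0 // => Ax; apply: nA; rewrite inE.
apply/(integrable_mkcond _ mA).
apply: measurable_bounded_integrable => //; first exact: measurable_funTS.
exists C; split; first exact: num_real.
by move=> M CM x Ax /=; rewrite (le_trans (fC x Ax)) // ltW.
Qed.

Section integration_by_parts.
Variables (R : realType) (d : nat).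
Variable lam : {measure set (borel 'rV[R]_d) -> \bar R}.
Hypothesis hlam : is_lebesgue lam.
Implicit Types (v y : 'rV[R]_d) (f : 'rV[R]_d -> R).

Lemma cube_measurable (r : R) : measurable (cube r : set (borel 'rV[R]_d)).
Proof. by apply: (@closed_borel 'rV[R]_d); exact: box_closed. Qed.

Lemma continuous_measurable_rV f : continuous f ->
  measurable_fun setT (f : borel 'rV[R]_d -> R).
Proof.
move=> cf; apply: (@measurable_continuous_in R 'rV[R]_d setT f); first exact: openT.
by move=> y _; exact: cf.
Qed.

Lemma continuous_cube_integrable f (r : R) : continuous f ->
  (forall y, ~ cube r y -> f y = 0) ->
  lam.-integrable setT (EFin \o (f : borel 'rV[R]_d -> R)).
Proof.
move=> cf f0.
have [C C0 hC] := compact_continuous_bounded (@cube_compact R d r) (fun y _ => cf y).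
apply: (bounded_support_integrable (cube_measurable r) _ _ f0 hC).
  exact: lebesgue_box_fin.
exact: continuous_measurable_rV.
Qed.

(** Invariance of the measure gives the nonnegative case through the pushforward formula; positive
    and negative parts are then treated separately. *)
Lemma integral_translation v (f : borel 'rV[R]_d -> \bar R) : measurable_fun setT f ->
  (\int[lam]_y f (translation v y) = \int[lam]_y f y)%E.
Proof.
have pos (g : borel 'rV[R]_d -> \bar R) : measurable_fun setT g ->
    (forall y, 0 <= g y)%E -> (\int[lam]_y g (translation v y) = \int[lam]_y g y)%E.
  move=> mg g0.
  have := @ge0_integral_pushforward _ _ _ _ R _ (measurable_translation v) lam setT g
     measurableT mg (fun y _ => g0 y).
  rewrite preimage_setT => <-.
  by apply: eq_measure_integral => A mA _; exact: lebesgue_translation.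
move=> mf; rewrite [LHS]integralE [RHS]integralE.
have -> : (fun y => f (translation v y)) = f \o translation v by [].
rewrite funepos_comp funeneg_comp.
congr (_ - _)%E; apply: pos => //.
- exact: measurable_funepos.
- exact: measurable_funeneg.
Qed.

(** The mean value theorem for the restriction of [f] to the line through [y] in direction [k]. *)
Lemma diff_quotient_bound f k (C t : R) y : 0 < t -> C1_on setT f ->
  (forall z, `|partial k f z| <= C) ->
  `|t^-1 * (f (y + t *: delta_mx 0 k) - f y)| <= C.
Proof.
move=> t0 hf hC; pose g (s : R) : R := f (y + s *: delta_mx 0 k).
have dg (s : R) : is_derive s 1 g (partial k f (y + s *: delta_mx 0 k)).
  have hd : derivable f (y + s *: delta_mx 0 k) (delta_mx 0 k).
    exact: C1_on_derivable hf I.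
  have E : (fun h : R => h^-1 *: (g (h *: 1 + s) - g s)) =
           (fun h : R => h^-1 *: ((f \o shift (y + s *: delta_mx 0 k))
               (h *: delta_mx 0 k) - f (y + s *: delta_mx 0 k))).
    apply/funext => h; rewrite /g /=; congr (_ *: (f _ - _)).
    by rewrite [h *: 1]mulr1 scalerDl addrCA.
  by split; rewrite /derivable /derive E.
have [] := @MVT R g (fun s => partial k f (y + s *: delta_mx 0 k)) 0 t t0.
  apply: continuous_in_subspaceT => s _.
  by apply/differentiable_continuous/derivable1_diffP; exact: (@ex_derive _ _ _ _ _ _ _ (dg s)).
move=> c _; rewrite /g scale0r addr0 subr0 => ->.
by rewrite mulrCA mulVf ?gt_eqF // mulr1; exact: hC.
Qed.

(* The difference quotients of f in direction k have integral zero, by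
   translation invariance, and converge boundedly to the partial derivative. *)
Lemma integral_partial f k (r : R) : 0 <= r -> C1_on setT f ->
  (forall y, ~ cube r y -> f y = 0) ->
  (\int[lam]_(y in [set: borel 'rV[R]_d]) partial k f y = 0)%R.
Proof.
move=> r0 hf f0.
have cf : continuous f by move=> y; exact: C1_on_continuous hf I.
have cp : continuous (partial k f) by move=> y; exact: C1_on_partial hf I.
have p0 y : ~ cube r y -> partial k f y = 0.
  move=> ny; rewrite (@near_eq_partial _ _ f (fun=> 0) y k) ?partial_cst //.
  apply: (@near_open _ _ (~` cube r)) => //.
  by apply: closed_openC; exact: box_closed.
have [C C0 hC'] := compact_continuous_bounded (@cube_compact R d r) (fun y _ => cp y).
have hC y : `|partial k f y| <= C.
  have [|ny] := pselect (cube r y); first exact: hC'.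
  by rewrite p0 // normr0.
pose t (n : nat) : R := n.+1%:R^-1.
have t0 n : 0 < t n by rewrite invr_gt0 ltr0n.
have t1 n : t n <= 1 by rewrite invf_le1 ?ltr0n // ler1n.
pose D (n : nat) (y : borel 'rV[R]_d) : R :=
  (t n)^-1 * (f (translation (t n *: delta_mx 0 k) y) - f y).
have mf := continuous_measurable_rV cf.
have intf := continuous_cube_integrable cf f0.
have mft n : measurable_fun setT
    (fun y : borel 'rV[R]_d => f (translation (t n *: delta_mx 0 k) y)).
  by apply: (@measurableT_comp _ _ _ _ _ _ (f : borel 'rV[R]_d -> R) _
     (translation (t n *: delta_mx 0 k))) => //; exact: measurable_translation.
have mD n : measurable_fun setT (EFin \o D n).
  apply/measurable_EFinP; apply: measurable_funM => //.
  exact: measurable_funB.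
have D_cvg y : (D n y)%:E @[n --> \oo] --> (partial k f y)%:E.
  apply: cvg_EFin; first exact: nearW.
  have : derivable f y (delta_mx 0 k) by exact: C1_on_derivable hf I.
  rewrite /derivable -/(partial k f y) => /cvg_ex [l hl].
  have -> : partial k f y = l by apply: cvg_lim hl.
  (* The harmonic sequence tends to 0 without meeting it, which the punctured neighbourhood
     requires. *)
  have ht : t n @[n --> \oo] --> (0:R)^'.
    move=> A; rewrite /dnbhs /within /= => hA.
    have := @cvg_harmonic R _ hA; rewrite /= /nbhs /=; apply: filterS => n /=.
    by apply; rewrite gt_eqF.
  have := cvg_comp _ _ ht hl; apply: cvg_trans; apply: near_eq_cvg; apply: nearW => n.
  by rewrite /D /= /translation [_ + t n *: _]addrC.
(* Since [t n] is at most 1, all the quotients vanish outside the cube of radius [r + 1]; this makes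
   a single dominating function possible. *)
have supp n y : ~ cube (r + 1) y -> D n y = 0.
  have r10 : 0 <= r + 1 by rewrite addr_ge0.
  move=> ny; have ny1 : ~ cube r y.
    by move=> /(cubeP _ r0) h; apply: ny; apply/cubeP => //; rewrite (le_trans h) // lerDl.
  rewrite /D (f0 _ ny1) f0 ?subrr ?mulr0 // => /(cubeP _ r0) h.
  apply: ny; apply/cubeP => //.
  rewrite -[y](addrK (t n *: delta_mx 0 k)) (le_trans (ler_normB _ _)) // lerD //.
  rewrite normrZ gtr0_norm // (le_trans _ (t1 n)) //.
  apply: ler_piMr; first exact: ltW.
  apply/(rV_norm_le _ ler01) => l; rewrite mxE /=.
  by case: (_ == _) => /=; rewrite ?normr1 ?normr0.
have intg : lam.-integrable setT (fun y => (C * \1_(cube (r + 1)) y)%:E).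
  apply: (@bounded_support_integrable _ (borel 'rV[R]_d) R lam
    (fun y => C * \1_(cube (r + 1)) y) (cube (r + 1)) C).
  - exact: cube_measurable.
  - exact: lebesgue_box_fin.
  - by apply: measurable_funM => //; apply: measurable_indic; exact: cube_measurable.
  - by move=> y ny; rewrite indicE memNset // mulr0.
  - by move=> y hy; rewrite indicE mem_set // mulr1 ger0_norm.
have Dg n y : (`|(D n y)%:E| <= (C * \1_(cube (r + 1)) y)%:E)%E.
  rewrite lee_fin indicE; have [hy|hy] := pselect (cube (r + 1) y).
    by rewrite mem_set // mulr1; exact: diff_quotient_bound.
  by rewrite memNset // mulr0 supp // normr0.
have [] := @dominated_convergence _ _ R lam setT measurableT
   (fun n => EFin \o D n) (EFin \o (partial k f : borel 'rV[R]_d -> R)) _ mD _ _ intg.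
- by apply/measurable_EFinP; exact: continuous_measurable_rV.
- by apply: aeW => y _; exact: D_cvg.
- by apply: aeW => y n _; exact: Dg.
move=> _ _; rewrite (_ : (fun n => _) = (fun=> 0%E)); last first.
  apply/funext => n; rewrite /D.
  have intft : lam.-integrable setT (fun y => (f (translation (t n *: delta_mx 0 k) y))%:E).
    apply: (@continuous_cube_integrable _ (r + 1)).
      move=> y; apply: (@continuous_comp _ _ _ (fun y => y + t n *: delta_mx 0 k)); last exact: cf.
      by apply: continuousD; [exact: cvg_id|exact: cst_continuous].
    move=> y ny; have := supp n y ny; rewrite /D => /eqP; rewrite mulf_eq0 invr_eq0 gt_eqF //=.
    rewrite subr_eq0 => /eqP ->; apply: f0 => /(cubeP _ r0) h; apply: ny.
    by apply/cubeP; rewrite ?addr_ge0 // (le_trans h) // lerDl.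
  under eq_integral do rewrite /= EFinM EFinB.
  rewrite integralZl //; last exact: integrableB.
  rewrite integralB //.
  rewrite (@integral_translation _ (EFin \o f)); last exact/measurable_EFinP.
  by rewrite subee ?mule0 //; apply: integrable_fin_num.
move=> h; rewrite /Rintegral; suff -> : (\int[lam]_y (partial k f y)%:E = 0)%E by [].
by apply: (cvg_unique _ h); [exact: ereal_hausdorff|exact: cvg_cst].
Qed.

End integration_by_parts.

(** * Change of variables through a density *)

Section density_transfer.
Context d1 d2 (X : measurableType d1) (Y : measurableType d2) (R : realType).
Variables (lam : {measure set X -> \bar R}) (mu : {measure set Y -> \bar R}).
Variables (E : set X) (D : set Y) (psi : X -> Y) (w : X -> R).
Hypotheses (mE : measurable E) (mD : measurable D) (mpsi : measurable_fun E psi)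
  (mw : measurable_fun E w) (w0 : forall x, E x -> 0 <= w x)
  (psiD : forall x, E x -> D (psi x))
  (muE : forall A, measurable A -> A `<=` D ->
     mu A = (\int[lam]_(x in E `&` psi @^-1` A) (w x)%:E)%E).

Import HBNNSimple.
Local Open Scope ereal_scope.

(** The hypothesis [muE] is the case of indicator functions. Linearity extends it to simple
    functions, and monotone convergence along [nnsfun_approx] to nonnegative measurable ones. *)
Lemma ge0_integral_density_transfer (f : Y -> \bar R) :
  measurable_fun D f -> (forall y, 0 <= f y) ->
  \int[mu]_(y in D) f y = \int[lam]_(x in E) (f (psi x) * (w x)%:E).
Proof.
move=> mf f0; pose h := nnsfun_approx mD mf.
have mhpsi n : measurable_fun E (fun x => h n (psi x)).
  by apply: (measurable_comp measurableT) => //; exact: measurable_funP.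
have mpre (A : set Y) : measurable A -> measurable (E `&` psi @^-1` A).
  by move=> mA; exact: mpsi.
transitivity (limn (fun n => \int[mu]_(y in D) (h n y)%:E)).
  rewrite -monotone_convergence//.
  - apply: eq_integral => y /[!inE] yD; apply/esym/cvg_lim => //.
    by apply: cvg_nnsfun_approx.
  - by move=> n; exact/measurable_EFinP/measurable_funTS/measurable_funP.
  - by move=> n y _; rewrite lee_fin.
  - by move=> y _ m n mn; rewrite lee_fin; exact/lefP/nd_nnsfun_approx.
transitivity (limn (fun n => \int[lam]_(x in E) ((h n (psi x))%:E * (w x)%:E))); last first.
  rewrite -monotone_convergence//.
  - apply: eq_integral => x /[!inE] xE; apply/cvg_lim => //; apply: cvgeZr => //.
    by apply: cvg_nnsfun_approx => //; exact: psiD.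
  - move=> n; apply: emeasurable_funM; exact/measurable_EFinP.
  - by move=> n x Ex; rewrite mule_ge0 // lee_fin // w0.
  - move=> x Ex m n mn; rewrite lee_wpmul2r ?lee_fin ?w0 //.
    exact/lefP/nd_nnsfun_approx.
congr (limn _); apply/funext => n.
(* Both integrals of the simple function [h n] are expanded over its finite range and compared level
   set by level set. *)
transitivity (\sum_(c \in range (h n)) c%:E * mu (D `&` h n @^-1` [set c])).
  transitivity (\int[mu]_(y in D)
     (\sum_(c \in range (h n)) (c * \1_(h n @^-1` [set c]) y)%:E)).
    by apply: eq_integral => t tE; rewrite /= fimfunE -fsumEFin.
  rewrite ge0_integral_fsum //; last 2 first.
  - by move=> c; apply/measurable_EFinP; apply: measurable_funM.
  - by move=> c y Dy; exact: nnfun_muleindic_ge0.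
  apply: eq_fsbigr => c _; rewrite integralZl_indic_nnsfun // integral_indic //.
  by rewrite setIC.
transitivity (\int[lam]_(x in E)
   (\sum_(c \in range (h n)) (c * \1_(h n @^-1` [set c]) (psi x))%:E * (w x)%:E)); last first.
  apply: eq_integral => x xE; rewrite -ge0_mule_fsuml => [|y]; last exact: nnfun_muleindic_ge0.
  by rewrite fsumEFin // -(fimfunE _ (psi x)).
have mind c : measurable_fun E (fun x => (c * \1_(h n @^-1` [set c]) (psi x))%:E).
  apply/measurable_EFinP; apply: measurable_funM => //.
  by apply: (measurable_comp measurableT) => //; exact: measurable_indic.
rewrite ge0_integral_fsum //; last 2 first.
- by move=> c; apply: emeasurable_funM => //; exact/measurable_EFinP.
- by move=> c x Ex; apply: mule_ge0; [exact: nnfun_muleindic_ge0|rewrite lee_fin w0].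
apply: eq_fsbigr => c /[!inE] -[y0 _ hc].
have c0 : (0 <= c)%R by rewrite -hc.
transitivity (\int[lam]_(x in E) (c%:E * ((\1_(h n @^-1` [set c]) (psi x))%:E * (w x)%:E))).
  rewrite ge0_integralZl //; first last.
  - by move=> x Ex; rewrite mule_ge0 // lee_fin w0.
  - apply: emeasurable_funM; last exact/measurable_EFinP.
    apply/measurable_EFinP.
    by apply: (measurable_comp measurableT) => //; exact: measurable_indic.
  congr (_ * _); have mA : measurable (D `&` h n @^-1` [set c]) by exact: measurableI.
  rewrite muE //.
  have -> : E `&` psi @^-1` (D `&` h n @^-1` [set c]) = E `&` psi @^-1` (h n @^-1` [set c]).
    by apply/seteqP; split => x [Ex]; [case|split => //; split => //; exact: psiD].
  rewrite integral_mkcondr; apply: eq_integral => x xE.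
  rewrite /patch indicE /=.
  have -> : (x \in psi @^-1` (h n @^-1` [set c])) = (psi x \in h n @^-1` [set c]).
    by apply/idP/idP; rewrite !inE.
  by case: ifP => _; rewrite ?mul1e ?mul0e.
by apply: eq_integral => x _; rewrite EFinM muleA.
Qed.

Lemma Rintegral_density_transfer (f : Y -> R) : measurable_fun D f ->
  (\int[mu]_(y in D) f y = \int[lam]_(x in E) (f (psi x) * w x))%R.
Proof.
move=> mf; rewrite /Rintegral [in LHS]integralE [in RHS]integralE.
have mf' : measurable_fun D (EFin \o f) by exact/measurable_EFinP.
congr (fine (_ - _)).
  rewrite ge0_integral_density_transfer //; last exact: measurable_funepos.
  apply: eq_integral => x /[!inE] Ex; rewrite !funeposE /= -EFin_max -EFin_max.
  by rewrite -EFinM maxr_pMl ?mul0r // w0.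
rewrite ge0_integral_density_transfer //; last exact: measurable_funeneg.
apply: eq_integral => x /[!inE] Ex; rewrite !funenegE /= -EFin_max -EFin_max.
by rewrite -EFinM maxr_pMl ?mul0r ?mulNr // w0.
Qed.

End density_transfer.

(** * Quadratic pairings and L^2 limits *)

(** Convergence to zero for nonnegative [e], in a form that combines directly with inequalities
    between extended integrals. *)
Definition vanishing (R : realType) (I : Type) (F : set_system I) (e : I -> \bar R) :=
  forall eps : R, 0 < eps -> \forall i \near F, (e i <= eps%:E)%E.

(** Such bounds come from Young's inequality with weight [N.+1] on the small factor. Given [eps],
    the weight is chosen to bring [C / N.+1] below [eps / 2]; the smallness of [a] then absorbs the
    fixed factor [N.+1]. *)
Lemma vanishing_of_weighted_bound (R : realType) (I : Type) (F : set_system I) {FF : Filter F}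
   (a b : I -> \bar R) (C : R) : 0 <= C ->
  (forall N : nat, \forall i \near F,
     (b i <= N.+1%:R%:E * a i + (C / N.+1%:R)%:E)%E) ->
  vanishing F a -> vanishing F b.
Proof.
move=> C0 h va eps eps0.
pose N := Num.truncn (2 * C / eps).
have N0 : 0 < N.+1%:R :> R by rewrite ltr0n.
have CN : C / N.+1%:R <= eps / 2.
  have := truncnS_gt (2 * C / eps); rewrite -/N ltr_pdivrMr // ler_pdivrMr //.
  by move=> hN; lra.
have e' : 0 < eps / 2 / N.+1%:R by rewrite !divr_gt0.
have := va _ e'; apply: filterS2 (h N) => i hb ha.
apply: (le_trans hb); apply: (@le_trans _ _ (N.+1%:R%:E * (eps / 2 / N.+1%:R)%:E + (eps / 2)%:E)%E).
  by apply: leeD; [rewrite lee_wpmul2l ?lee_fin|rewrite lee_fin].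
by rewrite -EFinM -EFinD lee_fin [N.+1%:R * _]mulrC divfK ?gt_eqF // -splitr.
Qed.

Section pairing.
Context d (T : measurableType d) (R : realType).
Variable mu : {measure set T -> \bar R}.

(* Only biadditivity is required: R[i] and 'rV[R[i]]_d carry no canonical
   R-module structure.  Natural multiples suffice for Young's inequality with
   integer weights, which replaces Cauchy-Schwarz. *)
Record pairing (V : zmodType) (B : T -> V -> V -> R) (mf : (T -> V) -> Prop) : Prop :=
  Pairing {
  pairDl : forall x a b c, B x (a + b) c = B x a c + B x b c;
  pairC : forall x a b, B x a b = B x b a;
  pair_ge0 : forall x a, 0 <= B x a a;
  pair_mfD : forall X Y, mf X -> mf Y -> mf (fun x => X x + Y x);
  pair_mfN : forall X, mf X -> mf (fun x => - X x);
  pair_meas : forall X Y, mf X -> mf Y ->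
    measurable_fun setT (fun x => B x (X x) (Y x)) }.

Variables (V : zmodType) (B : T -> V -> V -> R) (mf : (T -> V) -> Prop).
Hypothesis hB : pairing B mf.
Implicit Types (X Y : T -> V).

Definition sqnorm X : \bar R := (\int[mu]_x (B x (X x) (X x))%:E)%E.
Definition square_integrable X := mf X /\ (sqnorm X < +oo)%E.

Lemma pair0l x a : B x 0 a = 0.
Proof. by apply: (addIr (B x 0 a)); rewrite -(pairDl hB) !add0r. Qed.

Lemma pairNl x a b : B x (- a) b = - B x a b.
Proof. by apply/eqP; rewrite -addr_eq0 -(pairDl hB) addNr pair0l. Qed.

Lemma pairDr x a b c : B x a (b + c) = B x a b + B x a c.
Proof. by rewrite !(pairC hB x a) (pairDl hB). Qed.

Lemma pairNr x a b : B x a (- b) = - B x a b.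
Proof. by rewrite !(pairC hB x a) pairNl. Qed.

Lemma pairMnl x a b n : B x (a *+ n) b = n%:R * B x a b.
Proof.
elim: n => [|n IH]; first by rewrite mulr0n pair0l mul0r.
by rewrite mulrS (pairDl hB) IH -[n.+1]add1n natrD mulrDl mul1r.
Qed.

Lemma pairMnr x a b n : B x a (b *+ n) = n%:R * B x a b.
Proof. by rewrite !(pairC hB x a) pairMnl. Qed.

(** The form is nonnegative at [a *+ N.+1 - b] and at [a *+ N.+1 + b]; expanding and dividing by
    twice the weight gives both signs. *)
Lemma pair_young x a b (N : nat) :
  `|B x a b| <= (N.+1%:R * B x a a + B x b b / N.+1%:R) / 2.
Proof.
have N0 : 0 < N.+1%:R :> R by rewrite ltr0n.
have h1 := pair_ge0 hB x (a *+ N.+1 - b); have h2 := pair_ge0 hB x (a *+ N.+1 + b).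
move: h1 h2; rewrite !(pairDl hB, pairDr, pairNl, pairNr, pairMnl, pairMnr).
rewrite (pairC hB x b a); move: N0; set n := N.+1%:R; set p := B x a a; set q := B x b b.
set r := B x a b => n0 h1 h2.
rewrite ler_norml lerNl -subr_ge0 -[X in _ && X]subr_ge0.
have -> : (n * p + q / n) / 2 - - r = (n * (n * p) + q + 2 * n * r) / (2 * n).
  by field; rewrite gt_eqF.
have -> : (n * p + q / n) / 2 - r = (n * (n * p) + q - 2 * n * r) / (2 * n).
  by field; rewrite gt_eqF.
by apply/andP; split; apply: divr_ge0; lra.
Qed.

(** Nonnegativity of the form at [a - b]. *)
Lemma pair_sqD x a b : B x (a + b) (a + b) <= 2 * (B x a a + B x b b).
Proof.
have := pair_ge0 hB x (a - b); rewrite !(pairDl hB, pairDr, pairNl, pairNr).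
rewrite (pairC hB x b a); lra.
Qed.

Lemma measurable_sq X : mf X -> measurable_fun setT (fun x => (B x (X x) (X x))%:E).
Proof. by move=> mX; apply/measurable_EFinP; exact: (pair_meas hB). Qed.

Lemma sqnormD X Y : mf X -> mf Y ->
  (sqnorm (fun x => X x + Y x)%R <= 2%:E * (sqnorm X + sqnorm Y))%E.
Proof.
move=> mX mY; rewrite /sqnorm -ge0_integralD //=; last 4 first.
- by move=> x _; rewrite lee_fin (pair_ge0 hB).
- exact: measurable_sq.
- by move=> x _; rewrite lee_fin (pair_ge0 hB).
- exact: measurable_sq.
rewrite -ge0_integralZl //=; last 2 first.
- by apply: emeasurable_funD; exact: measurable_sq.
- by move=> x _; rewrite adde_ge0 ?lee_fin ?(pair_ge0 hB).
apply: ge0_le_integral => //.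
- by move=> x _; rewrite lee_fin (pair_ge0 hB).
- by apply: measurable_sq; exact: (pair_mfD hB).
- apply: emeasurable_funM => //; by apply: emeasurable_funD; exact: measurable_sq.
- by move=> x _; rewrite -EFinD -EFinM lee_fin pair_sqD.
Qed.

Lemma square_integrableD X Y : square_integrable X -> square_integrable Y ->
  square_integrable (fun x => X x + Y x).
Proof.
move=> [mX hX] [mY hY]; split; first exact: (pair_mfD hB).
apply: (le_lt_trans (sqnormD mX mY)).
by rewrite lte_mul_pinfty ?lee_fin // lte_add_pinfty.
Qed.

Lemma square_integrableN X : square_integrable X -> square_integrable (fun x => - X x).
Proof.
move=> [mX hX]; split; first exact: (pair_mfN hB).
by rewrite /sqnorm; under eq_integral do rewrite pairNl pairNr opprK.
Qed.

Lemma square_integrableB X Y : square_integrable X -> square_integrable Y ->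
  square_integrable (fun x => X x - Y x).
Proof. by move=> hX /square_integrableN; exact: square_integrableD. Qed.

Lemma sq_integrable X : square_integrable X ->
  mu.-integrable setT (fun x => (B x (X x) (X x))%:E).
Proof.
move=> [mX hX]; apply/integrableP; split; first exact: measurable_sq.
rewrite (_ : (\int[mu]_x _)%E = sqnorm X) //; apply: eq_integral => x _.
by rewrite gee0_abs // lee_fin (pair_ge0 hB).
Qed.

Lemma pair_integrable X Y : square_integrable X -> square_integrable Y ->
  mu.-integrable setT (fun x => (B x (X x) (Y x))%:E).
Proof.
move=> hX hY; have iX := sq_integrable hX; have iY := sq_integrable hY.
apply: (le_integrable _ _ _ (integrableD _ iX iY)) => //.
  by apply/measurable_EFinP; apply: (pair_meas hB); [case: hX|case: hY].
move=> x _; rewrite -EFinD /= !lee_fin.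
have := @pair_young x (X x) (Y x) 0; rewrite mul1r divr1 => h.
apply: (le_trans h); rewrite ger0_norm; last by rewrite addr_ge0 ?(pair_ge0 hB).
have := pair_ge0 hB x (X x); have := pair_ge0 hB x (Y x); lra.
Qed.

Definition rsq X : R := \int[mu]_x (B x (X x) (X x)).

Lemma rsqE X : square_integrable X -> sqnorm X = (rsq X)%:E.
Proof.
move=> hX; rewrite /rsq /Rintegral /sqnorm fineK //.
exact: integrable_fin_num (sq_integrable hX).
Qed.

Lemma rsq_ge0 X : 0 <= rsq X.
Proof. by apply: Rintegral_ge0 => x _; exact: (pair_ge0 hB). Qed.

Lemma pair_integral_young X Y (N : nat) : square_integrable X -> square_integrable Y ->
  `|\int[mu]_x B x (X x) (Y x)| <= (N.+1%:R * rsq X + rsq Y / N.+1%:R) / 2.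
Proof.
move=> hX hY; have iX := sq_integrable hX; have iY := sq_integrable hY.
have iXY := pair_integrable hX hY.
apply: (le_trans (le_normr_Rintegral measurableT iXY)).
have i1 : mu.-integrable setT (fun x => (N.+1%:R / 2 * B x (X x) (X x))%:E).
  by under eq_fun do rewrite EFinM; exact: integrableZl.
have i2 : mu.-integrable setT (fun x => (N.+1%:R^-1 / 2 * B x (Y x) (Y x))%:E).
  by under eq_fun do rewrite EFinM; exact: integrableZl.
apply: (@le_trans _ _ (\int[mu]_x (N.+1%:R / 2 * B x (X x) (X x)
                          + N.+1%:R^-1 / 2 * B x (Y x) (Y x)))).
  apply: le_Rintegral => //.
  - by have := integrable_abse iXY.
  - exact: (integrableD measurableT i1 i2).
  - move=> x _; apply: (le_trans (pair_young x _ _ N)).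
    by move: (N.+1%:R) => n; move: (n^-1) => m; lra.
rewrite RintegralD // !RintegralZl // -!/(rsq _).
by move: (N.+1%:R) => n; move: (n^-1) => m; lra.
Qed.

Lemma pair_integralDl X X' Y : square_integrable X -> square_integrable X' ->
  square_integrable Y ->
  \int[mu]_x B x (X x + X' x) (Y x) =
    \int[mu]_x B x (X x) (Y x) + \int[mu]_x B x (X' x) (Y x).
Proof.
move=> hX hX' hY; rewrite -RintegralD //; try exact: pair_integrable.
by apply: eq_Rintegral => x _; rewrite (pairDl hB).
Qed.

Lemma pair_integralC X Y : \int[mu]_x B x (X x) (Y x) = \int[mu]_x B x (Y x) (X x).
Proof. by apply: eq_Rintegral => x _; rewrite (pairC hB). Qed.

Lemma pair_integralDr X Y Y' : square_integrable X -> square_integrable Y ->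
  square_integrable Y' ->
  \int[mu]_x B x (X x) (Y x + Y' x) =
    \int[mu]_x B x (X x) (Y x) + \int[mu]_x B x (X x) (Y' x).
Proof.
by move=> hX hY hY'; rewrite pair_integralC pair_integralDl // !(pair_integralC _ X).
Qed.

Lemma pair_integralNr X Y : square_integrable X -> square_integrable Y ->
  \int[mu]_x B x (X x) (- Y x) = - \int[mu]_x B x (X x) (Y x).
Proof.
move=> hX hY; apply/eqP; rewrite -addr_eq0 -pair_integralDr //; last exact: square_integrableN.
rewrite (@eq_Rintegral _ _ _ _ _ (fun=> 0)); first by rewrite Rintegral_cst // mul0r.
by move=> x _; rewrite addNr (pairC hB) pair0l.
Qed.

(** With increments dX and dY, bilinearity leaves the errors B(dX, Y), B(X, dY) and B(dX, dY). The
    first two take the weight [N.+1] on the increment, so that the fixed factor is divided by it;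
    the last takes weight 1. *)
Lemma pair_integral_cvg (I : Type) (F : set_system I) {FF : Filter F}
    (X_ Y_ : I -> T -> V) X Y :
  (\forall i \near F, mf (X_ i)) -> (\forall i \near F, mf (Y_ i)) ->
  square_integrable X -> square_integrable Y ->
  vanishing F (fun i => sqnorm (fun x => X_ i x - X x)) ->
  vanishing F (fun i => sqnorm (fun x => Y_ i x - Y x)) ->
  \int[mu]_x B x (X_ i x) (Y_ i x) @[i --> F] --> \int[mu]_x B x (X x) (Y x).
Proof.
move=> mX_ mY_ hX hY vX vY; apply/cvgrPdist_le => eps eps0.
pose C := rsq X + rsq Y; have C0 : 0 <= C by rewrite addr_ge0 // rsq_ge0.
pose N := Num.truncn (C / eps); have N0 : 0 < N.+1%:R :> R by rewrite ltr0n.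
have CN : C / N.+1%:R <= eps.
  rewrite ler_pdivrMr // mulrC -ler_pdivrMr //; apply: ltW; exact: truncnS_gt.
(* Chosen so that [N.+1 * e + e] is [eps / 2]; the fixed factors contribute at most half of
   [C / N.+1], which is the other [eps / 2]. *)
pose e := eps / (2 * N.+2%:R).
have N20 : 0 < N.+2%:R :> R by rewrite ltr0n.
have e0 : 0 < e by rewrite divr_gt0 // mulr_gt0.
near=> i.
have mXi : mf (X_ i) by near: i.
have mYi : mf (Y_ i) by near: i.
have sX : (sqnorm (fun x => X_ i x - X x)%R <= e%:E)%E by near: i; exact: vX.
have sY : (sqnorm (fun x => Y_ i x - Y x)%R <= e%:E)%E by near: i; exact: vY.
have hdX : square_integrable (fun x => X_ i x - X x).
  split; last exact: le_lt_trans sX (ltry _).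
  by apply: (pair_mfD hB) => //; apply: (pair_mfN hB); case: hX.
have hdY : square_integrable (fun x => Y_ i x - Y x).
  split; last exact: le_lt_trans sY (ltry _).
  by apply: (pair_mfD hB) => //; apply: (pair_mfN hB); case: hY.
have -> : \int[mu]_x B x (X_ i x) (Y_ i x) =
    \int[mu]_x B x (X x + (X_ i x - X x)) (Y x + (Y_ i x - Y x)).
  by apply: eq_Rintegral => x _; rewrite [X x + _]addrC [Y x + _]addrC !subrK.
have hY' := square_integrableD hY hdY.
have /= e1 := pair_integralDr hX hY hdY; have /= e2 := pair_integralDr hdX hY hdY.
have /= -> := pair_integralDl hX hdX hY'; rewrite e1 e2.
have := pair_integral_young 0 hdX hdY; have := pair_integral_young N hdX hY.
have -> : \int[mu]_x B x (X x) (Y_ i x - Y x) = \int[mu]_x B x (Y_ i x - Y x) (X x).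
  exact: pair_integralC.
have := pair_integral_young N hdY hX.
move: sX sY; rewrite !rsqE // !lee_fin.
set a := rsq _; set b := rsq (fun x => Y_ i x - Y x).
set i0 := Rintegral _ _ _; set i1 := Rintegral _ _ _; set i2 := Rintegral _ _ _.
set i3 := Rintegral _ _ _.
move=> ae be; rewrite !ler_norml mul1r divr1.
move: CN; rewrite /C mulrDl => CN.
have Na : N.+1%:R * a <= N.+1%:R * e by rewrite ler_pM2l.
have Nb : N.+1%:R * b <= N.+1%:R * e by rewrite ler_pM2l.
have eE : e * N.+1%:R + e = eps / 2.
  have -> : e * N.+1%:R + e = e * N.+2%:R by rewrite -[N.+2%:R]natr1 mulrDr mulr1.
  by rewrite /e; field; rewrite gt_eqF.
move: CN Na Nb eE; rewrite [N.+1%:R * e]mulrC.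
move: (rsq X / N.+1%:R) (rsq Y / N.+1%:R) (N.+1%:R * a) (N.+1%:R * b) (e * N.+1%:R).
move=> p q r s w CN Na Nb eE /andP[? ?] /andP[? ?] /andP[? ?].
apply/andP; split; lra.
Unshelve. all: by end_near. Qed.

End pairing.

(** * Complex scalars *)

Section Lnorm_vanishing.
Context d (T : measurableType d) (R : realType).
Variable mu : {measure set T -> \bar R}.

Lemma poweR_Lnorm_nat (n : nat) (h : T -> R) : (forall x, 0 <= h x) ->
  (poweR (Lnorm mu n.+1%:R%:E (fun x => (h x)%:E)) n.+1%:R
   = \int[mu]_x (h x ^+ n.+1)%:E)%E.
Proof.
move=> h0; rewrite poweR_Lnorm ?pnatr_eq0 //; apply: eq_integral => x _.
by rewrite gee0_abs ?lee_fin // poweR_EFin powR_mulrn.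
Qed.

Lemma Lnorm_lty (n : nat) (h : T -> R) : (forall x, 0 <= h x) ->
  (Lnorm mu n.+1%:R%:E (fun x => (h x)%:E) < +oo)%E ->
  (\int[mu]_x (h x ^+ n.+1)%:E < +oo)%E.
Proof. by move=> h0 hoo; rewrite -poweR_Lnorm_nat //; exact: poweR_lty. Qed.

Lemma Lnorm_vanishing (I : Type) (F : set_system I) {FF : Filter F} (n : nat)
    (h : I -> T -> R) : (forall i x, 0 <= h i x) ->
  Lnorm mu n.+1%:R%:E (fun x => (h i x)%:E) @[i --> F] --> 0%E ->
  vanishing F (fun i => (\int[mu]_x (h i x ^+ n.+1)%:E)%E).
Proof.
move=> h0 hF eps eps0; pose del := powR eps n.+1%:R^-1.
have del0 : 0 < del by exact: powR_gt0.
have : \forall i \near F, (Lnorm mu n.+1%:R%:E (fun x => (h i x)%:E) < del%:E)%E.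
  have := hF (fun e => (e < del%:E)%E); apply.
  by apply: open_nbhs_nbhs; split; [exact: open_ereal_lt_ereal|rewrite /= lte_fin].
apply: filterS => i hi; rewrite -poweR_Lnorm_nat //.
have -> : eps%:E = poweR del%:E n.+1%:R.
  by rewrite poweR_EFin /del -powRrM mulVf ?pnatr_eq0 // powRr1 // ltW.
by apply: gt0_ler_poweR; rewrite ?ler0n ?in_itv /= ?andbT ?lee_fin ?Lnorm_ge0 ?leey ?ltW.
Qed.

End Lnorm_vanishing.

Section complex_pairing.
Variable R : realType.
Implicit Types z w : R[i].

(** The real part of z times the conjugate of w, that is, the Euclidean product of the plane. *)
Definition zdot z w : R := complex.Re z * complex.Re w + complex.Im z * complex.Im w.

Lemma normc_sqr z : Normc.normc z ^+ 2 = zdot z z.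
Proof. by case: z => a b; rewrite /= sqr_sqrtr ?addr_ge0 ?sqr_ge0 // -!expr2. Qed.

Lemma normc_ge0 z : 0 <= Normc.normc z.
Proof. by case: z => a b; exact: sqrtr_ge0. Qed.

Lemma normc_expr4 z : Normc.normc z ^+ 4 = zdot z z ^+ 2.
Proof. by rewrite -normc_sqr -exprM. Qed.

Lemma zdot_mul z w : zdot (z * w) (z * w) = zdot z z * zdot w w.
Proof. by case: z w => [a b] [c e]; rewrite /zdot /=; ring. Qed.

Lemma zdot_ge0 z : 0 <= zdot z z.
Proof. by rewrite -normc_sqr exprn_ge0 // normc_ge0. Qed.

Lemma zdot_sqD3 z1 z2 z3 : zdot (z1 + z2 + z3) (z1 + z2 + z3) <=
  3 * (zdot z1 z1 + zdot z2 z2 + zdot z3 z3).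
Proof.
case: z1 z2 z3 => [a a'] [b b'] [c c']; rewrite /zdot /= -subr_ge0.
have -> : 3 * (a * a + a' * a' + (b * b + b' * b') + (c * c + c' * c'))
    - ((a + b + c) * (a + b + c) + (a' + b' + c') * (a' + b' + c'))
  = (a - b) ^+ 2 + (b - c) ^+ 2 + (a - c) ^+ 2
    + ((a' - b') ^+ 2 + (b' - c') ^+ 2 + (a' - c') ^+ 2) by ring.
by rewrite !addr_ge0 ?sqr_ge0.
Qed.

End complex_pairing.

(** * Products of L^4 functions as elements of L^2 *)

Section L4.
Variables (R : realType) (d : nat) (M : closed_riemannian_manifold R d).
Variable mu : {measure set (borel M) -> \bar R}.
Implicit Types f g : M -> R[i].

Lemma cmeasurableD f g : cmeasurable f -> cmeasurable g ->
  cmeasurable (fun x => f x + g x).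
Proof.
move=> [f1 f2] [g1 g2]; split.
  by rewrite (_ : (fun x => _) = (fun x : borel M => complex.Re (f x) + complex.Re (g x)));
    [exact: measurable_funD|apply/funext => x; case: (f x) (g x) => [? ?] [? ?]].
by rewrite (_ : (fun x => _) = (fun x : borel M => complex.Im (f x) + complex.Im (g x)));
  [exact: measurable_funD|apply/funext => x; case: (f x) (g x) => [? ?] [? ?]].
Qed.

Lemma cmeasurableN f : cmeasurable f -> cmeasurable (fun x => - f x).
Proof.
move=> [f1 f2]; split.
  by rewrite (_ : (fun x => _) = (fun x : borel M => - complex.Re (f x)));
    [exact: measurable_funN|apply/funext => x; case: (f x) => ? ?].
by rewrite (_ : (fun x => _) = (fun x : borel M => - complex.Im (f x)));
  [exact: measurable_funN|apply/funext => x; case: (f x) => ? ?].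
Qed.

Lemma cmeasurableM f g : cmeasurable f -> cmeasurable g ->
  cmeasurable (fun x => f x * g x).
Proof.
move=> [f1 f2] [g1 g2]; split.
  rewrite (_ : (fun x => _) = (fun x : borel M => complex.Re (f x) * complex.Re (g x)
     - complex.Im (f x) * complex.Im (g x))).
    by apply: measurable_funB; exact: measurable_funM.
  by apply/funext => x; case: (f x) (g x) => [? ?] [? ?].
rewrite (_ : (fun x => _) = (fun x : borel M => complex.Re (f x) * complex.Im (g x)
     + complex.Im (f x) * complex.Re (g x))).
  by apply: measurable_funD; exact: measurable_funM.
by apply/funext => x; case: (f x) (g x) => [? ?] [? ?].
Qed.

Lemma cmeasurable_real (f : M -> R) : measurable_fun setT (f : borel M -> R) ->
  cmeasurable (fun x => (f x)%:C%C).
Proof. by move=> mf; split => //=; exact: measurable_cst. Qed.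

Lemma measurable_zdot f g : cmeasurable f -> cmeasurable g ->
  measurable_fun setT (fun x : borel M => zdot (f x) (g x)).
Proof.
by move=> [f1 f2] [g1 g2]; apply: measurable_funD; exact: measurable_funM.
Qed.

Lemma zdot_pairing : @pairing _ (borel M) R R[i] (fun _ => @zdot R) (@cmeasurable R d M).
Proof.
split.
- by move=> _ [? ?] [? ?] [? ?]; rewrite /zdot /=; ring.
- by move=> _ [? ?] [? ?]; rewrite /zdot /=; ring.
- by move=> _ z; exact: zdot_ge0.
- by move=> X Y; exact: cmeasurableD.
- by move=> X; exact: cmeasurableN.
- by move=> X Y; exact: measurable_zdot.
Qed.

Notation csqnorm := (@sqnorm _ (borel M) R mu R[i] (fun _ => @zdot R)).
Notation csquare_integrable :=
  (@square_integrable _ (borel M) R mu R[i] (fun _ => @zdot R) (@cmeasurable R d M)).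

Lemma in_L2P f : in_Lp mu 2 f -> csquare_integrable f.
Proof.
move=> [mf hf]; split => //; rewrite /sqnorm.
under eq_integral do rewrite -normc_sqr.
by apply: Lnorm_lty hf => x; exact: normc_ge0.
Qed.

Lemma L2_vanishing (I : Type) (F : set_system I) {FF : Filter F} (f_ : I -> M -> R[i]) :
  Lp_norm mu 2 (f_ i) @[i --> F] --> 0%E -> vanishing F (fun i => csqnorm (f_ i)).
Proof.
move=> hf; rewrite /sqnorm.
have := @Lnorm_vanishing _ _ R mu _ F FF 1 (fun i x => Normc.normc (f_ i x))
  (fun i x => normc_ge0 _) hf.
move=> h eps e0; have := h eps e0; apply: filterS => i.
by under eq_integral do rewrite normc_sqr.
Qed.

(** The fourth power of the L^4 norm. *)
Definition quartic f : \bar R := (\int[mu]_(x in [set: borel M]) (zdot (f x) (f x) ^+ 2)%:E)%E.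

Lemma in_L4P f : in_Lp mu 4 f -> cmeasurable f /\ (quartic f < +oo)%E.
Proof.
move=> [mf hf]; split => //; rewrite /quartic.
under eq_integral do rewrite -normc_expr4.
by apply: (@Lnorm_lty _ _ R mu 3 (fun x => Normc.normc (f x))) hf => x; exact: normc_ge0.
Qed.

Lemma L4_vanishing (I : Type) (F : set_system I) {FF : Filter F} (f_ : I -> M -> R[i]) :
  Lp_norm mu 4 (f_ i) @[i --> F] --> 0%E -> vanishing F (fun i => quartic (f_ i)).
Proof.
move=> hf; rewrite /quartic.
have := @Lnorm_vanishing _ _ R mu _ F FF 3 (fun i x => Normc.normc (f_ i x))
  (fun i x => normc_ge0 _) hf.
move=> h eps e0; have := h eps e0; apply: filterS => i.
by under eq_integral do rewrite normc_expr4.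
Qed.

Lemma quartic_ge0 f : (0 <= quartic f)%E.
Proof. by apply: integral_ge0 => x _; rewrite lee_fin sqr_ge0. Qed.

Lemma measurable_quartic f : cmeasurable f ->
  measurable_fun setT (fun x : borel M => (zdot (f x) (f x) ^+ 2)%:E).
Proof.
by move=> mf; apply/measurable_EFinP; apply: measurable_funX; exact: measurable_zdot.
Qed.

Lemma mulr_half_le (a b : R) (N : nat) : 0 <= a -> 0 <= b ->
  a * b <= (N.+1%:R * a ^+ 2 + b ^+ 2 / N.+1%:R) / 2.
Proof.
move=> a0 b0; have n0 : 0 < N.+1%:R :> R by rewrite ltr0n.
move: (N.+1%:R) n0 => n n0; rewrite -subr_ge0.
have -> : (n * a ^+ 2 + b ^+ 2 / n) / 2 - a * b = (n * a - b) ^+ 2 / (2 * n).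
  by field; rewrite gt_eqF.
by rewrite divr_ge0 ?sqr_ge0 // mulr_ge0 // ltW.
Qed.

(** Pointwise, |f g|^2 is at most half of |f|^4 + |g|^4. *)
Lemma L4_mul_square_integrable f g : cmeasurable f -> (quartic f < +oo)%E ->
  cmeasurable g -> (quartic g < +oo)%E -> csquare_integrable (fun x => f x * g x).
Proof.
move=> mf hf mg hg; split; first exact: cmeasurableM.
apply: (@le_lt_trans _ _ (quartic f + quartic g)%E); last exact: lte_add_pinfty.
rewrite /sqnorm /quartic -ge0_integralD //; try exact: measurable_quartic;
  try by move=> x _; rewrite lee_fin sqr_ge0.
apply: ge0_le_integral => //.
- by move=> x _; rewrite lee_fin zdot_ge0.
- have mfg := cmeasurableM mf mg.
  by apply/measurable_EFinP; exact: (measurable_zdot mfg mfg).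
- by apply: emeasurable_funD; exact: measurable_quartic.
- move=> x _; rewrite -EFinD lee_fin zdot_mul.
  apply: (le_trans (mulr_half_le 0 (zdot_ge0 _) (zdot_ge0 _))).
  rewrite mul1r divr1; have := sqr_ge0 (zdot (f x) (f x)); have := sqr_ge0 (zdot (g x) (g x)); lra.
Qed.

(** The difference of products is F1 G1 + F1 g + f G1 with F1, G1 the increments. Squaring produces
    products of squared moduli, to which Young's inequality applies, weighted by [N.+1] on the
    increment whenever the other factor is fixed. *)
Lemma L4_mul_vanishing (I : Type) (F : set_system I) {FF : Filter F}
    (f_ g_ : I -> M -> R[i]) f g :
  (\forall i \near F, cmeasurable (f_ i)) -> (\forall i \near F, cmeasurable (g_ i)) ->
  cmeasurable f -> (quartic f < +oo)%E -> cmeasurable g -> (quartic g < +oo)%E ->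
  vanishing F (fun i => quartic (fun x => f_ i x - f x)) ->
  vanishing F (fun i => quartic (fun x => g_ i x - g x)) ->
  vanishing F (fun i => csqnorm (fun x => f_ i x * g_ i x - f x * g x)).
Proof.
move=> mf_ mg_ mf hf mg hg vf vg.
have qfin h : (quartic h < +oo)%E -> quartic h = (fine (quartic h))%:E.
  by move=> hh; rewrite fineK // ge0_fin_numE // quartic_ge0.
pose C := 2 * (fine (quartic f) + fine (quartic g)).
have C0 : 0 <= C by rewrite mulr_ge0 // addr_ge0 // fine_ge0 // quartic_ge0.
apply: (@vanishing_of_weighted_bound _ _ _ FF
   (* The factor 6 here and the factor 2 in [C] leave room: the pointwise estimates yield 3 and
      3/2. *)
   (fun i => (6%:E * (quartic (fun x => f_ i x - f x)%R
                      + quartic (fun x => g_ i x - g x)%R))%E) _ C) => //.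
- move=> N; near=> i.
  have mfi : cmeasurable (f_ i) by near: i.
  have mgi : cmeasurable (g_ i) by near: i.
  have mdf : cmeasurable (fun x => f_ i x - f x) by apply: cmeasurableD => //; exact: cmeasurableN.
  have mdg : cmeasurable (fun x => g_ i x - g x) by apply: cmeasurableD => //; exact: cmeasurableN.
  have -> : (C / N.+1%:R)%:E = ((2 / N.+1%:R)%:E * (quartic f + quartic g))%E.
    by rewrite (qfin f) // (qfin g) // -EFinD -EFinM /C; congr EFin; ring.
  rewrite muleA -EFinM /sqnorm /quartic.
  rewrite -!ge0_integralD //; try exact: measurable_quartic;
    try by move=> x _; rewrite lee_fin sqr_ge0.
  have n0 : 0 < N.+1%:R :> R by rewrite ltr0n.
  rewrite -!ge0_integralZl //; try (by apply: emeasurable_funD; exact: measurable_quartic);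
    try (by move=> x _; rewrite adde_ge0 // lee_fin sqr_ge0);
    try by rewrite lee_fin divr_ge0.
  rewrite -ge0_integralD //; first last.
  + apply: emeasurable_funM => //; by apply: emeasurable_funD; exact: measurable_quartic.
  + by move=> x _; apply: mule_ge0; [rewrite lee_fin ?divr_ge0|
       apply: adde_ge0; rewrite lee_fin sqr_ge0].
  + apply: emeasurable_funM => //; by apply: emeasurable_funD; exact: measurable_quartic.
  + by move=> x _; apply: mule_ge0; [rewrite lee_fin ?mulr_ge0|
       apply: adde_ge0; rewrite lee_fin sqr_ge0].
  apply: ge0_le_integral => //.
  + by move=> x _; rewrite lee_fin zdot_ge0.
  + have mfg := cmeasurableD (cmeasurableM mfi mgi) (cmeasurableN (cmeasurableM mf mg)).
    by apply/measurable_EFinP; exact: (measurable_zdot mfg mfg).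
  + by apply: emeasurable_funD; (apply: emeasurable_funM => //;
      apply: emeasurable_funD; exact: measurable_quartic).
  move=> x _; rewrite -!EFinD lee_fin.
  set F1 := f_ i x - f x; set G1 := g_ i x - g x.
  have -> : f_ i x * g_ i x - f x * g x = F1 * G1 + F1 * g x + f x * G1.
    by rewrite /F1 /G1; ring.
  apply: (le_trans (zdot_sqD3 _ _ _)); rewrite !zdot_mul.
  have h1 := mulr_half_le 0 (zdot_ge0 F1) (zdot_ge0 G1).
  have h2 := mulr_half_le N (zdot_ge0 F1) (zdot_ge0 (g x)).
  have h3 := mulr_half_le N (zdot_ge0 G1) (zdot_ge0 (f x)).
  have n1 : 1 <= N.+1%:R :> R by rewrite ler1n.
  move: h1 h2 h3; rewrite mul1r divr1 [zdot G1 G1 * _]mulrC.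
  have := ler_wpM2r (sqr_ge0 (zdot F1 F1)) n1; have := ler_wpM2r (sqr_ge0 (zdot G1 G1)) n1.
  have : 0 <= zdot (f x) (f x) ^+ 2 / N.+1%:R by rewrite divr_ge0 ?sqr_ge0.
  have : 0 <= zdot (g x) (g x) ^+ 2 / N.+1%:R by rewrite divr_ge0 ?sqr_ge0.
  have := sqr_ge0 (zdot F1 F1); have := sqr_ge0 (zdot G1 G1).
  clear.
  move: (N.+1%:R) => n.
  move: (zdot F1 F1 ^+ 2) (zdot G1 G1 ^+ 2) (zdot (f x) (f x) ^+ 2) (zdot (g x) (g x) ^+ 2).
  move: (zdot F1 F1 * zdot G1 G1) (zdot F1 F1 * zdot (g x) (g x)) (zdot (f x) (f x) * zdot G1 G1).
  move=> t1 t2 t3 q1 q2 q3 q4; move: (n^-1) => m; move=> *; lra.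
- move=> eps e0; have e' : 0 < eps / 12 by rewrite divr_gt0.
  have := vg _ e'; apply: filterS2 (vf _ e') => i h1 h2.
  apply: (@le_trans _ _ (6%:E * ((eps / 12)%:E + (eps / 12)%:E))%E).
    by rewrite lee_wpmul2l ?lee_fin // leeD.
  by rewrite -EFinD -EFinM lee_fin; lra.
Unshelve. all: by end_near. Qed.

End L4.

(** * Metric, gradient and Laplacian in charts *)

Lemma posdef_unitmx (R : realFieldType) (n : nat) (A : 'M[R]_n) :
  (forall X : 'rV[R]_n, X != 0 -> 0 < (X *m A *m X^T) 0 0) -> A \in unitmx.
Proof.
move=> hA; rewrite unitmxE unitfE; apply/negP => /det0P [v v0 vA].
by have := hA v v0; rewrite vA mul0mx mxE ltxx.
Qed.

(* The segment from A to the identity consists of positive definite matrices,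
   so the determinant cannot vanish along it. *)
Lemma posdef_det_gt0 (R : realType) (n : nat) (A : 'M[R]_n) :
  (forall X : 'rV[R]_n, X != 0 -> 0 < (X *m A *m X^T) 0 0) -> 0 < \det A.
Proof.
move=> hA; rewrite ltNge; apply/negP => detA.
(* Along the segment the determinant is a polynomial in the parameter, so the intermediate value
   theorem for polynomials provides a root. *)
pose P : 'M[{poly R}]_n :=
  \matrix_(i, j) ((1 - 'X) * (A i j)%:P + 'X * ((i == j)%:R)%:P).
have hP x : (\det P).[x] = \det ((1 - x) *: A + x%:M).
  rewrite -horner_evalE -det_map_mx; congr (\det _).
  apply/matrixP => i j; rewrite !mxE; set p := (_ + _ in LHS).
  by rewrite -[LHS]/(p.[x]) /p !(hornerD,hornerM,hornerC,hornerX,hornerN) mulr_natr.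
have /(poly_ivt ler01) [x /andP[x0 x1]] : (\det P).[0] <= 0 <= (\det P).[1].
  by rewrite !hP subr0 subrr scale0r scale1r raddf0 add0r addr0 det1 detA ler01.
rewrite /root hP => /det0P [v v0 hv].
have : v *m ((1 - x) *: A + x%:M) *m v^T = 0 by rewrite hv mul0mx.
move=> /matrixP /(_ 0 0); rewrite mulmxDr mulmxDl -scalemxAr -scalemxAl mul_mx_scalar -scalemxAl.
rewrite !mxE => /eqP; apply/negP; rewrite gt_eqF //.
have h1 := hA v v0; have : 0 < (v *m v^T) 0 0.
  rewrite mxE; have [k vk] : exists k, v 0 k != 0.
    apply/existsP; apply: contraR v0; rewrite negb_exists => /forallP h.
    by apply/eqP/rowP => k; rewrite mxE; have := h k; rewrite negbK => /eqP.
  rewrite (bigD1 k) //= mxE ltr_pwDl //; first by rewrite -expr2 exprn_even_gt0.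
  by apply: sumr_ge0 => l _; rewrite mxE -expr2 sqr_ge0.
move: h1; rewrite !mxE.
have [->|xn0] := eqVneq x 0; first by rewrite subr0 mul1r mul0r addr0.
move=> h1 h2; apply: ltr_wpDl; first by rewrite mulr_ge0 ?subr_ge0 // ltW.
by rewrite mulr_gt0 // lt_def xn0.
Qed.

Section local_geometry.
Variables (R : realType) (d : nat) (M : closed_riemannian_manifold R d).
Implicit Types (i j : chart M) (f h : M -> R) (x : M) (y : 'rV[R]_d).

Definition C1_manifold f := forall i, C1_on (@img _ _ M i) (f \o psi i).

Lemma smooth_C1 f : smooth f -> C1_manifold f.
Proof. by move=> hf i; apply: smooth_on_C1. Qed.

Lemma metric_unit i y : img i y -> metric i y \in unitmx.
Proof. by move=> iy; apply: posdef_unitmx => X; exact: metric_pos. Qed.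

Lemma metric_det_gt0 i y : img i y -> 0 < \det (metric i y).
Proof. by move=> iy; apply: posdef_det_gt0 => X; exact: metric_pos. Qed.

Lemma volume_density_gt0 i y : img i y -> 0 < volume_density i y.
Proof. by move=> iy; rewrite sqrtr_gt0 metric_det_gt0. Qed.

Lemma metric_C1 i k l : C1_on (img i) (fun y => metric i y k l).
Proof. exact/smooth_on_C1/metric_smooth. Qed.

Lemma volume_density_C1 i : C1_on (img i) (volume_density i).
Proof.
apply: C1_on_sqrt; first exact: img_open.
  by apply: C1_on_det; [exact: img_open|exact: metric_C1].
exact: metric_det_gt0.
Qed.

(** By Cramer's rule the entries are minors, which are C^1, divided by the positive determinant. *)
Lemma metric_inv_C1 i k l : C1_on (img i) (fun y => invmx (metric i y) k l).
Proof.
have oi := @img_open _ _ M i.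
apply: (@C1_on_eq _ _ _ _ (fun y => (\det (metric i y))^-1 *
   ((-1) ^+ (l + k) * \det (row' l (col' k (metric i y)))))) => //.
  by move=> y iy; rewrite /invmx metric_unit // !mxE.
have hdet : C1_on (img i) (fun y => \det (metric i y)).
  by apply: C1_on_det => // a b; exact: metric_C1.
apply: (C1_on_mul oi).
  by apply: (C1_on_inv oi hdet) => y iy; rewrite gt_eqF // metric_det_gt0.
apply: (C1_on_mul oi); first exact: C1_on_cst.
apply: (C1_on_det oi) => a b.
apply: (C1_on_eq oi _ (@metric_C1 i (lift l a) (lift k b))) => y iy.
by rewrite !mxE.
Qed.

Lemma chart_gradE i f y k : chart_grad i f y 0 k =
  \sum_l partial l (f \o psi i) y * invmx (metric i y) l k.
Proof. by rewrite mxE; apply: eq_bigr => l _; rewrite mxE. Qed.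

Lemma chart_grad_C1 i f k : smooth f -> C1_on (img i) (fun y => chart_grad i f y 0 k).
Proof.
move=> hf; have oi := @img_open _ _ M i.
apply: (@C1_on_eq _ _ _ _ (fun y =>
  \sum_l partial l (f \o psi i) y * invmx (metric i y) l k)) => //.
  by move=> y _; exact: chart_gradE.
apply: C1_on_sum => // l _; apply: C1_on_mul => //; last exact: metric_inv_C1.
by apply/smooth_on_C1/smooth_on_partial; exact: hf.
Qed.

Lemma chart_grad_continuous i f k y : C1_manifold f -> img i y ->
  {for y, continuous (fun y => chart_grad i f y 0 k)}.
Proof.
move=> hf iy; apply: (@continuous_near_eq 'rV[R]_d R _
   (fun y => \sum_l partial l (f \o psi i) y * invmx (metric i y) l k)).
  by near=> z; exact: chart_gradE.
apply: sum_continuous_at => l; apply: continuousM.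
  exact: C1_on_partial (hf i) iy.
exact: C1_on_continuous (@metric_inv_C1 i l k) iy.
Unshelve. all: by end_near. Qed.

(** The density times the gradient: its Euclidean divergence is the density times the Laplacian. *)
Definition flux i f k y : R := volume_density i y * chart_grad i f y 0 k.

Lemma flux_C1 i f k : smooth f -> C1_on (img i) (flux i f k).
Proof.
move=> hf; apply: C1_on_mul; first exact: img_open.
  exact: volume_density_C1.
exact: chart_grad_C1.
Qed.

Lemma chart_laplacian_continuous i f y : smooth f -> img i y ->
  {for y, continuous (chart_laplacian i f)}.
Proof.
move=> hf iy; apply: continuousM.
  apply: continuousV; first by rewrite gt_eqF // volume_density_gt0.
  exact: C1_on_continuous (@volume_density_C1 i) iy.
apply: sum_continuous_at => k.
exact: C1_on_partial (@flux_C1 i f k hf) iy.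
Qed.

(** The differential of f applied to the gradient of h. No metric factor remains in front of the
    partial derivatives of f, which is the shape produced by the product rule in Green's formula. *)
Definition chart_dot i f h y : R :=
  \sum_k partial k (f \o psi i) y * chart_grad i h y 0 k.

Definition grad_dot f h x : R := inner_at x (smooth_grad f x) (smooth_grad h x).

Lemma chart_at_dom x : dom (chart_at x) x.
Proof. by have := xchooseP (dom_cover x); rewrite inE. Qed.

Lemma grad_dotE f h x : grad_dot f h x = chart_dot (chart_at x) f h (phi (chart_at x) x).
Proof.
rewrite /grad_dot /inner_at /smooth_grad /metric_at.
set i := chart_at x; set y := phi i x.
have iy : img i y by apply: phi_img; exact: chart_at_dom.
rewrite {1}/chart_grad mulmxKV ?metric_unit // mxE.
by apply: eq_bigr => k _; rewrite !mxE.
Qed.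

Lemma chart_dot_continuous i f h y : C1_manifold f -> C1_manifold h -> img i y ->
  {for y, continuous (chart_dot i f h)}.
Proof.
move=> hf hh iy; apply: sum_continuous_at => k; apply: continuousM.
  exact: C1_on_partial (hf i) iy.
exact: chart_grad_continuous.
Qed.

Definition overlap i j : set 'rV[R]_d := img i `&` psi i @^-1` dom j.

Lemma overlap_open i j : open (overlap i j).
Proof.
apply: open_preimage_in; [exact: img_open|exact: psi_continuous|exact: dom_open].
Qed.

Lemma transition_C1 i j k : C1_on (overlap i j) (fun y => phi j (psi i y) 0 k).
Proof. exact/smooth_on_C1/transition_smooth. Qed.

Lemma transition_differentiable i j y : overlap i j y ->
  differentiable (phi j \o psi i) y.
Proof.
move=> h; apply: differentiable_rV => k.
exact: C1_on_differentiable (@transition_C1 i j k) h.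
Qed.

(** The chain rule for [f \o psi i], which equals [(f \o psi j) \o (phi j \o psi i)] near [y]. The
    transpose appears because 'J acts on row vectors from the right. *)
Lemma chart_partial_change i j f y : C1_manifold f -> overlap i j y ->
  \row_k partial k (f \o psi i) y =
  (\row_k partial k (f \o psi j) (phi j (psi i y))) *m ('J (phi j \o psi i) y)^T.
Proof.
move=> hf oy; apply/rowP => k; rewrite !mxE.
rewrite (@near_eq_partial _ _ _ ((f \o psi j) \o (phi j \o psi i))); last first.
  apply: (near_open (@overlap_open i j) oy) => z [_ /= zj].
  by rewrite phiK.
rewrite partial_comp; last 2 first.
- by move=> l; exact: C1_on_differentiable (@transition_C1 i j l) oy.
- by apply: C1_on_differentiable (hf j) _; apply: phi_img; case: oy.
apply: eq_bigr => l _; rewrite !mxE mulrC; congr (_ * _).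
have dt := transition_differentiable oy.
have /matrixP /(_ 0 l) := deriveEjacobian (delta_mx 0 k) dt.
rewrite derive_mx; last exact: diff_derivable.
by rewrite -rowE !mxE.
Qed.

Lemma chart_dot_rowE i f h y : chart_dot i f h y =
  ((\row_k partial k (f \o psi i) y) *m (invmx (metric i y))^T
    *m (\row_k partial k (h \o psi i) y)^T) 0 0.
Proof.
by rewrite -mulmxA -trmx_mul mxE; apply: eq_bigr => k _; rewrite !mxE.
Qed.

(** The Jacobian factors of the two rows of partial derivatives cancel those of the inverse
    metric. *)
Lemma chart_dot_change i j f h y : C1_manifold f -> C1_manifold h -> overlap i j y ->
  chart_dot i f h y = chart_dot j f h (phi j (psi i y)).
Proof.
move=> hf hh oy; rewrite !chart_dot_rowE (chart_partial_change hf oy) (chart_partial_change hh oy).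
have [iy jy] := oy; have := metric_compat iy jy; rewrite /=.
set J := jacobian _ _; set g := metric i y; set g' := metric j _ => gE.
have ug : g \in unitmx by exact: metric_unit.
have ug' : g' \in unitmx by apply: metric_unit; exact: phi_img.
(* By [metric_compat] the invertible matrix [g] is a product with [J] as a factor. *)
have uJ : J \in unitmx.
  by move: ug; rewrite gE !unitmx_mul => /andP[/andP[]].
have -> : invmx g = invmx J^T *m invmx g' *m invmx J.
  apply: (can_inj (mulKmx ug)); rewrite mulmxV // gE.
  by rewrite !mulmxA mulmxK ?unitmx_tr // mulmxK // mulmxV.
rewrite !trmx_mul !trmx_inv trmxK !mulmxA.
rewrite mulmxKV ?unitmx_tr //.
by rewrite mulmxK ?unitmx_tr.
Qed.

Lemma grad_dot_chart i f h x : C1_manifold f -> C1_manifold h -> dom i x ->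
  grad_dot f h x = chart_dot i f h (phi i x).
Proof.
move=> hf hh ix; rewrite grad_dotE.
have cx := chart_at_dom x; rewrite (@chart_dot_change _ i) //.
  by rewrite phiK.
by split; [exact: phi_img|rewrite /= phiK].
Qed.

Lemma grad_dot_continuous f h : C1_manifold f -> C1_manifold h -> continuous (grad_dot f h).
Proof.
move=> hf hh x; have cx := chart_at_dom x; set i := chart_at x in cx.
apply: (@continuous_near_eq _ _ _ (chart_dot i f h \o phi i)).
  apply: filterS (open_nbhs_nbhs (conj (@dom_open _ _ M i) cx)) => z zi.
  exact: grad_dot_chart.
apply: (@continuous_comp _ _ _ (phi i) (chart_dot i f h)); first exact: phi_continuous.
by apply: chart_dot_continuous => //; exact: phi_img.
Qed.

Lemma C1_manifold_continuous f : C1_manifold f -> continuous f.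
Proof.
move=> hf x; have cx := chart_at_dom x; set i := chart_at x in cx.
apply: (@continuous_near_eq _ _ _ ((f \o psi i) \o phi i)).
  apply: filterS (open_nbhs_nbhs (conj (@dom_open _ _ M i) cx)) => z zi /=.
  by rewrite phiK.
apply: (@continuous_comp _ _ _ (phi i) (f \o psi i)); first exact: phi_continuous.
by apply: C1_on_continuous (hf i) _; exact: phi_img.
Qed.

End local_geometry.

(** * Integration in a chart *)

Section extension_by_zero.
Variables (R : realType) (d : nat).
Implicit Types (U K : set 'rV[R]_d) (f : 'rV[R]_d -> R) (y : 'rV[R]_d).

Lemma patch_in U f y : U y -> (f \_ U) y = f y.
Proof. by move=> Uy; rewrite /patch mem_set. Qed.

Lemma patch_out U f y : ~ U y -> (f \_ U) y = 0.
Proof. by move=> Uy; rewrite /patch memNset. Qed.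

Lemma patch_zero_off U K f y : (forall z, U z -> ~ K z -> f z = 0) ->
  ~ K y -> (f \_ U) y = 0.
Proof.
move=> f0 nK; have [Uy|nU] := pselect (U y); last exact: patch_out.
by rewrite patch_in // f0.
Qed.

(** [U] and the complement of [K] are open and cover the space, so every local property of the
    extension is inherited either from [f] or from zero. *)
Lemma patch_near U K f y : open U -> closed K -> K `<=` U ->
  (forall z, U z -> ~ K z -> f z = 0) ->
  (U y /\ {near y, f \_ U =1 f}) \/ (~ K y /\ {near y, f \_ U =1 (fun=> 0)}).
Proof.
move=> oU cK KU f0; have [Uy|nU] := pselect (U y); [left|right]; split => //.
- by apply: near_open oU Uy _ => z; exact: patch_in.
- by move=> /KU.
- apply: (@near_open _ _ (~` K)); first exact: closed_openC.
    by move=> /KU.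
  by move=> z; exact: patch_zero_off.
Qed.

Lemma patch_continuous U K f : open U -> closed K -> K `<=` U ->
  (forall z, U z -> ~ K z -> f z = 0) ->
  (forall y, U y -> {for y, continuous f}) -> continuous (f \_ U).
Proof.
move=> oU cK KU f0 cf y.
have [[Uy h]|[_ h]] := patch_near y oU cK KU f0.
  exact: continuous_near_eq h (cf y Uy).
by apply: continuous_near_eq h _; exact: cst_continuous.
Qed.

Lemma patch_C1 U K f : open U -> closed K -> K `<=` U ->
  (forall z, U z -> ~ K z -> f z = 0) -> C1_on U f -> C1_on setT (f \_ U).
Proof.
move=> oU cK KU f0 hf.
have -> : [set: 'rV[R]_d] = U `|` ~` K.
  by apply/seteqP; split => // y _; have [/KU|] := pselect (K y); [left|right].
apply: C1_on_setU.
  by apply: (C1_on_eq oU _ hf) => y; exact: patch_in.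
have oK : open (~` K) by exact: closed_openC.
apply: (C1_on_eq oK (g := fun=> 0)); last exact: C1_on_cst.
by move=> y; exact: patch_zero_off.
Qed.

Lemma compact_cube K : compact K -> exists2 r : R, 0 <= r & K `<=` cube r.
Proof.
move=> /compact_bounded [r [_ hr]]; exists (`|r| + 1); first by rewrite addr_ge0.
move=> y Ky; apply/cubeP; first by rewrite addr_ge0.
by apply: (hr (`|r| + 1)) => //; rewrite (le_lt_trans (ler_norm _)) // ltrDl.
Qed.

End extension_by_zero.

Section volume.
Variables (R : realType) (d : nat) (M : closed_riemannian_manifold R d).
Variable dg : {measure set (borel M) -> \bar R}.
Variable lam : {measure set (borel 'rV[R]_d) -> \bar R}.
Hypothesis hlam : is_lebesgue lam.
Hypothesis hvol : forall (i : chart M) (A : set (borel M)),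
  measurable A -> A `<=` dom i ->
  dg A = (\int[lam]_(y in phi i @` A) (volume_density i y)%:E)%E.
Implicit Types (i j : chart M) (f h F b : M -> R) (x : M) (y : 'rV[R]_d).

Lemma continuous_measurable_M F : continuous F -> measurable_fun setT (F : borel M -> R).
Proof.
move=> cF; apply: (@measurable_continuous_in R M setT F); first exact: openT.
by move=> x _; exact: cF.
Qed.

Lemma chart_image i (A : set M) : A `<=` dom i ->
  phi i @` A = img i `&` psi i @^-1` A.
Proof.
move=> Ai; apply/seteqP; split => [y [x Ax <-]|y [iy Ay]].
  by split; [exact: phi_img (Ai _ Ax)|rewrite /= phiK //; exact: Ai].
by exists (psi i y) => //; exact: psiK.
Qed.

Lemma psi_measurable i : measurable_fun (img i : set (borel 'rV[R]_d))
  (psi i : borel 'rV[R]_d -> borel M).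
Proof.
apply: (@borel_measurable_continuous 'rV[R]_d M); first exact: img_open.
by move=> y; exact: psi_continuous.
Qed.

Lemma img_measurable i : measurable (img i : set (borel 'rV[R]_d)).
Proof. by apply: (@open_borel 'rV[R]_d); exact: img_open. Qed.

Lemma dom_measurable i : measurable (dom i : set (borel M)).
Proof. by apply: (@open_borel M); exact: dom_open. Qed.

Lemma volume_density_measurable i :
  measurable_fun (img i : set (borel 'rV[R]_d)) (volume_density i : borel 'rV[R]_d -> R).
Proof.
apply: (@measurable_continuous_in R 'rV[R]_d); first exact: img_open.
by move=> y iy; exact: C1_on_continuous (@volume_density_C1 _ _ _ i) iy.
Qed.

Lemma chart_measure i (A : set (borel M)) : measurable A -> A `<=` dom i ->
  dg A = (\int[lam]_(y in img i `&` psi i @^-1` A) (volume_density i y)%:E)%E.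
Proof. by move=> mA Ai; rewrite (hvol mA Ai) chart_image. Qed.

Lemma chart_Rintegral i F : measurable_fun (dom i : set (borel M)) (F : borel M -> R) ->
  \int[dg]_(x in (dom i : set (borel M))) F x =
  \int[lam]_(y in (img i : set (borel 'rV[R]_d))) (F (psi i y) * volume_density i y).
Proof.
move=> mF; apply: (@Rintegral_density_transfer _ _ _ _ R lam dg) => //.
- exact: img_measurable.
- exact: dom_measurable.
- exact: psi_measurable.
- exact: volume_density_measurable.
- by move=> y iy; rewrite ltW // volume_density_gt0.
- by move=> y iy; exact: psi_dom.
- exact: chart_measure.
Qed.

(** The density is part of the function, so that its Lebesgue integral is the volume integral of F
    over the chart; extension by zero makes it a function on all of R^d. *)
Definition pullback i F : 'rV[R]_d -> R :=
  (fun y => F (psi i y) * volume_density i y) \_ (img i).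

Lemma compact_closed_M (K : set M) : compact K -> closed K.
Proof. by apply: compact_closed; exact: carrier_hausdorff. Qed.

Section compact_support.
Variables (i : chart M) (K : set M).
Hypotheses (cK : compact K) (Ki : K `<=` dom i).

Lemma chart_image_compact : compact (phi i @` K).
Proof.
apply: continuous_compact => //; apply: continuous_in_subspaceT => x.
by rewrite inE => /Ki; exact: phi_continuous.
Qed.

Lemma chart_image_closed : closed (phi i @` K).
Proof.
by apply: compact_closed chart_image_compact; exact: norm_hausdorff.
Qed.

Lemma chart_image_sub : phi i @` K `<=` img i.
Proof. by move=> _ [x Kx <-]; apply: phi_img; exact: Ki. Qed.

Lemma chart_image_off y : img i y -> ~ (phi i @` K) y -> ~ K (psi i y).
Proof. by move=> iy nK Ky; apply: nK; exists (psi i y) => //; exact: psiK. Qed.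

Variable F : M -> R.
Hypotheses (cF : continuous F) (F0 : forall x, ~ K x -> F x = 0).

Let F0' y : img i y -> ~ (phi i @` K) y -> F (psi i y) * volume_density i y = 0.
Proof. by move=> iy /(chart_image_off iy) nK; rewrite F0 // mul0r. Qed.

Lemma pullback_off y : ~ (phi i @` K) y -> pullback i F y = 0.
Proof. by apply: patch_zero_off => z; exact: F0'. Qed.

Lemma pullback_continuous : continuous (pullback i F).
Proof.
apply: (patch_continuous _ chart_image_closed chart_image_sub F0').
  exact: img_open.
move=> y iy; apply: continuousM.
  apply: continuous_comp; first exact: psi_continuous.
  exact: cF.
exact: C1_on_continuous (@volume_density_C1 _ _ _ i) iy.
Qed.

Lemma pullback_integrable : lam.-integrable setT (EFin \o (pullback i F : borel 'rV[R]_d -> R)).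
Proof.
have [r r0 Kr] := compact_cube chart_image_compact.
apply: (@continuous_cube_integrable _ _ _ hlam _ r pullback_continuous) => y ny.
by apply: pullback_off => /Kr.
Qed.

Lemma pullback_integral : \int[dg]_(x in [set: borel M]) F x = \int[lam]_y pullback i F y.
Proof.
transitivity (\int[dg]_(x in (dom i : set (borel M))) F x).
  rewrite [RHS]Rintegral_mkcond; apply: eq_Rintegral => x _.
  rewrite /patch; case: ifPn => // /negP nx; apply: F0 => /Ki ix.
  by apply: nx; rewrite inE.
rewrite chart_Rintegral; last by apply: measurable_funTS; exact: continuous_measurable_M.
by rewrite Rintegral_mkcond.
Qed.

(** Serves to show that the volume is finite, hence precedes the integrability of arbitrary
    continuous functions. For nonnegative F the absolute value disappears and the density formula
    reduces the claim to the pullback. *)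
Lemma chart_supported_integrable : (forall x, 0 <= F x) ->
  dg.-integrable setT (EFin \o (F : borel M -> R)).
Proof.
move=> Fge0; have mF := continuous_measurable_M cF.
apply/integrableP; split; first exact/measurable_EFinP.
rewrite (_ : (\int[dg]_x _)%E = (\int[dg]_(x in (dom i : set (borel M))) (F x)%:E)%E); last first.
  rewrite [RHS]integral_mkcond; apply: eq_integral => x _.
  rewrite /= ger0_norm // /patch; case: ifPn => // /negP nx; rewrite F0 // => /Ki ix.
  by apply: nx; rewrite inE.
rewrite (@ge0_integral_density_transfer _ _ _ _ R lam dg (img i) (dom i) (psi i)
   (volume_density i)) //; last 8 first.
- exact: img_measurable.
- exact: dom_measurable.
- exact: psi_measurable.
- exact: volume_density_measurable.
- by move=> y iy; rewrite ltW // volume_density_gt0.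
- by move=> y iy; exact: psi_dom.
- exact: chart_measure.
- by apply: measurable_funTS; exact/measurable_EFinP.
have /integrableP [_] := pullback_integrable; apply: le_lt_trans.
rewrite integral_mkcond le_eqVlt; apply/orP; left; apply/eqP; apply: eq_integral => y _.
rewrite /pullback /patch /=; case: ifPn => [/[!inE] iy|_]; last by rewrite normr0.
by rewrite ger0_norm // mulr_ge0 // ltW // volume_density_gt0.
Qed.

End compact_support.
End volume.

(** * Bump functions *)

Lemma Rintegral_sum d (T : measurableType d) (R : realType)
    (mu : {measure set T -> \bar R}) (I : Type) (r : seq I) (f : I -> T -> R) :
  (forall i, mu.-integrable setT (EFin \o f i)) ->
  mu.-integrable setT (EFin \o (fun x => \sum_(i <- r) f i x)) /\
  \int[mu]_x (\sum_(i <- r) f i x) = \sum_(i <- r) \int[mu]_x f i x.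
Proof.
move=> hf; elim: r => [|i r [IH1 IH2]].
  rewrite big_nil; split.
    apply: eq_integrable (integrable0 mu setT) => // x _ /=; by rewrite big_nil.
  by under eq_Rintegral do rewrite big_nil; rewrite Rintegral_cst // mul0r.
have iD := integrableD measurableT (hf i) IH1.
split.
  by apply: eq_integrable iD => // x _ /=; rewrite big_cons.
rewrite big_cons -IH2 -RintegralD //.
by apply: eq_Rintegral => x _; rewrite big_cons.
Qed.

(** Were g y positive, g would exceed half of it on a box of positive measure around y, and its
    integral would be positive. *)
Lemma Rintegral_eq0_continuous (R : realType) (d : nat)
    (lam : {measure set (borel 'rV[R]_d) -> \bar R}) (g : 'rV[R]_d -> R) (y : 'rV[R]_d) :
  is_lebesgue lam -> continuous g -> (forall z, 0 <= g z) ->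
  lam.-integrable setT (EFin \o (g : borel 'rV[R]_d -> R)) ->
  \int[lam]_z g z = 0 -> g y = 0.
Proof.
move=> hlam cg g0 ig Ig; apply/eqP; rewrite eq_le g0 andbT leNgt; apply/negP => gy.
have : \forall z \near y, g y / 2 < g z.
  have h : \forall s \near g y, g y / 2 < s by apply: nbhs_gt_at; lra.
  exact: cg h.
move=> /nbhs_ballP [e /= e0 he].
(* Half-side [e / 2] keeps the closed box inside the open ball of radius [e] of the sup norm and
   gives it volume [e] to the power [d]. *)
pose B : set 'rV[R]_d := box (y - const_mx (e / 2)) (y + const_mx (e / 2)).
have mB : measurable (B : set (borel 'rV[R]_d)).
  by apply: (@closed_borel 'rV[R]_d); exact: box_closed.
have e20 : 0 < e / 2 by rewrite divr_gt0.
have lamB : lam B = ((\prod_(k < d) e)%:E).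
  rewrite hlam; last by move=> k; rewrite !mxE; lra.
  by congr EFin; apply: eq_bigr => k _; rewrite !mxE; lra.
have gB z : B z -> g y / 2 <= g z.
  move=> hz; apply/ltW/he; rewrite -ball_normE /=; apply/(rV_norm_lt _ e0) => k.
  by have := hz k; rewrite !mxE ltr_norml => /andP[h1 h2]; apply/andP; split; lra.
suff : 0 < \int[lam]_z g z by rewrite Ig ltxx.
have gy2 : 0 < g y / 2 by rewrite divr_gt0.
apply: (@lt_le_trans _ _ (g y / 2 * \prod_(k < d) e)).
  by rewrite mulr_gt0 // prodr_gt0.
have ib : lam.-integrable setT (fun z : borel 'rV[R]_d => ((g y / 2) * \1_B z)%:E).
  apply: (@bounded_support_integrable _ (borel 'rV[R]_d) R lam
    (fun z => g y / 2 * \1_B z) B (g y / 2)) => //.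
  - by rewrite lamB ltry.
  - by apply: measurable_funM => //; exact: measurable_indic.
  - by move=> z nz; rewrite indicE memNset // mulr0.
  - by move=> z hz; rewrite indicE mem_set // mulr1 ger0_norm // ltW.
have -> : g y / 2 * \prod_(k < d) e = \int[lam]_(z in [set: borel 'rV[R]_d]) (g y / 2 * \1_B z).
  rewrite /Rintegral; under eq_integral do rewrite EFinM.
  rewrite integralZl //; last first.
    apply: (@bounded_support_integrable _ (borel 'rV[R]_d) R lam (\1_B) B 1) => //.
    - by rewrite lamB ltry.
    - by move=> z nz; rewrite indicE memNset.
    - by move=> z hz; rewrite indicE mem_set // normr1.
  by rewrite integral_indic // setIT lamB -EFinM.
apply: le_Rintegral => // z _; rewrite indicE; have [hz|hz] := pselect (B z).
  by rewrite mem_set // mulr1 gB.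
by rewrite memNset // mulr0.
Qed.

Section bump.
Variables (R : realType) (d : nat) (M : closed_riemannian_manifold R d).
Implicit Types (i j : chart M) (f h F b : M -> R) (x : M) (y : 'rV[R]_d).

(** In any chart j the overlap with chart i and the preimage of the complement of K form an open
    cover. On the first set the function is [beta] composed with the transition map, on the second
    it is zero. *)
Lemma C1_manifold_zero_off i (K : set M) (beta : 'rV[R]_d -> R) :
  closed K -> K `<=` dom i -> C1_on setT beta ->
  (forall x, dom i x -> ~ K x -> beta (phi i x) = 0) ->
  C1_manifold (fun x => if x \in dom i then beta (phi i x) else 0).
Proof.
move=> cK Ki hb b0 j.
have oK : open (~` K) by exact: closed_openC.
have cover : @img _ _ M j `<=` overlap j i `|` (img j `&` psi j @^-1` (~` K)).
  move=> y jy; have [Ky|nK] := pselect (K (psi j y)).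
    by left; split => //; exact: Ki.
  by right.
apply: C1_on_sub cover _; apply: C1_on_setU.
  apply: (@C1_on_eq _ _ _ _ (beta \o (phi i \o psi j))).
  - exact: overlap_open.
  - by move=> y [_ /= iy]; rewrite mem_set.
  - apply: (C1_on_comp (V := setT)) => //; first exact: overlap_open.
    by move=> k; exact: transition_C1.
have o2 : open (@img _ _ M j `&` psi j @^-1` (~` K)).
  by apply: open_preimage_in => //; [exact: img_open|exact: psi_continuous].
apply: (@C1_on_eq _ _ _ _ (fun=> 0)) => //; last exact: C1_on_cst.
by move=> y [jy /= nK]; case: ifPn => // /[!inE] iy; exact: b0.
Qed.

(** The squared positive part of [q], transported by the chart, where [q] is positive only inside a
    box that the chart maps into [U]. *)
Lemma bump i (U : set M) x0 : open U -> U x0 -> dom i x0 ->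
  exists b K, [/\ C1_manifold b, forall x, 0 <= b x, 0 < b x0, compact K &
     [/\ K `<=` dom i, K `<=` U & forall x, ~ K x -> b x = 0]].
Proof.
move=> oU Ux0 ix0; set y0 := phi i x0.
have oV : open (@img _ _ M i `&` psi i @^-1` U).
  by apply: open_preimage_in => //; [exact: img_open|exact: psi_continuous].
have Vy0 : (@img _ _ M i `&` psi i @^-1` U) y0.
  by split; [exact: phi_img|rewrite /= phiK].
have /nbhs_ballP [e /= e0 eV] := open_nbhs_nbhs (conj oV Vy0).
pose r := e / 2; have r0 : 0 < r by rewrite divr_gt0.
pose Q : set 'rV[R]_d := box (y0 - const_mx r) (y0 + const_mx r).
have QV : Q `<=` img i `&` psi i @^-1` U.
  move=> y hy; apply: eV; rewrite -ball_normE /=; apply/(rV_norm_lt _ e0) => k.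
  have := hy k; rewrite !mxE ltr_norml /r => /andP[h1 h2]; apply/andP; split; lra.
(* The squared radius minus the squared Euclidean distance to [y0], written with sums and products
   so that the C^1 closure lemmas apply. The Euclidean ball lies in the box [Q]. *)
pose q (y : 'rV[R]_d) := r ^+ 2 + \sum_k (-1) * ((y 0 k + - y0 0 k) * (y 0 k + - y0 0 k)).
have oT : open [set: 'rV[R]_d] by exact: openT.
have hq : C1_on setT q.
  have cst (c : R) : C1_on setT (fun _ : 'rV[R]_d => c) by exact: C1_on_cst.
  have hk k : C1_on setT (fun y : 'rV[R]_d => y 0 k + - y0 0 k).
    by apply: (C1_on_add oT _ (cst _)); exact: C1_on_coord.
  apply: (C1_on_add oT (cst _)); apply: (C1_on_sum _ oT) => k _.
  exact: (C1_on_mul oT (cst _) (C1_on_mul oT (hk k) (hk k))).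
have qQ y : 0 < q y -> Q y.
  move=> qy k; have : (y 0 k + - y0 0 k) ^+ 2 <= r ^+ 2.
    apply: ltW; move: qy; rewrite /q (bigD1 k) //= mulN1r addrA => qy.
    rewrite -subr_gt0 expr2; apply: (lt_le_trans qy); rewrite gerDl.
    by apply: sumr_le0 => l _; rewrite mulN1r oppr_le0 -expr2 sqr_ge0.
  rewrite -ler_sqrt ?sqr_ge0 // !sqrtr_sqr (gtr0_norm r0) ler_norml !mxE => /andP[h1 h2].
  by apply/andP; split; lra.
(* The box, which contains the ball, is known to be compact, so its image serves as the enclosing
   set. *)
pose K := psi i @` Q.
have cK : compact K.
  apply: continuous_compact; last exact: box_compact.
  apply: continuous_in_subspaceT => y; rewrite inE => /QV [iy _]; exact: psi_continuous.
have clK : closed K by exact: compact_closed_M.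
have Ki : K `<=` dom i by move=> _ [y /QV [iy _] <-]; exact: psi_dom.
have off x : dom i x -> ~ K x -> sqpos (q (phi i x)) = 0.
  move=> ix nK; rewrite /sqpos max_r ?expr0n // leNgt; apply/negP => /qQ h.
  by apply: nK; exists (phi i x) => //; exact: phiK.
exists (fun x => if x \in dom i then sqpos (q (phi i x)) else 0), K; split => //.
- exact: (C1_manifold_zero_off clK Ki (C1_on_sqpos oT hq) off).
- by move=> x; case: ifP => // _; exact: sqr_ge0.
- rewrite mem_set // /sqpos exprn_gt0 // lt_max; apply/orP; left.
  rewrite /q big1 ?addr0 ?exprn_gt0 // => k _.
  by rewrite subrr mul0r mulr0.
- split => //; first by move=> _ [y /QV [_ Uy] <-].
  by move=> x nK; case: ifPn => // /[!inE] ix; exact: off.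
Qed.

End bump.

(** * Green's formula for smooth functions *)

Section local_green.
Variables (R : realType) (d : nat) (M : closed_riemannian_manifold R d).
Implicit Types (i j : chart M) (f h F b : M -> R) (x : M) (y : 'rV[R]_d).

Lemma continuous_zero_off (K O : set M) F : closed K -> K `<=` O ->
  (forall x, ~ K x -> F x = 0) -> (forall x, O x -> {for x, continuous F}) ->
  continuous F.
Proof.
move=> cK KO F0 cF x; have [Kx|nK] := pselect (K x); first exact: cF (KO _ Kx).
apply: (@continuous_near_eq _ _ _ (fun=> 0)); last exact: cst_continuous.
have oK : open (~` K) by exact: closed_openC.
by apply: filterS (open_nbhs_nbhs (conj oK nK)) => z; exact: F0.
Qed.

Lemma chart_function_continuous i (u : 'rV[R]_d -> R) x :
  (forall y, img i y -> {for y, continuous u}) -> dom i x ->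
  {for x, continuous (u \o phi i)}.
Proof.
move=> cu ix; apply: continuous_comp; first exact: phi_continuous.
by apply: cu; exact: phi_img.
Qed.

Lemma mul_chart_function_continuous i (K : set M) f (u : 'rV[R]_d -> R) :
  closed K -> K `<=` dom i -> continuous f -> (forall x, ~ K x -> f x = 0) ->
  (forall y, img i y -> {for y, continuous u}) ->
  continuous (fun x => f x * u (phi i x)).
Proof.
move=> cK Ki cf f0 cu; apply: (continuous_zero_off cK Ki).
  by move=> x nK; rewrite f0 // mul0r.
move=> x ix; apply: continuousM; first exact: cf.
exact: (@chart_function_continuous i u).
Qed.

Lemma chart_dot_zero_off (K : set M) f h i y : closed K ->
  (forall x, ~ K x -> f x = 0) -> img i y -> ~ K (psi i y) -> chart_dot i f h y = 0.
Proof.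
move=> cK f0 iy nK; rewrite /chart_dot big1 // => k _.
have oK : open (~` K) by exact: closed_openC.
rewrite (@near_eq_partial _ _ _ (fun=> 0)) ?partial_cst ?mul0r //.
apply: (@near_open _ _ (img i `&` psi i @^-1` (~` K))) => //.
  by apply: open_preimage_in => //; [exact: img_open|exact: psi_continuous].
by move=> z [iz /= nz]; exact: f0.
Qed.

Lemma grad_dot_zero_off (K : set M) f h x : closed K ->
  (forall x, ~ K x -> f x = 0) -> ~ K x -> grad_dot f h x = 0.
Proof.
move=> cK f0 nK; rewrite grad_dotE (@chart_dot_zero_off K) //.
  by apply: phi_img; exact: chart_at_dom.
by rewrite phiK //; exact: chart_at_dom.
Qed.

Variable dg : {measure set (borel M) -> \bar R}.
Variable lam : {measure set (borel 'rV[R]_d) -> \bar R}.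
Hypothesis hlam : is_lebesgue lam.
Hypothesis hvol : forall (i : chart M) (A : set (borel M)),
  measurable A -> A `<=` dom i ->
  dg A = (\int[lam]_(y in phi i @` A) (volume_density i y)%:E)%E.

(** Multiplied by the density, the sum of the two integrands is in the chart the Euclidean
    divergence of f times the flux of h. This field extends by zero to a compactly supported C^1
    field, whose divergence has integral zero. *)
Lemma local_green i (K : set M) f h : compact K -> K `<=` dom i ->
  C1_manifold f -> (forall x, ~ K x -> f x = 0) -> smooth h ->
  \int[dg]_(x in [set: borel M]) (f x * chart_laplacian i h (phi i x)) =
  - \int[dg]_(x in [set: borel M]) grad_dot f h x.
Proof.
move=> cK Ki hf f0 hh; have clK := compact_closed_M cK.
have oi := @img_open _ _ M i.
have cf := C1_manifold_continuous hf.
have cl y : img i y -> {for y, continuous (chart_laplacian i h)}.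
  by move=> iy; exact: chart_laplacian_continuous.
have cF1 := mul_chart_function_continuous clK Ki cf f0 cl.
have cF2 := grad_dot_continuous hf (smooth_C1 hh).
have F10 x : ~ K x -> f x * chart_laplacian i h (phi i x) = 0.
  by move=> nK; rewrite f0 // mul0r.
have F20 x : ~ K x -> grad_dot f h x = 0 by move=> nK; exact: (@grad_dot_zero_off K).
apply/eqP; rewrite -subr_eq0 opprK; apply/eqP.
rewrite (pullback_integral hvol Ki cF1 F10) (pullback_integral hvol Ki cF2 F20).
have i1 := pullback_integrable hlam cK Ki cF1 F10.
have i2 := pullback_integrable hlam cK Ki cF2 F20.
rewrite -RintegralD //.
pose g k y := (f \o psi i) y * flux i h k y.
have hg k : C1_on (img i) (g k).
  by apply: (C1_on_mul oi (hf i)); exact: flux_C1.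
have clK' := chart_image_closed cK Ki; have K'i := chart_image_sub Ki.
have g0 k y : img i y -> ~ (phi i @` K) y -> g k y = 0.
  by move=> iy nK; rewrite /g /= f0 ?mul0r //; exact: chart_image_off nK.
have hG k := patch_C1 oi clK' K'i (g0 k) (hg k).
have [r r0 Kr] := compact_cube (chart_image_compact cK Ki).
have G0 k y : ~ cube r y -> (g k \_ (img i)) y = 0.
  by move=> ny; apply: patch_zero_off (g0 k) _ => /Kr.
(* Off the image of the chart both sides vanish: the extended field is zero near such a point. *)
have E y : pullback i (fun x => f x * chart_laplacian i h (phi i x)) y
    + pullback i (grad_dot f h) y = \sum_k partial k (g k \_ (img i)) y.
  have [iy|niy] := pselect (img i y); last first.
    rewrite /pullback !patch_out // addr0 big1 // => k _.
    have [[]//|[_ nE]] := patch_near y oi clK' K'i (g0 k).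
    by rewrite (near_eq_partial _ nE) partial_cst.
  rewrite /pullback !patch_in //.
  rewrite (@grad_dot_chart _ _ _ i f h _ hf (smooth_C1 hh)); last exact: psi_dom.
  rewrite psiK //.
  have v0 : volume_density i y != 0 by rewrite gt_eqF // volume_density_gt0.
  (* The density cancels its inverse in the Laplacian, leaving the two terms of the product rule. *)
  rewrite /chart_laplacian -mulrA mulrAC mulVf // mul1r /chart_dot mulr_sumr mulr_suml -big_split.
  apply: eq_bigr => k _ /=.
  have -> : partial k (g k \_ (img i)) y = partial k (g k) y.
    by apply: near_eq_partial; apply: near_open oi iy _ => z; exact: patch_in.
  have -> : partial k (g k) y = (f \o psi i) y * partial k (flux i h k) y
      + flux i h k y * partial k (f \o psi i) y.
    apply: partialM; first exact: C1_on_differentiable (hf i) iy.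
    exact: C1_on_differentiable (@flux_C1 _ _ _ i h k hh) iy.
  by rewrite /flux /=; congr (_ + _); ring.
rewrite (@eq_Rintegral _ (borel 'rV[R]_d) R lam setT
  (fun y => \sum_k partial k (g k \_ (img i)) y)); last first.
  by move=> y _; exact: E.
have ip k : lam.-integrable setT (EFin \o (partial k (g k \_ (img i)) : borel 'rV[R]_d -> R)).
  apply: (@continuous_cube_integrable _ _ _ hlam _ r).
    by move=> y; exact: C1_on_partial (hG k) I.
  move=> y ny; rewrite (@near_eq_partial _ _ _ (fun=> 0)) ?partial_cst //.
  apply: (@near_open _ _ (~` cube r)) => //; last by move=> z; exact: G0.
  by apply: closed_openC; exact: box_closed.
have [_ ->] := Rintegral_sum (index_enum 'I_d) ip.
by rewrite big1 // => k _; exact: (integral_partial hlam k r0 (hG k) (G0 k)).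
Qed.

(* Two chart expressions of the Laplacian have the same integral against every
   bump supported in the overlap, by the local Green formula in either chart. *)
Lemma chart_laplacian_change_le i j h x : smooth h -> dom i x -> dom j x ->
  chart_laplacian i h (phi i x) <= chart_laplacian j h (phi j x).
Proof.
move=> hh ix jx; rewrite leNgt; apply/negP => lt.
have oi := @dom_open _ _ M i; have oj := @dom_open _ _ M j.
pose D z := chart_laplacian i h (phi i z) - chart_laplacian j h (phi j z).
have cL i' z : dom i' z -> {for z, continuous (chart_laplacian i' h \o phi i')}.
  by move=> iz; apply: chart_function_continuous => // y; exact: chart_laplacian_continuous.
have cD z : (dom i `&` dom j) z -> {for z, continuous D}.
  by move=> [iz jz]; apply: continuousB; exact: cL.
(* The open part of the overlap on which the inequality assumed for contradiction persists; a bump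
   is placed there. *)
pose U := (dom i `&` dom j) `&` D @^-1` [set r | 0 < r].
have oU : open U.
  apply: open_preimage_in => //; first exact: openI.
have Ux : U x by split => //; rewrite /D /= subr_gt0.
have [b [K [hb b0 bx cK [Ki KU bK]]]] := bump oU Ux ix.
have Kj : K `<=` dom j by move=> z /KU [[]].
have clK := compact_closed_M cK; have cb := C1_manifold_continuous hb.
have gi := local_green cK Ki hb bK hh; have gj := local_green cK Kj hb bK hh.
pose Fi z := b z * chart_laplacian i h (phi i z).
pose Fj z := b z * chart_laplacian j h (phi j z).
have cFi : continuous Fi.
  by apply: (mul_chart_function_continuous clK Ki cb bK) => y; exact: chart_laplacian_continuous.
have cFj : continuous Fj.
  by apply: (mul_chart_function_continuous clK Kj cb bK) => y; exact: chart_laplacian_continuous.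
have Fi0 z : ~ K z -> Fi z = 0 by move=> nK; rewrite /Fi bK // mul0r.
have Fj0 z : ~ K z -> Fj z = 0 by move=> nK; rewrite /Fj bK // mul0r.
have : \int[dg]_(z in [set: borel M]) Fi z = \int[dg]_(z in [set: borel M]) Fj z.
  by rewrite gi gj.
(* Both integrals are read in chart [i], so that their difference is the integral of one nonnegative
   continuous function. *)
rewrite (pullback_integral hvol Ki cFi Fi0) (pullback_integral hvol Ki cFj Fj0).
have i1 := pullback_integrable hlam cK Ki cFi Fi0.
have i2 := pullback_integrable hlam cK Ki cFj Fj0.
move/eqP; rewrite -subr_eq0 -(RintegralB measurableT i1 i2) => /eqP I0.
have c1 := pullback_continuous cK Ki cFi Fi0.
have c2 := pullback_continuous cK Ki cFj Fj0.
have := @Rintegral_eq0_continuous R d lam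
  (fun y => pullback i Fi y - pullback i Fj y) (phi i x) hlam.
have iy : img i (phi i x) by exact: phi_img.
have -> : pullback i Fi (phi i x) - pullback i Fj (phi i x) =
    b x * D x * volume_density i (phi i x).
  by rewrite /pullback !patch_in // phiK // /Fi /Fj /D; ring.
move=> /(_ _ _ _ I0) h0; have : b x * D x * volume_density i (phi i x) = 0.
  apply: h0.
  - by move=> y; apply: continuousB; [exact: c1|exact: c2].
  - move=> y; have [jy|njy] := pselect (img i y); last by rewrite /pullback !patch_out // subr0.
    rewrite /pullback !patch_in // -mulrBl mulr_ge0 //; last by rewrite ltW // volume_density_gt0.
    have [/KU [_ /= Dy]|nK] := pselect (K (psi i y)); last by rewrite Fi0 // Fj0 // subr0.
    by rewrite /Fi /Fj -mulrBr mulr_ge0 // ltW.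
  - exact: (integrableB measurableT i1 i2).
apply/eqP; rewrite gt_eqF // !mulr_gt0 //; first by rewrite /D subr_gt0.
exact: volume_density_gt0.
Qed.

Lemma chart_laplacian_change i h x : smooth h -> dom i x ->
  chart_laplacian i h (phi i x) = smooth_laplacian h x.
Proof.
move=> hh ix; have cx := chart_at_dom x.
by apply/eqP; rewrite eq_le !chart_laplacian_change_le.
Qed.

Lemma smooth_laplacian_continuous h : smooth h -> continuous (smooth_laplacian h).
Proof.
move=> hh x; have cx := chart_at_dom x; set i := chart_at x in cx.
apply: (@continuous_near_eq _ _ _ (chart_laplacian i h \o phi i)).
  apply: filterS (open_nbhs_nbhs (conj (@dom_open _ _ M i) cx)) => z zi /=.
  by rewrite chart_laplacian_change.
by apply: chart_function_continuous => // y; exact: chart_laplacian_continuous.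
Qed.

(** * Finite families of bumps, finiteness of the volume and globalization *)

Definition good_bump (b : M -> R) := [/\ C1_manifold b, forall x, 0 <= b x &
  exists i K, [/\ compact K, K `<=` dom i & forall x, ~ K x -> b x = 0]].

(** By compactness, finitely many of the sets where a bump is positive cover M. The sum is left
    unnormalized and divided out where it is used. *)
Lemma bump_cover : exists s : seq (M -> R),
  (forall b, b \in s -> good_bump b) /\ forall x, 0 < \sum_(b <- s) b x.
Proof.
have hb x : {b : M -> R | good_bump b /\ 0 < b x}.
  apply: cid.
  have [b [K [h1 h2 h3 h4 [h5 _ h6]]]] :=
    bump openT (I : setT x) (chart_at_dom x).
  by exists b; split => //; split => //; exists (chart_at x), K.
pose W x := (sval (hb x)) @^-1` [set r | 0 < r].
have oW x : open (W x).
  case: (svalP (hb x)) => -[h1 _ _] _.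
  have c := C1_manifold_continuous h1.
  have -> : W x = setT `&` (sval (hb x)) @^-1` [set r | 0 < r] by rewrite setTI.
  by apply: open_preimage_in => //; [exact: openT|by move=> y _; exact: c].
have cc : @cover_compact M [set: M] by rewrite -compact_cover; exact: carrier_compact.
have [D _ cov] : finite_subset_cover [set: M] W [set: M].
  apply: cc => [x _|x _]; first exact: oW.
  by exists x => //; case: (svalP (hb x)).
exists [seq sval (hb x) | x <- finmap.enum_fset D]; split.
  by move=> b /mapP [x _ ->]; case: (svalP (hb x)).
move=> x; have [z zD Wz] := cov x I.
rewrite big_map (bigD1_seq z) ?finmap.fset_uniq //=.
apply: ltr_pwDl => //; apply: sumr_ge0 => w _.
by case: (svalP (hb w)) => -[].
Qed.

Lemma good_bump_integrable b : good_bump b ->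
  dg.-integrable setT (EFin \o (b : borel M -> R)).
Proof.
move=> [hb b0 [i [K [cK Ki bK]]]].
exact: (chart_supported_integrable hlam hvol cK Ki (C1_manifold_continuous hb) bK b0).
Qed.

Lemma continuous_M_bounded F : continuous F -> exists2 C, 0 <= C & forall x, `|F x| <= C.
Proof.
move=> cF; have [C C0 hC] := compact_continuous_bounded (@carrier_compact _ _ M) (fun x _ => cF x).
by exists C => // x; exact: hC.
Qed.

Lemma C1_manifold_sum (s : seq (M -> R)) : (forall b, b \in s -> C1_manifold b) ->
  C1_manifold (fun x => \sum_(b <- s) b x).
Proof.
move=> hs i; elim: s hs => [|b s IH] hs.
  apply: (@C1_on_eq _ _ _ _ (fun=> 0)); first exact: img_open.
    by move=> y _; rewrite /= big_nil.
  by apply: C1_on_cst; exact: img_open.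
apply: (@C1_on_eq _ _ _ _ (fun y => (b \o psi i) y + ((fun x => \sum_(b <- s) b x) \o psi i) y)).
- exact: img_open.
- by move=> y _; rewrite /= big_cons.
- apply: C1_on_add; first exact: img_open.
    by apply: hs; rewrite mem_head.
  by apply: IH => b' bs; apply: hs; rewrite in_cons bs orbT.
Qed.

(** The sum S of the bumps is integrable and 1/S is bounded by some C, so the constant 1 is
    dominated by C S. *)
Lemma volume_finite : (dg [set: borel M] < +oo)%E.
Proof.
have [s [hs s0]] := bump_cover.
pose S x := \sum_(b <- s) b x.
have cS : continuous S.
  by apply: C1_manifold_continuous; apply: C1_manifold_sum => b /hs [].
have cV : continuous (fun x => (S x)^-1).
  by move=> x; apply: continuousV; [rewrite gt_eqF // s0|exact: cS].
have [C C0 hC] := continuous_M_bounded cV.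
have iS : dg.-integrable setT (EFin \o (S : borel M -> R)).
  rewrite /S; elim: s hs {s0 S cS cV hC} => [|b s IH] hs.
    by apply: eq_integrable (integrable0 dg setT) => // x _ /=; rewrite big_nil.
  have ib := good_bump_integrable (hs b (mem_head _ _)).
  have isum : dg.-integrable setT (EFin \o (fun x : borel M => \sum_(b <- s) b x)).
    by apply: IH => b' bs; apply: hs; rewrite in_cons bs orbT.
  by apply: eq_integrable (integrableD measurableT ib isum) => // x _ /=; rewrite big_cons.
have : dg.-integrable setT (fun x : borel M => 1%E).
  apply: (le_integrable measurableT _ _ (integrableZl measurableT C iS)) => //.
  move=> x _; rewrite /= lee_fin normr1.
  have Sx : 0 < S x by exact: s0.
  have := hC x; rewrite gtr0_norm ?invr_gt0 // -[(S x)^-1]div1r ler_pdivrMr //.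
  by rewrite normrM (ger0_norm C0) (gtr0_norm Sx).
move=> /integrableP [_]; under eq_integral do rewrite abse1.
by rewrite integral_cst // mul1e.
Qed.

Lemma continuous_M_integrable F : continuous F ->
  dg.-integrable setT (EFin \o (F : borel M -> R)).
Proof.
move=> cF; have [C C0 hC] := continuous_M_bounded cF.
apply: (@bounded_support_integrable _ (borel M) R dg F setT C).
- exact: measurableT.
- exact: volume_finite.
- exact: continuous_measurable_M.
- by move=> x [].
- by move=> x _; exact: hC.
Qed.

Lemma grad_dotDl f1 f2 h x : C1_manifold f1 -> C1_manifold f2 ->
  grad_dot (fun z => f1 z + f2 z) h x = grad_dot f1 h x + grad_dot f2 h x.
Proof.
move=> h1 h2; rewrite !grad_dotE /chart_dot -big_split; apply: eq_bigr => k _ /=.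
have iy : img (chart_at x) (phi (chart_at x) x) by apply: phi_img; exact: chart_at_dom.
rewrite -mulrDl; congr (_ * _); apply: partialD.
  exact: C1_on_differentiable (h1 _) iy.
exact: C1_on_differentiable (h2 _) iy.
Qed.

(** With S the sum of the bumps, f is the sum of the pieces b (f / S), each supported in one
    chart. *)
Lemma green_C1 f h : C1_manifold f -> smooth h ->
  \int[dg]_(x in [set: borel M]) (f x * smooth_laplacian h x) =
  - \int[dg]_(x in [set: borel M]) grad_dot f h x.
Proof.
move=> hf hh; have [s [hs s0]] := bump_cover.
have oi i := @img_open _ _ M i.
pose S x := \sum_(b <- s) b x.
have hS : C1_manifold S by apply: C1_manifold_sum => b /hs [].
have hfS : C1_manifold (fun x => f x / S x).
  move=> i; apply: (C1_on_mul (oi i)); first exact: hf.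
  apply: (C1_on_inv (oi i)); first exact: hS.
  by move=> y _; rewrite gt_eqF //= s0.
have cL := smooth_laplacian_continuous hh.
(* Induction over sublists; C^1 regularity of the partial sums is carried along because additivity
   of the gradient product requires it. *)
have part (r : seq (M -> R)) : {subset r <= s} ->
    C1_manifold (fun x => \sum_(b <- r) b x * (f x / S x)) /\
    \int[dg]_(x in [set: borel M]) ((\sum_(b <- r) b x * (f x / S x)) * smooth_laplacian h x) =
    - \int[dg]_(x in [set: borel M]) grad_dot (fun x => \sum_(b <- r) b x * (f x / S x)) h x.
  elim: r => [|b r IH] rs.
    split.
      move=> i; apply: (@C1_on_eq _ _ _ _ (fun=> 0)) => //; last exact: C1_on_cst.
      by move=> y _; rewrite /= big_nil.
    under eq_Rintegral do rewrite big_nil mul0r.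
    rewrite (@eq_Rintegral _ (borel M) R dg setT (fun=> 0)
      (fun x => grad_dot (fun x => \sum_(b <- [::]) b x * (f x / S x)) h x)); last first.
      move=> x _; apply: (@grad_dot_zero_off set0) => //; first exact: closed0.
      by move=> z _; rewrite big_nil.
    by rewrite Rintegral_cst // mul0r oppr0.
  have [] := IH; first by move=> b' br; apply: rs; rewrite in_cons br orbT.
  move=> hr gr; have [hb b0 [i [K [cK Ki bK]]]] := hs b (rs b (mem_head _ _)).
  pose fb x := b x * (f x / S x).
  have hfb : C1_manifold fb.
    by move=> i'; apply: (C1_on_mul (oi i')); [exact: hb|exact: hfS].
  have fbK x : ~ K x -> fb x = 0 by move=> nK; rewrite /fb bK // mul0r.
  have gb := local_green cK Ki hfb fbK hh.
  pose fr x := \sum_(b <- r) b x * (f x / S x).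
  have E : (fun x => \sum_(b <- b :: r) b x * (f x / S x)) = (fun x => fb x + fr x).
    by apply/funext => x; rewrite big_cons.
  rewrite E; split.
    by move=> i'; apply: (C1_on_add (oi i')); [exact: hfb|exact: hr].
  have cb := C1_manifold_continuous hfb; have cr := C1_manifold_continuous hr.
  have -> : \int[dg]_(x in [set: borel M])
        ((\sum_(b <- b :: r) b x * (f x / S x)) * smooth_laplacian h x)
     = \int[dg]_(x in [set: borel M]) (fb x * smooth_laplacian h x + fr x * smooth_laplacian h x).
    by apply: eq_Rintegral => x _; rewrite big_cons mulrDl.
  have ib : dg.-integrable setT (EFin \o (fun x : borel M => fb x * smooth_laplacian h x)).
    apply: (@continuous_M_integrable (fun x => fb x * smooth_laplacian h x)) => x.
    by apply: continuousM; [exact: cb|exact: cL].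
  have ir : dg.-integrable setT (EFin \o (fun x : borel M => fr x * smooth_laplacian h x)).
    apply: (@continuous_M_integrable (fun x => fr x * smooth_laplacian h x)) => x.
    by apply: continuousM; [exact: cr|exact: cL].
  rewrite (RintegralD measurableT ib ir).
  (* The piece vanishes off the chart domain, and on it the chart expression is the intrinsic
     Laplacian. *)
  rewrite gr; have -> : \int[dg]_(x in [set: borel M]) (fb x * smooth_laplacian h x) =
      \int[dg]_(x in [set: borel M]) (fb x * chart_laplacian i h (phi i x)).
    apply: eq_Rintegral => x _; have [ix|nix] := pselect (dom i x).
      by rewrite chart_laplacian_change.
    by rewrite fbK ?mul0r // => /Ki.
  have igb := continuous_M_integrable (grad_dot_continuous hfb (smooth_C1 hh)).
  have igr := continuous_M_integrable (grad_dot_continuous hr (smooth_C1 hh)).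
  rewrite gb -opprD -(RintegralD measurableT igb igr).
  by congr (- _); apply: eq_Rintegral => x _; rewrite (grad_dotDl h x hfb hr).
have [_] := part s (fun b bs => bs).
have -> : (fun x => \sum_(b <- s) b x * (f x / S x)) = f.
  apply/funext => x; rewrite -mulr_suml -/(S x) mulrCA divff ?mulr1 //.
  by rewrite gt_eqF // s0.
move=> <-; apply: eq_Rintegral => x _; congr (_ * _).
by rewrite -mulr_suml -/(S x) mulrCA divff ?mulr1 // gt_eqF // s0.
Qed.

End local_green.

(** * Green's formula in H^2 *)

Section chartwise_measurability.
Variables (R : realType) (d : nat) (M : closed_riemannian_manifold R d).
Implicit Types (x : M).

(** The points whose chart domains are exactly those of S: the atoms of the finite algebra generated
    by the domains. *)
Definition chart_cell (S : {set chart M}) : set M :=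
  \bigcap_(i in [set: chart M]) (if i \in S then dom i else ~` dom i).

Lemma chart_cell_measurable S : measurable (chart_cell S : set (borel M)).
Proof.
apply: fin_bigcap_measurable => [|i _]; first exact: finite_finset.
case: ifP => _; first exact: dom_measurable.
by apply: measurableC; exact: dom_measurable.
Qed.

Lemma chart_cellP S x : chart_cell S x <-> forall i, (x \in dom i) = (i \in S).
Proof.
split=> [h i|h i _].
  have := h i I; case: ifPn => iS hx; first by rewrite mem_set.
  by rewrite memNset.
by rewrite -h; case: ifPn; [rewrite inE|move=> /negP nx ix; apply: nx; rewrite inE].
Qed.

Lemma chart_at_cell S x z : chart_cell S x -> chart_cell S z -> chart_at x = chart_at z.
Proof.
move=> /chart_cellP hx /chart_cellP hz; apply: eq_xchoose => i.
by rewrite hx hz.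
Qed.

(* [chart_at] is constant on each of the finitely many Borel cells. *)
Lemma chart_at_measurable (i : chart M) :
  measurable ([set x | chart_at x = i] : set (borel M)).
Proof.
have -> : [set x | chart_at x = i] = \bigcup_(S in [set: {set chart M}])
    (if `[< exists2 z, chart_cell S z & chart_at z = i >] then chart_cell S else set0).
  apply/seteqP; split => [x /= xi|x [S _]].
    have cx : chart_cell [set j | x \in dom j]%SET x.
      by apply/chart_cellP => j; rewrite inE.
    exists [set j | x \in dom j]%SET => //.
    by case: asboolP => // -[]; exists x.
  by case: asboolP => // -[z cz <-] cx; exact: chart_at_cell cx cz.
apply: fin_bigcup_measurable; first exact: finite_finset.
move=> S _; case: asboolP => _; first exact: chart_cell_measurable.
exact: measurable0.
Qed.

(** Coordinates taken in [chart_at] may jump where the selected chart changes. On each level set of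
    [chart_at] the function agrees with one that is continuous on the chart domain, and there are
    finitely many level sets. *)
Lemma chartwise_measurable (u : chart M -> 'rV[R]_d -> R) :
  (forall i y, img i y -> {for y, continuous (u i)}) ->
  measurable_fun [set: borel M] (fun x : borel M => u (chart_at x) (phi (chart_at x) x)).
Proof.
move=> cu _ Y mY; rewrite setTI.
have -> : (fun x : borel M => u (chart_at x) (phi (chart_at x) x)) @^-1` Y =
    \bigcup_(i in [set: chart M]) ([set x | chart_at x = i] `&` (dom i `&` (u i \o phi i) @^-1` Y)).
  apply/seteqP; split => [x Yx|x [i _ [/= <- [_ Yx]]]] //.
  by exists (chart_at x) => //; split => //; split => //; exact: chart_at_dom.
apply: fin_bigcup_measurable; first exact: finite_finset.
move=> i _; apply: measurableI; first exact: chart_at_measurable.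
have m : measurable_fun (dom i : set (borel M)) (u i \o phi i : borel M -> R).
  apply: (@measurable_continuous_in R M); first exact: dom_open.
  by move=> x ix; apply: chart_function_continuous ix => y; exact: cu.
by apply: m => //; exact: dom_measurable.
Qed.

Lemma metric_at_measurable k l : measurable_fun [set: borel M]
  (fun x : borel M => metric_at x k l).
Proof.
apply: (chartwise_measurable (u := fun i y => metric i y k l)) => i y iy.
exact: C1_on_continuous (@metric_C1 _ _ M i k l) iy.
Qed.

Lemma smooth_grad_measurable (f : M -> R) k : C1_manifold f ->
  measurable_fun [set: borel M] (fun x : borel M => smooth_grad f x 0 k).
Proof.
move=> hf; apply: (chartwise_measurable (u := fun i y => chart_grad i f y 0 k)) => i y iy.
exact: chart_grad_continuous.
Qed.

Lemma inner_at_measurable (X Y : M -> 'rV[R]_d) :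
  (forall k, measurable_fun [set: borel M] (fun x : borel M => X x 0 k)) ->
  (forall k, measurable_fun [set: borel M] (fun x : borel M => Y x 0 k)) ->
  measurable_fun [set: borel M] (fun x : borel M => inner_at x (X x) (Y x)).
Proof.
move=> mX mY.
have -> : (fun x : borel M => inner_at x (X x) (Y x)) =
    (fun x : borel M => \sum_k (\sum_l X x 0 l * metric_at x l k) * Y x 0 k).
  by apply/funext => x; rewrite /inner_at mxE; apply: eq_bigr => k _; rewrite !mxE.
apply: measurable_sum => k; apply: measurable_funM => //.
apply: measurable_sum => l; apply: measurable_funM => //.
exact: metric_at_measurable.
Qed.

End chartwise_measurability.

Section field_pairing.
Variables (R : realType) (d : nat) (M : closed_riemannian_manifold R d).
Implicit Types (x : M) (X Y : M -> 'rV[R[i]]_d).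

Lemma metric_at_sym x : (metric_at x)^T = metric_at x.
Proof. by apply: metric_sym; apply: phi_img; exact: chart_at_dom. Qed.

Lemma inner_atC x (a b : 'rV[R]_d) : inner_at x a b = inner_at x b a.
Proof.
rewrite /inner_at; have -> : b *m metric_at x *m a^T = (a *m metric_at x *m b^T)^T.
  by rewrite !trmx_mul trmxK metric_at_sym mulmxA.
by rewrite [RHS]mxE.
Qed.

Lemma inner_atDl x (a b c : 'rV[R]_d) : inner_at x (a + b) c = inner_at x a c + inner_at x b c.
Proof. by rewrite /inner_at !mulmxDl mxE. Qed.

Lemma inner_at_ge0 x (a : 'rV[R]_d) : 0 <= inner_at x a a.
Proof.
have [->|a0] := eqVneq a 0; first by rewrite /inner_at !mul0mx mxE.
by apply/ltW/metric_pos => //; apply: phi_img; exact: chart_at_dom.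
Qed.

(** The polarization of [cnorm2_at], that is, the real part of the Hermitian product of complexified
    tangent vectors. *)
Definition field_dot x (A B : 'rV[R[i]]_d) : R :=
  inner_at x (map_mx (@complex.Re R) A) (map_mx (@complex.Re R) B)
  + inner_at x (map_mx (@complex.Im R) A) (map_mx (@complex.Im R) B).

Lemma map_ReD (A B : 'rV[R[i]]_d) : map_mx (@complex.Re R) (A + B) =
  map_mx (@complex.Re R) A + map_mx (@complex.Re R) B.
Proof. by apply/rowP => k; rewrite !mxE; case: (A 0 k) (B 0 k) => [? ?] [? ?]. Qed.

Lemma map_ImD (A B : 'rV[R[i]]_d) : map_mx (@complex.Im R) (A + B) =
  map_mx (@complex.Im R) A + map_mx (@complex.Im R) B.
Proof. by apply/rowP => k; rewrite !mxE; case: (A 0 k) (B 0 k) => [? ?] [? ?]. Qed.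

Lemma field_dot_pairing :
  @pairing _ (borel M) R 'rV[R[i]]_d field_dot (@field_measurable R d M).
Proof.
split.
- by move=> x a b c; rewrite /field_dot map_ReD map_ImD !inner_atDl addrACA.
- by move=> x a b; rewrite /field_dot inner_atC; congr (_ + _); exact: inner_atC.
- by move=> x a; rewrite addr_ge0 ?inner_at_ge0.
- move=> X Y mX mY k.
  have -> : (fun x => (X x + Y x) 0 k) = (fun x => X x 0 k + Y x 0 k).
    by apply/funext => x; rewrite mxE.
  exact: cmeasurableD.
- move=> X mX k.
  have -> : (fun x => (- X x) 0 k) = (fun x => - X x 0 k).
    by apply/funext => x; rewrite mxE.
  exact: cmeasurableN.
- move=> X Y mX mY; apply: measurable_funD; apply: inner_at_measurable => k.
  + by under eq_fun do rewrite mxE; exact: (mX k).1.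
  + by under eq_fun do rewrite mxE; exact: (mY k).1.
  + by under eq_fun do rewrite mxE; exact: (mX k).2.
  + by under eq_fun do rewrite mxE; exact: (mY k).2.
Qed.

End field_pairing.

Section H2_green.
Variables (R : realType) (d : nat) (M : closed_riemannian_manifold R d).
Variable dg : {measure set (borel M) -> \bar R}.
Hypothesis hdg : is_volume dg.

Notation csqnorm := (@sqnorm _ (borel M) R dg R[i] (fun _ => @zdot R)).
Notation csquare_integrable :=
  (@square_integrable _ (borel M) R dg R[i] (fun _ => @zdot R) (@cmeasurable R d M)).
Notation fsqnorm := (@sqnorm _ (borel M) R dg 'rV[R[i]]_d (@field_dot R d M)).
Notation fsquare_integrable :=
  (@square_integrable _ (borel M) R dg 'rV[R[i]]_d (@field_dot R d M) (@field_measurable R d M)).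

(** Properness of the filter supplies one index at which X_i - X has finite norm, and X is X_i minus
    this difference. *)
Lemma vanishing_square_integrable (V : zmodType) (B : borel M -> V -> V -> R)
    (mf : (borel M -> V) -> Prop) (hB : pairing B mf) (I : Type) (F : set_system I)
    {FF : ProperFilter F} (X_ : I -> borel M -> V) (X : borel M -> V) :
  (forall i, square_integrable dg B mf (X_ i)) -> mf X ->
  vanishing F (fun i => sqnorm dg B (fun x => X_ i x - X x)) ->
  square_integrable dg B mf X.
Proof.
move=> hX_ mX /(_ 1 ltr01) /filter_ex [i hi].
have hD : square_integrable dg B mf (fun x => X_ i x - X x).
  split; last exact: le_lt_trans hi (ltry _).
  by apply: (pair_mfD hB); [case: (hX_ i)|exact: (pair_mfN hB)].
have -> : X = (fun x => X_ i x - (X_ i x - X x)).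
  by apply/funext => x; rewrite opprB addrC subrK.
exact: (square_integrableB hB).
Qed.

Lemma field_L2_vanishing (I : Type) (F : set_system I) {FF : Filter F}
    (X_ : I -> M -> 'rV[R[i]]_d) :
  field_L2_norm dg (X_ i) @[i --> F] --> 0%E -> vanishing F (fun i => fsqnorm (X_ i)).
Proof.
move=> hX; rewrite /sqnorm.
have := @Lnorm_vanishing _ _ R dg _ F FF 1 (fun i x => Num.sqrt (cnorm2_at x (X_ i x)))
  (fun i x => sqrtr_ge0 _) hX.
move=> h eps e0; have := h eps e0; apply: filterS => i.
have E x : Num.sqrt (cnorm2_at x (X_ i x)) ^+ 2 = cnorm2_at x (X_ i x).
  by rewrite sqr_sqrtr // addr_ge0 // inner_at_ge0.
by under eq_integral do rewrite E.
Qed.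

Lemma csmooth_square_integrable h : csmooth h -> csquare_integrable h.
Proof.
case: hdg => lam hlam hvol [/smooth_C1 h1 /smooth_C1 h2].
have c1 := C1_manifold_continuous h1; have c2 := C1_manifold_continuous h2.
split.
  by split; [exact: (continuous_measurable_M c1)|exact: (continuous_measurable_M c2)].
have cz : continuous (fun x => zdot (h x) (h x)).
  by move=> x; exact: (continuousD (continuousM (c1 x) (c1 x)) (continuousM (c2 x) (c2 x))).
have /integrableP [_] := continuous_M_integrable hlam hvol cz.
rewrite (_ : (\int[dg]_x _)%E = csqnorm h) //; apply: eq_integral => x _.
by rewrite /= ger0_norm // zdot_ge0.
Qed.

Lemma map_Re_cgrad (h : M -> R[i]) (x : M) :
  map_mx (@complex.Re R) (smooth_cgrad h x) = smooth_grad (fun z => complex.Re (h z)) x.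
Proof. by apply/rowP => k; rewrite !mxE. Qed.

Lemma map_Im_cgrad (h : M -> R[i]) (x : M) :
  map_mx (@complex.Im R) (smooth_cgrad h x) = smooth_grad (fun z => complex.Im (h z)) x.
Proof. by apply/rowP => k; rewrite !mxE. Qed.

Lemma field_dot_cgrad (h k : M -> R[i]) x :
  field_dot x (smooth_cgrad h x) (smooth_cgrad k x) =
  grad_dot (fun z => complex.Re (h z)) (fun z => complex.Re (k z)) x +
  grad_dot (fun z => complex.Im (h z)) (fun z => complex.Im (k z)) x.
Proof. by rewrite /field_dot !map_Re_cgrad !map_Im_cgrad. Qed.

Lemma cgrad_square_integrable h : csmooth h -> fsquare_integrable (smooth_cgrad h).
Proof.
case: hdg => lam hlam hvol [/smooth_C1 h1 /smooth_C1 h2]; split.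
  move=> k; split; under eq_fun do rewrite mxE /=; exact: smooth_grad_measurable.
have cz : continuous (fun x => field_dot x (smooth_cgrad h x) (smooth_cgrad h x)).
  have -> : (fun x => field_dot x (smooth_cgrad h x) (smooth_cgrad h x)) =
      (grad_dot (fun z => complex.Re (h z)) (fun z => complex.Re (h z)) : M -> R)
      + grad_dot (fun z => complex.Im (h z)) (fun z => complex.Im (h z)).
    by apply/funext => x; rewrite field_dot_cgrad.
  by move=> x; exact: (continuousD (@grad_dot_continuous _ _ _ _ _ h1 h1 x)
    (@grad_dot_continuous _ _ _ _ _ h2 h2 x)).
have /integrableP [_] := continuous_M_integrable hlam hvol cz.
rewrite (_ : (\int[dg]_x _)%E = fsqnorm (smooth_cgrad h)) //; apply: eq_integral => x _.
by rewrite /= ger0_norm // (pair_ge0 (field_dot_pairing M)).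
Qed.

Lemma claplacian_square_integrable h : csmooth h -> csquare_integrable (smooth_claplacian h).
Proof.
case: hdg => lam hlam hvol [h1 h2].
have c1 := smooth_laplacian_continuous hlam hvol h1.
have c2 := smooth_laplacian_continuous hlam hvol h2.
split.
  by split; [exact: (continuous_measurable_M c1)|exact: (continuous_measurable_M c2)].
have cz : continuous (fun x => zdot (smooth_claplacian h x) (smooth_claplacian h x)).
  by move=> x; exact: (continuousD (continuousM (c1 x) (c1 x)) (continuousM (c2 x) (c2 x))).
have /integrableP [_] := continuous_M_integrable hlam hvol cz.
rewrite (_ : (\int[dg]_x _)%E = csqnorm (smooth_claplacian h)) //.
by apply: eq_integral => x _; rewrite /= ger0_norm // zdot_ge0.
Qed.

Lemma csmooth_green h k : csmooth h -> csmooth k ->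
  \int[dg]_(x in [set: borel M]) field_dot x (smooth_cgrad h x) (smooth_cgrad k x) =
  - \int[dg]_(x in [set: borel M]) zdot (h x) (smooth_claplacian k x).
Proof.
case: hdg => lam hlam hvol [h1 h2] [k1 k2].
under eq_Rintegral do rewrite field_dot_cgrad.
have int1 := continuous_M_integrable hlam hvol.
have cL := smooth_laplacian_continuous hlam hvol.
rewrite RintegralD //; try (apply: int1; apply: grad_dot_continuous; exact: smooth_C1).
rewrite /zdot RintegralD //.
- rewrite opprD; congr (_ + _).
    by rewrite -[LHS]opprK -(green_C1 hlam hvol (smooth_C1 h1) k1).
  by rewrite -[LHS]opprK -(green_C1 hlam hvol (smooth_C1 h2) k2).
- apply: (int1 (fun x => complex.Re (h x) * smooth_laplacian (fun z => complex.Re (k z)) x)).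
  move=> x; apply: continuousM; last exact: cL.
  exact: (C1_manifold_continuous (smooth_C1 h1)).
- apply: (int1 (fun x => complex.Im (h x) * smooth_laplacian (fun z => complex.Im (k z)) x)).
  move=> x; apply: continuousM; last exact: cL.
  exact: (C1_manifold_continuous (smooth_C1 h2)).
Qed.

Lemma H2_with_square_integrable f G w : H2_with dg f G w ->
  [/\ csquare_integrable f, fsquare_integrable G & csquare_integrable w].
Proof.
move=> [mf mG mw [h [sh v1 v2 v3]]].
have {}v1 : vanishing \oo (fun n => csqnorm (fun x => h n x - f x)).
  exact: L2_vanishing.
have {}v2 : vanishing \oo (fun n => fsqnorm (fun x => smooth_cgrad (h n) x - G x)).
  exact: field_L2_vanishing.
have {}v3 : vanishing \oo (fun n => csqnorm (fun x => smooth_claplacian (h n) x - w x)).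
  exact: L2_vanishing.
split.
- apply: (vanishing_square_integrable (zdot_pairing M) (X_ := h) _ mf v1) => n.
  exact: csmooth_square_integrable.
- apply: (vanishing_square_integrable (field_dot_pairing M)
    (X_ := fun n => smooth_cgrad (h n)) _ mG v2) => n.
  exact: cgrad_square_integrable.
- apply: (vanishing_square_integrable (zdot_pairing M)
    (X_ := fun n => smooth_claplacian (h n)) _ mw v3) => n.
  exact: claplacian_square_integrable.
Qed.

(** Stated for all triples related by [H2_with], so that it applies to whichever representatives
    [H2_jet] selects. *)
Lemma H2_green f1 G1 w1 f2 G2 w2 : H2_with dg f1 G1 w1 -> H2_with dg f2 G2 w2 ->
  \int[dg]_(x in [set: borel M]) field_dot x (G1 x) (G2 x) =
  - \int[dg]_(x in [set: borel M]) zdot (f1 x) (w2 x).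
Proof.
move=> H1 H2.
have [s1 sG1 _] := H2_with_square_integrable H1.
have [_ sG2 s2] := H2_with_square_integrable H2.
case: H1 => _ _ _ [h [sh v1 vG1 _]]; case: H2 => _ _ _ [k [sk _ vG2 v2]].
have c1 : \int[dg]_(x in [set: borel M]) field_dot x (smooth_cgrad (h n) x) (smooth_cgrad (k n) x)
    @[n --> \oo] --> \int[dg]_(x in [set: borel M]) field_dot x (G1 x) (G2 x).
  apply: (pair_integral_cvg (field_dot_pairing M) _ _ sG1 sG2
    (X_ := fun n => smooth_cgrad (h n)) (Y_ := fun n => smooth_cgrad (k n))).
  - by apply: nearW => n; have [] := cgrad_square_integrable (sh n).
  - by apply: nearW => n; have [] := cgrad_square_integrable (sk n).
  - exact: field_L2_vanishing.
  - exact: field_L2_vanishing.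
have c2 : \int[dg]_(x in [set: borel M]) zdot (h n x) (smooth_claplacian (k n) x)
    @[n --> \oo] --> \int[dg]_(x in [set: borel M]) zdot (f1 x) (w2 x).
  apply: (pair_integral_cvg (zdot_pairing M) _ _ s1 s2
    (X_ := h) (Y_ := fun n => smooth_claplacian (k n))).
  - by apply: nearW => n; have [] := csmooth_square_integrable (sh n).
  - by apply: nearW => n; have [] := claplacian_square_integrable (sk n).
  - exact: L2_vanishing.
  - exact: L2_vanishing.
have c3 : \int[dg]_(x in [set: borel M]) field_dot x (smooth_cgrad (h n) x) (smooth_cgrad (k n) x)
    @[n --> \oo] --> - \int[dg]_(x in [set: borel M]) zdot (f1 x) (w2 x).
  apply: cvg_trans (cvgN c2); apply: near_eq_cvg; apply: nearW => n.
  by rewrite csmooth_green.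
exact: (cvg_unique (@Rhausdorff R) c1 c3).
Qed.

End H2_green.

(** * The energy identity *)

Lemma Rintegral_ae_eq d (T : measurableType d) (R : realType)
    (mu : {measure set T -> \bar R}) (f g : T -> R) :
  measurable_fun setT f -> measurable_fun setT g ->
  {ae mu, forall x, f x = g x} -> \int[mu]_x f x = \int[mu]_x g x.
Proof.
move=> mf mg fg; congr fine; apply: ae_eq_integral => //.
- exact/measurable_EFinP.
- exact/measurable_EFinP.
- by apply: filterS fg => x -> .
Qed.

Section energy.
Variables (R : realType) (d : nat) (M : closed_riemannian_manifold R d).
Variable dg : {measure set (borel M) -> \bar R}.
Hypothesis hdg : is_volume dg.
Implicit Types (f g : M -> R[i]).

Notation csqnorm := (@sqnorm _ (borel M) R dg R[i] (fun _ => @zdot R)).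
Notation csquare_integrable :=
  (@square_integrable _ (borel M) R dg R[i] (fun _ => @zdot R) (@cmeasurable R d M)).
Local Notation "<| f , g |>" := (\int[dg]_(x in [set: borel M]) zdot (f x) (g x))
  (at level 0, f at level 99, g at level 99).

Lemma zdotZl (c : R) (z w : R[i]) : zdot (c%:C%C * z) w = c * zdot z w.
Proof. by case: z w => [? ?] [? ?]; rewrite /zdot /=; ring. Qed.

Lemma zdot_real (a b : R) : zdot a%:C%C b%:C%C = a * b.
Proof. by rewrite /zdot /= mulr0 addr0. Qed.

Lemma zdot_integralZl (c : R) f g : csquare_integrable f -> csquare_integrable g ->
  <| (fun x => c%:C%C * f x), g |> = c * <| f, g |>.
Proof.
move=> hf hg; rewrite -RintegralZl //; last exact: (pair_integrable (zdot_pairing M)).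
by apply: eq_Rintegral => x _; rewrite zdotZl.
Qed.

Lemma zdot_integralBl f1 f2 g : csquare_integrable f1 -> csquare_integrable f2 ->
  csquare_integrable g -> <| (fun x => f1 x - f2 x), g |> = <| f1, g |> - <| f2, g |>.
Proof.
move=> h1 h2 hg; have zp := zdot_pairing M.
have /= -> := pair_integralDl zp h1 (square_integrableN zp h2) hg; congr (_ + _).
rewrite (pair_integralC dg zp (fun x => - f2 x)) /= (pair_integralNr zp hg h2).
by rewrite (pair_integralC dg zp g).
Qed.

(** Expanding the right-hand side leaves the mixed pairings of f1 with w2 and of f2 with w1. Both
    equal minus the integral of G1 against G2, by Green's formula and symmetry, and they cancel. *)
Lemma dirichlet_difference f1 G1 w1 f2 G2 w2 :
  H2_with dg f1 G1 w1 -> H2_with dg f2 G2 w2 ->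
  \int[dg]_x cnorm2_at x (G1 x) - \int[dg]_x cnorm2_at x (G2 x) =
  - <| (fun x => f1 x - f2 x), (fun x => w1 x + w2 x) |>.
Proof.
move=> h1 h2; have zp := zdot_pairing M; have fp := field_dot_pairing M.
have [s1 sG1 sw1] := H2_with_square_integrable hdg h1.
have [s2 sG2 sw2] := H2_with_square_integrable hdg h2.
have sw := square_integrableD zp sw1 sw2.
rewrite zdot_integralBl //.
have /= -> := pair_integralDr zp s1 sw1 sw2; have /= -> := pair_integralDr zp s2 sw1 sw2.
have e11 := H2_green hdg h1 h1; have e12 := H2_green hdg h1 h2.
have e21 := H2_green hdg h2 h1; have e22 := H2_green hdg h2 h2.
have := pair_integralC dg fp G1 G2; rewrite /= e12 e21 => esym.
(* On the diagonal [field_dot] is convertible to [cnorm2_at], so Green's formula applies to each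
   energy. *)
rewrite [X in X - _](_ : _ = - <| f1, w1 |>) //.
rewrite [X in _ - X](_ : _ = - <| f2, w2 |>) //.
by move: esym; move: (<| f1, w2 |>) (<| f2, w1 |>) => p q /oppr_inj ->; ring.
Qed.

Lemma potential_integrable f (v : M -> R) :
  csquare_integrable f -> csquare_integrable (fun x => f x * (v x)%:C%C) ->
  dg.-integrable setT (EFin \o (fun x : borel M => Normc.normc (f x) ^+ 2 * v x)).
Proof.
move=> hf hfv; apply: eq_integrable (pair_integrable (zdot_pairing M) hfv hf) => // x _ /=.
by rewrite normc_sqr; case: (f x) => a b; rewrite /zdot /=; congr EFin; ring.
Qed.

(** Pointwise, |f1|^2 v1 - |f2|^2 v2 = (|f1|^2 - |f2|^2) v1 + (v1 - v2) |f2|^2, and the first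
    bracket is the pairing of f1 - f2 with f1 + f2. Each time increment thus stands alone in one
    slot of the pairing. *)
Lemma potential_difference f1 (v1 : M -> R) f2 (v2 : M -> R) :
  csquare_integrable f1 -> csquare_integrable f2 ->
  csquare_integrable (fun x => (v1 x)%:C%C) -> csquare_integrable (fun x => (v2 x)%:C%C) ->
  csquare_integrable (fun x => f1 x * (v1 x)%:C%C) ->
  csquare_integrable (fun x => f2 x * (v1 x)%:C%C) ->
  csquare_integrable (fun x => f2 x * (v2 x)%:C%C) ->
  csquare_integrable (fun x => (Normc.normc (f2 x) ^+ 2)%:C%C) ->
  \int[dg]_x (Normc.normc (f1 x) ^+ 2 * v1 x) - \int[dg]_x (Normc.normc (f2 x) ^+ 2 * v2 x) =
  <| (fun x => f1 x - f2 x), (fun x => f1 x * (v1 x)%:C%C) |>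
  + <| (fun x => f1 x - f2 x), (fun x => f2 x * (v1 x)%:C%C) |>
  + <| (fun x => (v1 x)%:C%C - (v2 x)%:C%C), (fun x => (Normc.normc (f2 x) ^+ 2)%:C%C) |>.
Proof.
move=> h1 h2 k1 k2 h11 h21 h22 hN; have zp := zdot_pairing M.
have hf := square_integrableB zp h1 h2; have hv := square_integrableB zp k1 k2.
have i1 := pair_integrable zp hf h11; have i2 := pair_integrable zp hf h21.
have i3 := pair_integrable zp hv hN.
rewrite -(RintegralB measurableT (potential_integrable h1 h11) (potential_integrable h2 h22)).
rewrite -(RintegralD measurableT i1 i2).
rewrite -(RintegralD measurableT (integrableD measurableT i1 i2) i3).
apply: eq_Rintegral => x _; rewrite !normc_sqr.
by case: (f1 x) (f2 x) => [a b] [a' b']; rewrite /zdot /=; ring.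
Qed.

End energy.

Section time.
Variables (R : realType) (T t : R).

Lemma near_in'_in : \forall s \near near_in' T t, s \in `[0, T] /\ s != t.
Proof.
rewrite /near_in' near_withinE; apply: filterS (nbhs_dnbhs_neq t) => s st /= hs.
by split.
Qed.

Lemma near_in'_sub (A : set R) : near_in T t A -> near_in' T t A.
Proof. by rewrite /near_in /near_in' /within /=; exact: nbhs_dnbhs. Qed.

End time.

Theorem proposition16 (R : realType) (d : nat) (hd : (2 <= d)%N)
    (M : closed_riemannian_manifold R d)
    (dg : {measure set (borel M) -> \bar R}) (hdg : is_volume dg)
    (kappa lambda : R) (hkappa : 0 < kappa)
    (hlambda : lambda = 1 \/ lambda = -1)
    (T : R) (hT : 0 < T)
    (u0 : M -> R[i]) (v0 : M -> R)
    (u u' : R -> M -> R[i]) (v v' : R -> M -> R)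
    (hsmooth : sufficiently_smooth dg T u u' v v')
    (hsol : schrodinger_debye dg T kappa lambda u0 v0 u u' v v')
    (t : R) (ht : t \in `[0, T]) :
  has_time_derivative T
    (fun s => (\int[dg]_x cnorm2_at x (grad dg (u s) x))
              + (\int[dg]_x (Normc.normc (u s x) ^+ 2 * v s x)))
    t
    (kappa^-1 * (- (\int[dg]_x (Normc.normc (u t x) ^+ 2 * v t x))
                 + lambda * (\int[dg]_x (Normc.normc (u t x) ^+ 4)))).
Proof.
case: hsmooth => hu [cu cu' du] u4 [cv cv' dv] v4.
case: hsol => eq_u eq_v _ _.
have zp := zdot_pairing M.
pose vc s x : R[i] := (v s x)%:C%C; pose vc' s x : R[i] := (v' s x)%:C%C.
pose L s := laplacian dg (u s).
pose csq := @sqnorm _ (borel M) R dg R[i] (fun _ => @zdot R).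
pose csi := @square_integrable _ (borel M) R dg R[i] (fun _ => @zdot R) (@cmeasurable R d M).
(* On H^2 the chosen value is not the default one: [xget] returns an element of its nonempty set. *)
have jet s : s \in `[0, T] -> H2_with dg (u s) (grad dg (u s)) (L s).
  move=> hs; have [[G [w hGw]] _ _ _] := hu s hs.
  have : exists Gw, H2_with dg (u s) Gw.1 Gw.2 by exists (G, w).
  exact: (@xgetPex _ (fun=> 0, fun=> 0) [set Gw | H2_with dg (u s) Gw.1 Gw.2]).
have su s : s \in `[0, T] -> csi (u s).
  by move=> hs; have [] := H2_with_square_integrable hdg (jet s hs).
have sL s : s \in `[0, T] -> csi (L s).
  by move=> hs; have [] := H2_with_square_integrable hdg (jet s hs).
have su' s : s \in `[0, T] -> csi (u' s).
  by move=> hs; apply: in_L2P; case: (cu' s hs).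
have sv s : s \in `[0, T] -> csi (vc s).
  by move=> hs; apply: in_L2P; case: (cv s hs).
have sv' s : s \in `[0, T] -> csi (vc' s).
  by move=> hs; apply: in_L2P; case: (cv' s hs).
have qu s : s \in `[0, T] -> cmeasurable (u s) /\ (quartic dg (u s) < +oo)%E.
  by move=> hs; apply: in_L4P; case: (u4 s hs).
have qv s : s \in `[0, T] -> cmeasurable (vc s) /\ (quartic dg (vc s) < +oo)%E.
  by move=> hs; apply: in_L4P; case: (v4 s hs).
have suv r s : r \in `[0, T] -> s \in `[0, T] -> csi (fun x => u r x * vc s x).
  move=> hr hs; have [? ?] := qu r hr; have [? ?] := qv s hs.
  exact: L4_mul_square_integrable.
pose N x : R[i] := (Normc.normc (u t x) ^+ 2)%:C%C.
have [mut qut] := qu t ht; have [mvt qvt] := qv t ht.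
(* The squared L^2 norm of [N] is the fourth power of the L^4 norm of [u t]. *)
have sN : csi N.
  split.
    apply: cmeasurable_real; under eq_fun do rewrite normc_sqr.
    exact: measurable_zdot.
  rewrite /sqnorm; apply: le_lt_trans qut; rewrite le_eqVlt; apply/orP; left; apply/eqP.
  by apply: eq_integral => x _; rewrite zdot_real normc_sqr.
pose F := near_in' T t.
have FF : Filter F by exact: within_filter.
have Fin : \forall s \near F, s \in `[0, T] /\ s != t by exact: near_in'_in.
have FinT : \forall s \near F, s \in `[0, T] by apply: filterS Fin => s [].
(* [X] and [V] are the difference quotients at time [t], with L^2 limits [u'] and [v']. *)
pose X s x : R[i] := ((s - t)^-1)%:C%C * (u s x - u t x).
pose V s x : R[i] := ((s - t)^-1)%:C%C * (vc s x - vc t x).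
have cmZ (c : R) (f : M -> R[i]) : cmeasurable f -> cmeasurable (fun x => c%:C%C * f x).
  by move=> mf; apply: cmeasurableM => //; split; exact: measurable_cst.
have mX : \forall s \near F, cmeasurable (X s).
  apply: filterS FinT => s hs; apply: cmZ.
  by have [] := square_integrableB zp (su s hs) (su t ht).
have mV : \forall s \near F, cmeasurable (V s).
  apply: filterS FinT => s hs; apply: cmZ.
  by have [] := square_integrableB zp (sv s hs) (sv t ht).
have vX : vanishing F (fun s => csq (fun x => X s x - u' t x)).
  by apply: L2_vanishing; exact: du t ht.
have vV : vanishing F (fun s => csq (fun x => V s x - vc' t x)).
  by apply: L2_vanishing; exact: dv t ht.
have sub (e : R -> \bar R) : e s @[s --> near_in T t] --> 0%E -> e s @[s --> F] --> 0%E.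
  by move=> he A /he hA; exact: near_in'_sub.
(* The limit is kept as the sum [L t x + L t x], which suits a pairing that is only biadditive. *)
have vL : vanishing F (fun s => csq (fun x => (L s x + L t x) - (L t x + L t x))).
  have [_ _ _ /sub hL] := hu t ht.
  have h : vanishing F (fun s => csq (fun x => L s x - L t x)) by exact: L2_vanishing.
  have E s : (fun x => (L s x + L t x) - (L t x + L t x)) = (fun x => L s x - L t x).
    by apply/funext => x; rewrite opprD addrACA subrr addr0.
  by move=> e e0; apply: filterS (h e e0) => s; rewrite E.
have vu4 : vanishing F (fun s => quartic dg (fun x => u s x - u t x)).
  by apply: L4_vanishing; apply: sub; case: (u4 t ht).
have vv4 : vanishing F (fun s => quartic dg (fun x => vc s x - vc t x)).
  by apply: L4_vanishing; apply: sub; case: (v4 t ht).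
(* Constant families are treated as convergent ones, so that the same product and pairing lemmas
   cover [u t x * vc s x] and the fixed factor [N]. *)
have v0' : vanishing F (fun s => quartic dg (fun x => u t x - u t x)).
  move=> e e0; apply: filterE => s; rewrite /quartic.
  under eq_integral do rewrite subrr /zdot /= mulr0 addr0 expr0n.
  by rewrite integral0 lee_fin ltW.
have mu_ : \forall s \near F, cmeasurable (u s).
  by apply: filterS FinT => s /qu [].
have mv_ : \forall s \near F, cmeasurable (vc s).
  by apply: filterS FinT => s /qv [].
have vW1 : vanishing F (fun s => csq (fun x => u s x * vc s x - u t x * vc t x)).
  exact: (L4_mul_vanishing mu_ mv_ mut qut mvt qvt vu4 vv4).
have vW2 : vanishing F (fun s => csq (fun x => u t x * vc s x - u t x * vc t x)).
  by apply: (L4_mul_vanishing _ mv_ mut qut mvt qvt v0' vv4); exact: filterE.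
have vN : vanishing F (fun s => csq (fun x => N x - N x)).
  move=> e e0; apply: filterE => s; rewrite /csq /sqnorm.
  under eq_integral do rewrite subrr /zdot /= mulr0 addr0.
  by rewrite integral0 lee_fin ltW.
have sLL := square_integrableD zp (sL t ht) (sL t ht).
have c1 : \int[dg]_(x in [set: borel M]) zdot (X s x) (L s x + L t x) @[s --> F] -->
    \int[dg]_(x in [set: borel M]) zdot (u' t x) (L t x + L t x).
  apply: (pair_integral_cvg zp mX _ (su' t ht) sLL vX
     (Y_ := fun s x => L s x + L t x) vL).
  by apply: filterS FinT => s hs; have [] := square_integrableD zp (sL s hs) (sL t ht).
have c2 : \int[dg]_(x in [set: borel M]) zdot (X s x) (u s x * vc s x) @[s --> F] -->
    \int[dg]_(x in [set: borel M]) zdot (u' t x) (u t x * vc t x).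
  apply: (pair_integral_cvg zp mX _ (su' t ht) (suv t t ht ht) vX
     (Y_ := fun s x => u s x * vc s x) vW1).
  by apply: filterS FinT => s hs; have [] := suv s s hs hs.
have c3 : \int[dg]_(x in [set: borel M]) zdot (X s x) (u t x * vc s x) @[s --> F] -->
    \int[dg]_(x in [set: borel M]) zdot (u' t x) (u t x * vc t x).
  apply: (pair_integral_cvg zp mX _ (su' t ht) (suv t t ht ht) vX
     (Y_ := fun s x => u t x * vc s x) vW2).
  by apply: filterS FinT => s hs; have [] := suv t s ht hs.
have c4 : \int[dg]_(x in [set: borel M]) zdot (V s x) (N x) @[s --> F] -->
    \int[dg]_(x in [set: borel M]) zdot (vc' t x) (N x).
  apply: (pair_integral_cvg zp mV _ (sv' t ht) sN vV (Y_ := fun _ => N) vN).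
  by apply: filterE => s; case: sN.
have key : - (\int[dg]_(x in [set: borel M]) zdot (u' t x) (L t x + L t x))
    + (\int[dg]_(x in [set: borel M]) zdot (u' t x) (u t x * vc t x))
    + (\int[dg]_(x in [set: borel M]) zdot (u' t x) (u t x * vc t x))
    + (\int[dg]_(x in [set: borel M]) zdot (vc' t x) (N x)) =
    kappa^-1 * (- (\int[dg]_x (Normc.normc (u t x) ^+ 2 * v t x))
                 + lambda * (\int[dg]_x (Normc.normc (u t x) ^+ 4))).
  have mu' : cmeasurable (u' t) by case: (su' t ht).
  have mL : cmeasurable (L t) by case: (sL t ht).
  have muv : cmeasurable (fun x => u t x * vc t x) by case: (suv t t ht ht).
  have -> : \int[dg]_(x in [set: borel M]) zdot (u' t x) (u t x * vc t x) =
      \int[dg]_(x in [set: borel M]) zdot (u' t x) (L t x).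
    apply: Rintegral_ae_eq; try exact: measurable_zdot.
    apply: filterS (eq_u t ht) => x /= <-.
    rewrite -/(L t x); case: (u' t x) (L t x) => [a b] [a' b'].
    by rewrite /zdot /=; ring.
  have /= -> := pair_integralDr zp (su' t ht) (sL t ht) (sL t ht).
  (* The pairings of [u'] with the Laplacian cancel, and only the term with [v'] is left. *)
  rewrite opprD -!addrA addrCA addKr addrA addNr add0r.
  have iN := potential_integrable (su t ht) (suv t t ht ht).
  have iq := pair_integrable zp sN sN.
  have iq' : dg.-integrable setT (EFin \o (fun x : borel M => Normc.normc (u t x) ^+ 4)).
    by apply: eq_integrable iq => // x _ /=; rewrite zdot_real -exprD.
  (* The right-hand side is gathered into a single integral, so that the second equation can be
     applied almost everywhere under it. *)
  rewrite -mulN1r -RintegralZl // -RintegralZl //.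
  have j1 : dg.-integrable setT
      (EFin \o (fun x : borel M => -1 * (Normc.normc (u t x) ^+ 2 * v t x))).
    by apply: eq_integrable (integrableZl measurableT (-1) iN).
  have j2 : dg.-integrable setT (EFin \o (fun x : borel M => lambda * Normc.normc (u t x) ^+ 4)).
    by apply: eq_integrable (integrableZl measurableT lambda iq').
  rewrite -(RintegralD measurableT j1 j2) -RintegralZl //; last first.
    exact: (integrableD measurableT j1 j2).
  have mr : measurable_fun [set: borel M] (fun x : borel M => Normc.normc (u t x) ^+ 2).
    by under eq_fun do rewrite normc_sqr; exact: measurable_zdot.
  apply: Rintegral_ae_eq.
  - by apply: measurable_zdot; [case: (sv' t ht)|case: sN].
  - have /measurable_EFinP := measurable_int _ (integrableD measurableT j1 j2).
    by move=> m; apply: measurable_funM => //; exact: measurable_cst.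
  - apply: filterS (eq_v t ht) => x /= hx; rewrite zdot_real.
    have -> : v' t x = kappa^-1 * (lambda * Normc.normc (u t x) ^+ 2 - v t x).
      by rewrite -hx addrK mulKf // gt_eqF.
    by move: (Normc.normc (u t x)) (v t x) => n w; ring.
rewrite /has_time_derivative -key.
set l1 := Rintegral _ _ _ in c1 *; set l2 := Rintegral _ _ _ in c2 c3 *.
set l4 := Rintegral _ _ _ in c4 *.
pose E s := (\int[dg]_x cnorm2_at x (grad dg (u s) x))
  + (\int[dg]_x (Normc.normc (u s x) ^+ 2 * v s x)).
have c : - (\int[dg]_(x in [set: borel M]) zdot (X s x) (L s x + L t x))
    + (\int[dg]_(x in [set: borel M]) zdot (X s x) (u s x * vc s x))
    + (\int[dg]_(x in [set: borel M]) zdot (X s x) (u t x * vc s x))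
    + (\int[dg]_(x in [set: borel M]) zdot (V s x) (N x)) @[s --> F] --> - l1 + l2 + l2 + l4.
  exact: (cvgD (cvgD (cvgD (cvgN c1) c2) c3) c4).
(* For [s] in the time interval the difference quotient of the energy is exactly this combination of
   pairings, without remainder. *)
suff nE : {near F, (fun s => (s - t)^-1 * (E s - E t)) =1
    (fun s => - (\int[dg]_(x in [set: borel M]) zdot (X s x) (L s x + L t x))
    + (\int[dg]_(x in [set: borel M]) zdot (X s x) (u s x * vc s x))
    + (\int[dg]_(x in [set: borel M]) zdot (X s x) (u t x * vc s x))
    + (\int[dg]_(x in [set: borel M]) zdot (V s x) (N x)))}.
  by apply: cvg_trans c; apply: near_eq_cvg; apply: filterS nE => s ->.
apply: filterS Fin => s [hs st] /=.
have e1 := dirichlet_difference hdg (jet s hs) (jet t ht).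
have e2 := potential_difference (su s hs) (su t ht) (sv s hs) (sv t ht)
  (suv s s hs hs) (suv t s ht hs) (suv t t ht ht) sN.
have sd := square_integrableB zp (su s hs) (su t ht).
have sdv := square_integrableB zp (sv s hs) (sv t ht).
have sLs := square_integrableD zp (sL s hs) (sL t ht).
have /= z1 := zdot_integralZl (s - t)^-1 sd sLs.
have /= z2 := zdot_integralZl (s - t)^-1 sd (suv s s hs hs).
have /= z3 := zdot_integralZl (s - t)^-1 sd (suv t s ht hs).
have /= z4 := zdot_integralZl (s - t)^-1 sdv sN.
rewrite /X /V z1 z2 z3 z4 -mulrN -!mulrDr; congr (_ * _).
by rewrite /E opprD addrACA e1 e2 !addrA.
Qed.
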